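(* Let $(R,D)$ be a second-order regular overdetermined system of codimension $2$ with $2$ independent and $1$ dependent variables which is involutive (type (I)), let $(\Sigma(R),\hat D)$ be its rank $2$ prolongation, with decomposition $\Sigma(R)=\Sigma_0\cup\Sigma_1$ and filtration $\{F^p\}_{p=-1}^{-4}$ as defined in the context. (1) For any point $w\in\Sigma_0$, the symbol algebra $\mathfrak f^0(w)$ of $(\Sigma(R),\{F^p\})$ at $w$ is isomorphic to the graded Lie algebra $\mathfrak f^0=\mathfrak f_{-4}\oplus\mathfrak f_{-3}\oplus\mathfrak f_{-2}\oplus\mathfrak f_{-1}$ with basis $\{X_0,X_1,X_2,X_{\omega_1},X_{\omega_2},X_\pi,X_a\}$, where $\mathfrak f_{-1}=\langle X_{\omega_1},X_{\omega_2},X_a\rangle$, $\mathfrak f_{-2}=\langle X_\pi\rangle$, $\mathfrak f_{-3}=\langle X_1,X_2\rangle$, $\mathfrak f_{-4}=\langle X_0\rangle$, whose bracket relations are $$[X_a,X_{\omega_2}]=X_\pi,\quad [X_\pi,X_{\omega_2}]=X_2,\quad [X_1,X_{\omega_1}]=[X_2,X_{\omega_2}]=X_0,$$ all other brackets being trivial. (2) For any point $w\in\Sigma_1$, the symbol algebra $\mathfrak f^1(w)$ of $(\Sigma(R),\{F^p\})$ at $w$ is isomorphic to the graded Lie algebra $\mathfrak f^1=\mathfrak f_{-4}\oplus\mathfrak f_{-3}\oplus\mathfrak f_{-2}\oplus\mathfrak f_{-1}$ with basis $\{X_0,X_1,X_2,X_{\omega_1},X_{\omega_2},X_\pi,X_b\}$,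 where $\mathfrak f_{-1}=\langle X_{\omega_1},X_\pi,X_b\rangle$, $\mathfrak f_{-2}=\langle X_{\omega_2}\rangle$, $\mathfrak f_{-3}=\langle X_1,X_2\rangle$, $\mathfrak f_{-4}=\langle X_0\rangle$, whose bracket relations are $$[X_b,X_\pi]=X_{\omega_2},\quad [X_\pi,X_{\omega_2}]=X_2,\quad [X_1,X_{\omega_1}]=X_0,$$ all other brackets being trivial.
   Context: Let $J^1=J^1(\mathbb R^2,\mathbb R)=\{(x,y,z,p,q)\}$, $J^2=J^2(\mathbb R^2,\mathbb R)=\{(x,y,z,p,q,r,s,t)\}$, let $\pi^2_1:J^2\to J^1$ be the natural projection, and let $C^2$ be the canonical system on $J^2$ defined by $\varpi_0=\varpi_1=\varpi_2=0$ with $\varpi_0=dz-p\,dx-q\,dy$, $\varpi_1=dp-r\,dx-s\,dy$, $\varpi_2=dq-s\,dx-t\,dy$. A second-order regular overdetermined system (codimension $2$, with $2$ independent and $1$ dependent variables) is a non-empty subset $R=\{F=G=0\}\subset J^2$, with $F,G$ smooth, such that $(F_r,F_s,F_t)$ and $(G_r,G_s,G_t)$ are linearly independent on $R$, together with $D=C^2|_R$, a rank $3$ subbundle of $TR$ on the $6$-dimensional manifold $R$. $(R,D)$ is involutive (type (I)) if around every point of $R$ there is a coframe $\{\varpi_0,\varpi_1,\varpi_2,\omega_1,\omega_2,\pi\}$ of $R$, with $\varpi_0$ the restriction to $R$ of $dz-p\,dx-q\,dy$ and $D=\{\varpi_0=\varpi_1=\varpi_2=0\}$, such that $d\varpi_0\equiv\omega_1\wedge\varpi_1+\omega_2\wedge\varpi_2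 \pmod{\varpi_0}$, $d\varpi_1\equiv 0$ and $d\varpi_2\equiv\omega_2\wedge\pi \pmod{\varpi_0,\varpi_1,\varpi_2}$. Rank $2$ prolongation. A $2$-dimensional integral element of $D$ at $x\in R$ is a $2$-dimensional subspace $v\subset D(x)$ with $d\varpi_i|_v=0$ for $i=0,1,2$. $\Sigma(R)$ is the set of all $2$-dimensional integral elements of $D$ at all points of $R$, with projection $p:\Sigma(R)\to R$; for involutive $(R,D)$ it is a smooth submanifold (of dimension $7$) of the Grassmann bundle $J(D,2)$ of $2$-planes in $D$. The canonical system is $\hat D(u)=p_*^{-1}(u)=\{v\in T_u\Sigma(R)\mid p_*(v)\in u\}$ for $u\in\Sigma(R)$; it has rank $3$. Decomposition. $\Sigma_i=\{w\in\Sigma(R)\mid \dim(w\cap \operatorname{Ker}(\pi^2_1|_R)_* )=i\}$, $i=0,1$, so $\Sigma(R)=\Sigma_0\cup\Sigma_1$. Filtration. $F^{-4}=T\Sigma(R)$, $F^{-3}=\{p^*\varpi_0=0\}$, $F^{-2}=p_*^{-1}(D)=\{p^*\varpi_0=p^*\varpi_1=p^*\varpi_2=0\}$ (which equals the derived system $\partial\hat D=\hat D+[\hat D,\hat D]$), $F^{-1}=\hat D$, $F^0=0$. Symbol algebra. For a manifold with a filtration $\{F^p\}_{p<0}$ of its tangent bundle by subbundles, $F^p\supset F^{p+1}$, satisfying $[\Gamma(F^p),\Gamma(F^q)]\subset\Gamma(F^{p+q})$, put $\mathfrak f_p(w)=F^p(w)/F^{p+1}(w)$ and $\mathfrak f(w)=\bigoplus_{p<0}\mathfrak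 f_p(w)$. For $X\in\mathfrak f_p(w)$, $Y\in\mathfrak f_q(w)$, the bracket $[X,Y]\in\mathfrak f_{p+q}(w)$ is the class of $[\tilde X,\tilde Y]_w$, where $\tilde X\in\Gamma(F^p)$, $\tilde Y\in\Gamma(F^q)$ are local sections extending representatives of $X,Y$; this is independent of choices and makes $\mathfrak f(w)$ a nilpotent graded Lie algebra, the symbol algebra at $w$. Isomorphism means isomorphism of graded Lie algebras; $\langle\cdot\rangle$ denotes linear span. *)

(* Defs.v *)
From HB Require Import structures.
From mathcomp Require Import all_boot all_order all_algebra.
From mathcomp Require Import all_classical all_reals all_analysis.

Set Implicit Arguments.
Unset Strict Implicit.
Unset Printing Implicit Defensive.

Import Order.TTheory GRing.Theory Num.Theory.
Import numFieldNormedType.Exports.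

Local Open Scope classical_set_scope.
Local Open Scope ring_scope.

(** * Smooth maps, tangent vectors and Lie brackets in an ambient space

    All manifolds below are embedded submanifolds of a finite-dimensional space.
    A local smooth section (function, form, vector field) over such a manifold
    is given by a smooth extension to an open subset of the ambient space. *)

Fixpoint Ck {R : realType} {V W : normedModType R} (k : nat) (U : set V)
    (f : V -> W) : Prop :=
  match k with
  | 0 => forall x, U x -> {for x, continuous f}
  | k'.+1 => (forall x, U x -> differentiable f x) /\
             (forall v : V, Ck k' U (fun x => 'D_v f x))
  end.

Definition smooth {R : realType} {V W : normedModType R} (U : set V)
    (f : V -> W) : Prop :=
  forall k, Ck k U f.

Definition tangent {R : realType} {V : normedModType R} (S : set V) (x : V) :
    set V :=
  [set v | exists (U : set R^o) (c : R^o -> V),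
     [/\ open U /\ U 0, smooth U c, forall t, U t -> S (c t), c 0 = x
       & 'D_1 c 0 = v]].

Definition lie_bracket {R : realType} {V : normedModType R} (X Y : V -> V)
    (x : V) : V :=
  'D_(X x) Y x - 'D_(Y x) X x.

(** * The symbol algebra of a filtered tangent bundle

    [F k x] is the fibre at [x] of F^{-k}; in particular [F 0 x] is F^0. *)

Definition local_section {R : realType} {V : normedModType R} (S : set V)
    (E : V -> set V) (x : V) (X : V -> V) : Prop :=
  exists U : set V,
    [/\ open U, U x, smooth U X & forall y, U y -> S y -> E y (X y)].

Definition linear_subset {R : realType} {V : normedModType R} (E : set V) :
    Prop :=
  E 0 /\ forall (a : R) (u v : V), E u -> E v -> E (a *: u + v).

(* The class of v modulo F^{-k+1}. *)
Definition symbol_class {R : realType} {V : normedModType R}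
    (F : nat -> V -> set V) (x : V) (k : nat) (v : V) : set V :=
  [set v' | F k.-1 x (v' - v)].

(* The quotient F^{-k}(x) / F^{-k+1}(x), as a set of cosets. *)
Definition symbol_space {R : realType} {V : normedModType R}
    (F : nat -> V -> set V) (x : V) (k : nat) : set (set V) :=
  [set symbol_class F x k v | v in F k x].

(* The union of the classes of [X, Y]_x over all local sections X of F^{-k} and
   Y of F^{-l} extending representatives of A and B.  That it is a single
   element of [symbol_space F x (k + l)] says that such sections exist, that
   [X, Y]_x lies in F^{-(k+l)}, and that its class is independent of choices. *)
Definition symbol_bracket {R : realType} {V : normedModType R} (S : set V)
    (F : nat -> V -> set V) (x : V) (k l : nat) (A B : set V) : set V :=
  [set z | exists X Y : V -> V,
     [/\ local_section S (F k) x X, local_section S (F l) x Y, A (X x), B (Y x)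
       & symbol_class F x (k + l) (lie_bracket X Y x) z]].

(** * Graded Lie algebras given by a basis e_0, ..., e_(n-1)

    [gr k] lists the indices of the basis of the component of degree -k.
    A triple (i, j, k) in the table stands for [e_i, e_j] = e_k (and hence
    [e_j, e_i] = - e_k); all brackets not listed vanish. *)

Definition graded_part {R : realType} {n : nat} (gr : nat -> seq 'I_n)
    (k : nat) : set 'rV[R]_n :=
  [set v | v \in span [seq (delta_mx 0 i : 'rV[R]_n) | i <- gr k]].

Definition table_bracket {R : realType} {n : nat}
    (tbl : seq ('I_n * 'I_n * 'I_n)) (u v : 'rV[R]_n) : 'rV[R]_n :=
  \sum_(t <- tbl)
    (u 0 t.1.1 * v 0 t.1.2 - u 0 t.1.2 * v 0 t.1.1) *: delta_mx 0 t.2.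

Definition symbol_isomorphic {R : realType} {V : normedModType R} (S : set V)
    (F : nat -> V -> set V) (x : V) (n : nat) (gr : nat -> seq 'I_n)
    (tbl : seq ('I_n * 'I_n * 'I_n)) : Prop :=
  (forall k, linear_subset (F k x)) /\
  exists phi : nat -> set V -> 'rV[R]_n,
    [/\ forall k, (0 < k)%N ->
          set_bij (symbol_space F x k) (graded_part gr k) (phi k),
        forall k (a : R) u v, (0 < k)%N -> F k x u -> F k x v ->
          phi k (symbol_class F x k (a *: u + v)) =
          a *: phi k (symbol_class F x k u) + phi k (symbol_class F x k v)
      & forall k l A B, (0 < k)%N -> (0 < l)%N ->
          symbol_space F x k A -> symbol_space F x l B ->
          symbol_space F x (k + l)%N (symbol_bracket S F x k l A B) /\
          phi (k + l)%N (symbol_bracket S F x k l A B) =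
          table_bracket tbl (phi k A) (phi l B)].

(** * Differential forms on a space of row vectors

    A covector is a row vector, acting on vectors by [pairing]. *)

Definition pairing {R : realType} {n : nat} (a v : 'rV[R]_n) : R :=
  (a *m v^T) 0 0.

Definition wedge {R : realType} {n : nat} (a b u v : 'rV[R]_n) : R :=
  pairing a u * pairing b v - pairing a v * pairing b u.

Definition ext_d {R : realType} {n : nat} (th : 'rV[R]_n -> 'rV[R]_n)
    (x u v : 'rV[R]_n) : R :=
  pairing ('D_u th x) v - pairing ('D_v th x) u.

(* Two 2-forms on T are congruent modulo the ideal generated by the covectors
   of ths. *)
Definition congr_mod {R : realType} {n : nat} (T : set 'rV[R]_n)
    (ths : seq 'rV[R]_n) (al be : 'rV[R]_n -> 'rV[R]_n -> R) : Prop :=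
  exists eta : nat -> 'rV[R]_n, forall u v, T u -> T v ->
    al u v - be u v = \sum_(i < size ths) wedge (eta i) ths`_i u v.

(* The covectors ths restrict to a basis of the dual of T. *)
Definition is_coframe {R : realType} {n m : nat} (T : set 'rV[R]_n)
    (ths : m.-tuple 'rV[R]_n) : Prop :=
  set_bij T [set: 'rV[R]_m] (fun v => \row_(i < m) pairing (tnth ths i) v).

(** * The jet space J^2(R^2, R), with coordinates (x, y, z, p, q, r, s, t) *)

Definition jx : 'I_8 := @Ordinal 8 0 isT.
Definition jy : 'I_8 := @Ordinal 8 1 isT.
Definition jz : 'I_8 := @Ordinal 8 2 isT.
Definition jp : 'I_8 := @Ordinal 8 3 isT.
Definition jq : 'I_8 := @Ordinal 8 4 isT.
Definition jr : 'I_8 := @Ordinal 8 5 isT.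
Definition js : 'I_8 := @Ordinal 8 6 isT.
Definition jt : 'I_8 := @Ordinal 8 7 isT.

(* The i-th coordinate vector field, and also the i-th coordinate covector. *)
Definition unit_vec {R : realType} (i : 'I_8) : 'rV[R]_8 := delta_mx 0 i.

Definition varpi0 {R : realType} (c : 'rV[R]_8) : 'rV[R]_8 :=
  unit_vec jz - c 0 jp *: unit_vec jx - c 0 jq *: unit_vec jy.
Definition varpi1 {R : realType} (c : 'rV[R]_8) : 'rV[R]_8 :=
  unit_vec jp - c 0 jr *: unit_vec jx - c 0 js *: unit_vec jy.
Definition varpi2 {R : realType} (c : 'rV[R]_8) : 'rV[R]_8 :=
  unit_vec jq - c 0 js *: unit_vec jx - c 0 jt *: unit_vec jy.

Definition C2 {R : realType} (c : 'rV[R]_8) : set 'rV[R]_8 :=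
  [set v | [/\ pairing (varpi0 c) v = 0, pairing (varpi1 c) v = 0
             & pairing (varpi2 c) v = 0]].

(* The projection J^2 -> J^1 is the linear map v |-> v *m pi21 onto the first
   five coordinates, so [kermx pi21] spans the kernel of its differential. *)
Definition pi21 (R : realType) : 'M[R]_(8, 5) := pid_mx 5.

(** * Regular overdetermined systems *)

Definition zero_set {R : realType} (F G : 'rV[R]_8 -> R) : set 'rV[R]_8 :=
  [set c | F c = 0 /\ G c = 0].

Definition grad_rst {R : realType} (F : 'rV[R]_8 -> R) (c : 'rV[R]_8) :
    'rV[R]_3 :=
  \row_(j < 3) 'D_(unit_vec (tnth [tuple jr; js; jt] j)) F c.

Definition regular_system {R : realType} (F G : 'rV[R]_8 -> R) : Prop :=
  [/\ smooth [set: 'rV[R]_8] F, smooth [set: 'rV[R]_8] G, zero_set F G !=set0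
    & forall c, zero_set F G c -> row_free (col_mx (grad_rst F c) (grad_rst G c))].

(* D = C^2 restricted to the submanifold M. *)
Definition contact {R : realType} (M : set 'rV[R]_8) (c : 'rV[R]_8) :
    set 'rV[R]_8 :=
  tangent M c `&` C2 c.

(* w1, w2 play the roles of varpi_1, varpi_2: they need not be the restrictions
   of the canonical forms of the same name, contrary to varpi_0. *)
Definition involutive_system {R : realType} (M : set 'rV[R]_8) : Prop :=
  forall c, M c ->
  exists (U : set 'rV[R]_8) (w1 w2 om1 om2 pi : 'rV[R]_8 -> 'rV[R]_8),
    [/\ open U, U c,
        [/\ smooth U w1, smooth U w2, smooth U om1, smooth U om2 & smooth U pi]
      & forall y, U y -> M y ->
        [/\ is_coframe (tangent M y)
              [tuple varpi0 y; w1 y; w2 y; om1 y; om2 y; pi y],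
            contact M y = tangent M y `&`
              [set v | [/\ pairing (varpi0 y) v = 0, pairing (w1 y) v = 0
                         & pairing (w2 y) v = 0]],
            congr_mod (tangent M y) [:: varpi0 y] (ext_d varpi0 y)
              (fun u v => wedge (om1 y) (w1 y) u v + wedge (om2 y) (w2 y) u v),
            congr_mod (tangent M y) [:: varpi0 y; w1 y; w2 y] (ext_d w1 y)
              (fun _ _ => 0)
          & congr_mod (tangent M y) [:: varpi0 y; w1 y; w2 y] (ext_d w2 y)
              (wedge (om2 y) (pi y))]].

(** * Rank 2 prolongation

    A 2-plane in R^8 is encoded by the matrix of the orthogonal projection onto
    it, whose row space is the plane; this embeds the Grassmann bundle of
    2-planes in TJ^2 as a submanifold of ['rV[R]_8 * 'M[R]_8]. *)

Definition is_plane {R : realType} (P : 'M[R]_8) : Prop :=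
  [/\ P^T = P, P *m P = P & \rank P = 2].

Definition integral_element {R : realType} (M : set 'rV[R]_8) (c : 'rV[R]_8)
    (P : 'M[R]_8) : Prop :=
  [/\ is_plane P,
      forall v : 'rV[R]_8, (v <= P)%MS -> contact M c v
    & forall u v : 'rV[R]_8, (u <= P)%MS -> (v <= P)%MS ->
        [/\ ext_d varpi0 c u v = 0, ext_d varpi1 c u v = 0
          & ext_d varpi2 c u v = 0]].

Definition Sigma {R : realType} (M : set 'rV[R]_8) :
    set ('rV[R]_8 * 'M[R]_8)%type :=
  [set w | M w.1 /\ integral_element M w.1 w.2].

(* An integral element lies in the tangent space of M, so its intersection with
   the kernel of the restricted differential is that with [kermx pi21]. *)
Definition Sigma_ {R : realType} (M : set 'rV[R]_8) (i : nat) :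
    set ('rV[R]_8 * 'M[R]_8)%type :=
  [set w | Sigma M w /\ \rank (w.2 :&: kermx (pi21 R))%MS = i].

(* [filtration M k] is F^{-k}; the projection p is [fst], and so is its
   differential. *)
Definition filtration {R : realType} (M : set 'rV[R]_8) (k : nat)
    (w : ('rV[R]_8 * 'M[R]_8)%type) : set ('rV[R]_8 * 'M[R]_8)%type :=
  match k with
  | 0 => [set 0]
  | 1 => [set v | tangent (Sigma M) w v /\ (v.1 <= w.2)%MS]
  | 2 => [set v | tangent (Sigma M) w v /\ contact M w.1 v.1]
  | 3 => [set v | tangent (Sigma M) w v /\ pairing (varpi0 w.1) v.1 = 0]
  | _ => tangent (Sigma M) w
  end.

(** * The model algebras

    Basis of f0: X_0, X_1, X_2, X_{omega_1}, X_{omega_2}, X_pi, X_a;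
    for f1, the last vector is X_b. *)

Definition X0 : 'I_7 := @Ordinal 7 0 isT.
Definition X1 : 'I_7 := @Ordinal 7 1 isT.
Definition X2 : 'I_7 := @Ordinal 7 2 isT.
Definition Xom1 : 'I_7 := @Ordinal 7 3 isT.
Definition Xom2 : 'I_7 := @Ordinal 7 4 isT.
Definition Xpi : 'I_7 := @Ordinal 7 5 isT.
Definition Xa : 'I_7 := @Ordinal 7 6 isT.
Definition Xb : 'I_7 := @Ordinal 7 6 isT.

Definition f0_grading (k : nat) : seq 'I_7 :=
  match k with
  | 1 => [:: Xom1; Xom2; Xa]
  | 2 => [:: Xpi]
  | 3 => [:: X1; X2]
  | 4 => [:: X0]
  | _ => [::]
  end.

Definition f0_table : seq ('I_7 * 'I_7 * 'I_7) :=
  [:: (Xa, Xom2, Xpi); (Xpi, Xom2, X2); (X1, Xom1, X0); (X2, Xom2, X0)].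

Definition f1_grading (k : nat) : seq 'I_7 :=
  match k with
  | 1 => [:: Xom1; Xpi; Xb]
  | 2 => [:: Xom2]
  | 3 => [:: X1; X2]
  | 4 => [:: X0]
  | _ => [::]
  end.

Definition f1_table : seq ('I_7 * 'I_7 * 'I_7) :=
  [:: (Xb, Xpi, Xom2); (Xpi, Xom2, X2); (X1, Xom1, X0)].

(* Main.v *)
Require Import Defs.
From HB Require Import structures.
From mathcomp Require Import all_boot all_order all_algebra perm.
From mathcomp Require Import all_classical all_reals all_analysis.
From mathcomp Require Import ring.
Set Implicit Arguments.
Unset Strict Implicit.
Unset Printing Implicit Defensive.
Import Order.TTheory GRing.Theory Num.Theory.
Import numFieldNormedType.Exports.
Local Open Scope classical_set_scope.
Local Open Scope ring_scope.

(** Integral elements of an involutive system are the planes of D containing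
    the vector dual to omega_1.  Over a point of Sigma_0 or Sigma_1 one can
    change omega_2 and pi linearly with constant coefficients into sg and ta so
    that the given plane is {ta = 0} in D; then nearby integral elements are
    {ta = a sg} with a the fibre coordinate, and d varpi_2 = +- sg /\ ta.  The
    differential of ta - a sg contributes [X_a, X_sg] = X_ta, the structure
    equations of D contribute the remaining brackets, and both cases differ
    only by which of sg, ta is omega_2.

    No implicit function theorem is needed: the coframe forces the set of
    velocities of curves in R to be all of ker dF and ker dG, and Sigma(R) is
    the image of a retraction defined near it over R, through which curves and
    vector fields are pushed.  Brackets are computed with Cartan's formula for
    1-forms vanishing along the submanifold. *)

(** * Smooth maps *)

Section Smooth.
Context {R : realType}.
Implicit Types V W X : normedModType R.

(** A tangent space is at the outset only a set of velocities, and a section only an ambient smooth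
    map that meets its conditions along the submanifold; neither linear structure nor intrinsic
    vector fields are given. What replaces them is one fact: a derivative in a tangent direction
    depends only on the values along the submanifold. Applied to theta(X) = theta(Y) = 0 it yields
    theta([X, Y]) = - d theta(X, Y), so the symbol coordinates of [X, Y] at a point depend only on X
    and Y at that point. This is the independence of choices in the symbol bracket, and the minus
    sign is what turns d varpi_2 = omega_2 /\ pi into [X_pi, X_omega_2] = X_2.

    The last two contact forms of the involutive coframe may differ from the canonical forms that
    define integral elements; both families only share their common kernel in the tangent space.
    Brackets of contact sections carry the integrality condition from one family to the other.

    On Sigma_1 the form omega_2 has degree -2, so omega_2 /\ varpi_2 would contribute in degree -5:
    this is why f1 lacks the bracket of X_2 and X_omega_2 that f0 has. *)

Lemma near_eq_differentiable V W (f g : V -> W) x :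
  (\near x, f x = g x) -> differentiable f x -> differentiable g x.
Proof.
move=> nfg df; have [cdf e] := (diff_locallyP x f).1 df.
have eg : g \o shift x = cst (g x) + 'd f x +o_ 0 id.
  apply/eqaddoP => _ /posnumP[eps].
  move/eqaddoP : e => /(_ _ (gt0 eps)).
  have nfg0 : \forall h \near (0 : V), f (h + x) = g (h + x).
    move: nfg; rewrite (near_shift 0)/= => nfg.
    by apply: filterS nfg => h /=; rewrite subr0.
  apply: filter_app; near=> h.
  rewrite /= !fctE /= -(nbhs_singleton nfg).
  by have -> : f (h + x) = g (h + x) by near: h.
have dg := diff_unique cdf eg.
apply/diff_locallyP; split; first by rewrite dg.
by rewrite dg.
Unshelve. all: by end_near. Qed.

(** A derivative at a point of [U] sees only nearby values, so openness of [U] allows each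
    derivative to be replaced by a formula valid on [U] alone. The closure properties below proceed
    by such replacements. *)
Lemma Ck_eq V W k (U : set V) (f g : V -> W) :
  open U -> (forall x, U x -> f x = g x) -> Ck k U f -> Ck k U g.
Proof.
move=> oU; elim: k f g => [|k IH] f g fg /=.
  move=> cf x Ux; have := cf x Ux; rewrite /prop_for /continuous_at.
  rewrite fg// => h; apply: cvg_trans h; apply: near_eq_cvg.
  by near=> y; rewrite fg//; near: y; exact: open_nbhs_nbhs.
have nfg x : U x -> \near x, f x = g x.
  by move=> Ux; near=> y; apply: fg; near: y; exact: open_nbhs_nbhs.
move=> [df dk]; split=> [x Ux|v].
  exact: near_eq_differentiable (nfg _ Ux) (df _ Ux).
by apply: IH (dk v) => x Ux; apply: near_eq_derive; exact: nfg.
Unshelve. all: by end_near. Qed.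

Lemma Ck_sub V W k (U U' : set V) (f : V -> W) :
  U' `<=` U -> Ck k U f -> Ck k U' f.
Proof.
move=> UU'; elim: k f => [|k IH] f /= => [cf x /UU'|[df dk]]; first exact: cf.
by split=> [x /UU'|v]; [exact: df|exact: IH].
Qed.

Lemma Ck_leS V W k (U : set V) (f : V -> W) : Ck k.+1 U f -> Ck k U f.
Proof.
elim: k f => [|k IH] f; first by move=> [df _] x /df /differentiable_continuous.
by move=> [df dk]; split=> // v; exact: IH.
Qed.

Lemma smooth_diff V W (U : set V) (f : V -> W) x :
  smooth U f -> U x -> differentiable f x.
Proof. by move=> sf Ux; have [df _] := sf 1%N; exact: df. Qed.

Lemma smooth_derive V W (U : set V) (f : V -> W) v :
  smooth U f -> smooth U (fun x => 'D_v f x).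
Proof. by move=> sf k; have [_ dk] := sf k.+1; exact: dk. Qed.

Lemma smooth_sub V W (U U' : set V) (f : V -> W) :
  U' `<=` U -> smooth U f -> smooth U' f.
Proof. by move=> UU' sf k; exact: Ck_sub (sf k). Qed.

Lemma Ck_cst V W k (U : set V) (w : W) : Ck k U (cst w).
Proof.
elim: k w => [|k IH] w /=; first by move=> x _; exact: cst_continuous.
split=> [x _|v]; first exact: differentiable_cst.
by rewrite (_ : (fun _ => _) = cst 0)//; apply/funext => x; exact: derive_cst.
Qed.

Lemma derive_linear_comp V W X (L : W -> X) (f : V -> W) x v :
  linear L -> continuous L -> differentiable f x ->
  differentiable (fun y => L (f y)) x /\
  'D_v (fun y => L (f y)) x = L ('D_v f x).
Proof.
move=> linL cL df.
(* The predicate [linear L] is bundled into a structure, the form in which the differential of a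
   linear map is computed. *)
pose L' := HB.pack_for {linear W -> X} L (GRing.isLinear.Build R W X *:%R L linL).
have dL : differentiable L' (f x) by exact: linear_differentiable.
have dLf : differentiable (L' \o f) x by exact: differentiable_comp.
split; first exact: dLf.
rewrite -[LHS]/('D_v (L' \o f) x) (deriveE v dLf) diff_comp// diff_lin//=.
by rewrite (deriveE v df).
Qed.

Lemma Ck_linear_comp V W X (L : W -> X) k (U : set V) (f : V -> W) :
  open U -> linear L -> continuous L -> Ck k U f -> Ck k U (fun y => L (f y)).
Proof.
move=> oU linL cL; elim: k f => [|k IH] f /=.
  move=> cf x Ux; apply: (@continuous_comp _ _ _ f L); first exact: cf.
  exact: cL.
move=> [df dk]; split=> [x Ux|v].
  exact: (derive_linear_comp 0 linL cL (df x Ux)).1.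
apply: Ck_eq (IH _ (dk v)) => // x Ux.
by rewrite (derive_linear_comp v linL cL (df x Ux)).2.
Qed.

Lemma linear_fun_diff V W (L : V -> W) x v :
  linear L -> continuous L -> differentiable L x /\ 'D_v L x = L v.
Proof.
move=> linL cL.
have := @derive_linear_comp V V W L id x v linL cL.
by rewrite derive_id; apply; exact: ex_diff.
Qed.

Lemma Ck_linear V W (L : V -> W) k (U : set V) :
  linear L -> continuous L -> Ck k U L.
Proof.
move=> linL cL; case: k => [|k] /=; first by move=> x _; exact: cL.
split=> [x _|v]; first exact: (linear_fun_diff x 0 linL cL).1.
rewrite (_ : (fun _ => _) = cst (L v)); first exact: Ck_cst.
by apply/funext => x; exact: (linear_fun_diff x v linL cL).2.
Qed.

Lemma Ck_add V W k (U : set V) (f g : V -> W) : open U ->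
  Ck k U f -> Ck k U g -> Ck k U (fun x => f x + g x).
Proof.
move=> oU; elim: k f g => [|k IH] f g /=.
  by move=> cf cg x Ux; apply: continuousD; [exact: cf|exact: cg].
move=> [df dkf] [dg dkg]; split=> [x Ux|v].
  by apply: differentiableD; [exact: df|exact: dg].
apply: Ck_eq (IH _ _ (dkf v) (dkg v)) => // x Ux.
by rewrite deriveD//; apply: diff_derivable; [exact: df|exact: dg].
Qed.

Lemma Ck_mul V k (U : set V) (f g : V -> R) : open U ->
  Ck k U f -> Ck k U g -> Ck k U (fun x => f x * g x).
Proof.
move=> oU; elim: k f g => [|k IH] f g.
  move=> cf cg x Ux; apply: (@continuousM _ _ f g).
    exact: cf.
  exact: cg.
move=> Hf Hg; have [df dkf] := Hf; have [dg dkg] := Hg; split=> [x Ux|v].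
  exact: differentiableM (df x Ux) (dg x Ux).
apply: (@Ck_eq _ _ k U (fun x => f x * 'D_v g x + g x * 'D_v f x)) => //.
  move=> x Ux; rewrite [RHS]deriveM//.
    by apply: diff_derivable; exact: df.
  by apply: diff_derivable; exact: dg.
by apply: Ck_add => //; [exact: IH (Ck_leS Hf) (dkg v)|exact: IH (Ck_leS Hg) (dkf v)].
Qed.

Lemma Ck_opp V k (U : set V) (f : V -> R) : open U ->
  Ck k U f -> Ck k U (fun x => - f x).
Proof.
move=> oU Hf.
apply: (@Ck_eq _ _ k U (fun x => -1 * f x)) => //.
  by move=> x Ux; rewrite mulN1r.
by apply: Ck_mul => //; exact: Ck_cst.
Qed.

(** The derivative of 1/f is a polynomial in 1/f and the derivative of f, so the induction on the
    order closes up. *)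
Lemma Ck_inv V k (U : set V) (f : V -> R) : open U ->
  (forall x, U x -> f x != 0) -> Ck k U f -> Ck k U (fun x => (f x)^-1).
Proof.
move=> oU f0; elim: k => [|k IH].
  by move=> cf x Ux; apply: continuousV; [exact: f0|exact: cf].
move=> Hf; have [df dkf] := Hf; split=> [x Ux|v].
  exact: differentiableV (df x Ux) (f0 x Ux).
apply: (@Ck_eq _ _ k U (fun x => - ((f x)^-1 * (f x)^-1 * 'D_v f x))) => //.
  move=> x Ux; rewrite [RHS]deriveV//; last first.
  - by apply: diff_derivable; exact: df.
  - exact: f0.
  by rewrite -scaleNr /= expr2 invfM.
have IH' := IH (Ck_leS Hf).
by apply: Ck_opp => //; apply: Ck_mul (dkf v) => //; exact: Ck_mul.
Qed.

Lemma Ck_scale V W k (U : set V) (f : V -> R) (w : W) : open U ->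
  Ck k U f -> Ck k U (fun x => f x *: w).
Proof.
move=> oU Hf; apply: (@Ck_linear_comp V R W (fun a => a *: w)) => //.
  by move=> a u v; rewrite scalerDl scalerA.
exact: scalel_continuous.
Qed.

Lemma Ck_sum V W k (U : set V) (I : Type) (r : seq I) (P : pred I)
    (f : I -> V -> W) : open U ->
  (forall i, P i -> Ck k U (f i)) -> Ck k U (fun x => \sum_(i <- r | P i) f i x).
Proof.
move=> oU Hf; elim: r => [|i r IH].
  by rewrite (_ : (fun _ => _) = cst 0); [exact: Ck_cst|apply/funext => x; rewrite big_nil].
have [Pi|nPi] := boolP (P i).
  rewrite (_ : (fun _ => _) = (fun x => f i x + \sum_(i <- r | P i) f i x)).
    by apply: Ck_add => //; exact: Hf.
  by apply/funext => x; rewrite big_cons Pi.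
by apply: Ck_eq IH => // x _; rewrite big_cons (negbTE nPi).
Qed.

Lemma Ck_prod V k (U : set V) (I : Type) (r : seq I) (P : pred I)
    (f : I -> V -> R) : open U ->
  (forall i, P i -> Ck k U (f i)) -> Ck k U (fun x => \prod_(i <- r | P i) f i x).
Proof.
move=> oU Hf; elim: r => [|i r IH].
  by rewrite (_ : (fun _ => _) = cst 1); [exact: Ck_cst|apply/funext => x; rewrite big_nil].
have [Pi|nPi] := boolP (P i).
  rewrite (_ : (fun _ => _) = (fun x => f i x * \prod_(i <- r | P i) f i x)).
    by apply: Ck_mul => //; exact: Hf.
  by apply/funext => x; rewrite big_cons Pi.
by apply: Ck_eq IH => // x _; rewrite big_cons (negbTE nPi).
Qed.

End Smooth.

(** * Smooth maps between finite-dimensional spaces: chain rule, matrices, inverses *)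

Section FinDim.
Context {R : realType}.
Implicit Types V W X : normedModType R.

Lemma linearZ_fun V W (L : V -> W) a u : linear L -> L (a *: u) = a *: L u.
Proof. by move=> linL; exact: (GRing.scalable_linear linL). Qed.

Lemma linearB_fun V W (L : V -> W) u v : linear L -> L (u - v) = L u - L v.
Proof. by move=> linL; exact: (GRing.zmod_morphism_linear linL). Qed.

Lemma linear0_fun V W (L : V -> W) : linear L -> L 0 = 0.
Proof. by move=> linL; rewrite -(subrr 0) linearB_fun// subrr. Qed.

(** Coordinates enter as continuous linear functionals that reproduce each vector. This form passes
    to products and lets smoothness be tested coordinate by coordinate without comparing norms. *)
Definition is_basis V (I : finType) (b : I -> V) (be : I -> V -> R) : Prop :=
  [/\ forall i, linear (be i), forall i, continuous (be i)
    & forall v, v = \sum_i be i v *: b i].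

Definition findim V : Prop :=
  exists (I : finType) (b : I -> V) (be : I -> V -> R), is_basis b be.

Lemma findim_real : findim R.
Proof.
exists unit, (fun=> 1), (fun=> id); split=> //.
- by move=> _ x; exact: cvg_id.
- by move=> v; rewrite (big_pred1 tt) => [|[]//]; rewrite /GRing.scale/= mulr1.
Qed.

Lemma linear_entry m n i j : linear (fun M : 'M[R]_(m, n) => M i j).
Proof. by move=> a u v; rewrite !mxE. Qed.

Lemma findim_mx m n : findim 'M[R]_(m, n).
Proof.
exists ('I_m * 'I_n)%type, (fun p => delta_mx p.1 p.2), (fun p (M : 'M[R]_(m, n)) => M p.1 p.2).
split=> [p|p|v].
- exact: linear_entry.
- exact: coord_continuous.
- by rewrite {1}(matrix_sum_delta v) pair_big.
Qed.

Lemma linear_fst V W : linear (@fst V W).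
Proof. by []. Qed.

Lemma linear_snd V W : linear (@snd V W).
Proof. by []. Qed.

Lemma continuous_fst V W : continuous (@fst V W).
Proof. by move=> x; exact: cvg_fst. Qed.

Lemma continuous_snd V W : continuous (@snd V W).
Proof. by move=> x; exact: cvg_snd. Qed.

Lemma findim_prod V W : findim V -> findim W -> findim (V * W)%type.
Proof.
move=> [I [b [be [lb cb eb]]]] [J [c [ga [lc cc ec]]]].
exists (I + J)%type, (fun k => match k with inl i => (b i, 0) | inr j => (0, c j) end),
  (fun k v => match k with inl i => be i v.1 | inr j => ga j v.2 end).
split=> [[i|j] a u v|[i|j] x|[v w]] /=.
- exact: lb.
- exact: lc.
- apply: (@continuous_comp _ _ _ fst (be i)); [exact: continuous_fst|exact: cb].
- apply: (@continuous_comp _ _ _ snd (ga j)); [exact: continuous_snd|exact: cc].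
- rewrite big_sumType/=.
  have e1 : \sum_i be i v *: (b i, 0 : W) = (v, 0).
    rewrite {2}(eb v) (big_morph (fun v => (v, 0 : W)) (id1 := 0) (op1 := +%R))//.
      by apply: eq_bigr => i _; congr pair; exact: scaler0.
    by move=> x y; congr pair; exact/esym/addr0.
  have e2 : \sum_j ga j w *: (0 : V, c j) = (0, w).
    rewrite {2}(ec w) (big_morph (fun w => (0 : V, w)) (id1 := 0) (op1 := +%R))//.
      by apply: eq_bigr => i _; congr pair; exact: scaler0.
    by move=> x y; congr pair; exact/esym/addr0.
  by rewrite e1 e2; congr pair; rewrite /= ?addr0 ?add0r.
Qed.

Lemma Ck_coord V W (I : finType) (b : I -> W) be k (U : set V) (f : V -> W) :
  is_basis b be -> open U ->
  (forall i, Ck k U (fun x => be i (f x))) -> Ck k U f.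
Proof.
move=> [_ _ eb] oU Hf.
apply: (@Ck_eq _ _ _ k U (fun x => \sum_i be i (f x) *: b i)) => //.
by apply: Ck_sum => // i _; exact: Ck_scale.
Qed.

Lemma derive_basis V W (I : finType) (b : I -> V) be (f : V -> W) x v :
  is_basis b be -> differentiable f x ->
  'D_v f x = \sum_i be i v *: 'D_(b i) f x.
Proof.
move=> [_ _ eb] df; rewrite deriveE// {1}(eb v) linear_sum.
by apply: eq_bigr => i _; rewrite linearZ/= -deriveE.
Qed.

Lemma derive_linear V W (f : V -> W) x : differentiable f x ->
  linear (fun v => 'D_v f x).
Proof. by move=> df a u v; rewrite !deriveE// linearP. Qed.

Lemma derive_chain V W X (c : W -> V) (f : V -> X) x v :
  differentiable c x -> differentiable f (c x) ->
  'D_v (fun y => f (c y)) x = 'D_('D_v c x) f (c x).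
Proof.
move=> dc df; have dfc := differentiable_comp dc df.
by rewrite -[LHS]/('D_v (f \o c) x) deriveE// diff_comp//= -!deriveE.
Qed.

Lemma Ck_mulv V W k (U : set V) (f : V -> R) (g : V -> W) : findim W ->
  open U -> Ck k U f -> Ck k U g -> Ck k U (fun x => f x *: g x).
Proof.
move=> [I [b [be hb]]] oU Hf Hg; have [lb cb _] := hb.
apply: (Ck_coord hb) => // i.
apply: (@Ck_eq _ _ _ k U (fun x => f x * be i (g x))) => //.
  by move=> x _; rewrite (linearZ_fun _ _ (lb i)).
by apply: Ck_mul => //; exact: Ck_linear_comp.
Qed.

(** [Ck] differentiates in constant directions, whereas the chain rule differentiates [f] in the
    moving direction ['D_v c]. Expanding that direction in a basis returns to constant directions
    with smooth coefficients. *)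
Lemma Ck_comp V W X k (U : set V) (U0 : set W) (c : W -> V) (f : V -> X) :
  findim V -> findim X -> open U -> open U0 -> (forall x, U0 x -> U (c x)) ->
  Ck k U0 c -> Ck k U f -> Ck k U0 (fun x => f (c x)).
Proof.
move=> [I [b [be hb]]] fX oU oU0 cU; have [lb cb eb] := hb.
elim: k f => [|k IH] f Hc Hf.
  move=> x Ux; apply: (@continuous_comp _ _ _ c f); first exact: Hc.
  by apply: Hf; exact: cU.
have [dc dkc] := Hc; have [df dkf] := Hf; split=> [x Ux|v].
  by apply: (differentiable_comp (dc _ Ux)); apply: df; exact: cU.
apply: (@Ck_eq _ _ _ k U0 (fun x => \sum_i be i ('D_v c x) *: 'D_(b i) f (c x))) => //.
  move=> x Ux; rewrite (derive_chain v (dc x Ux) (df _ (cU _ Ux))).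
  by rewrite -derive_basis//; apply: df; exact: cU.
apply: Ck_sum => // i _; apply: Ck_mulv => //.
  by apply: Ck_linear_comp => //; exact: dkc.
by apply: IH (dkf _); exact: Ck_leS.
Qed.

Lemma Ck_dirder V W k (U : set V) (f : V -> W) (Y : V -> V) :
  findim V -> findim W -> open U ->
  Ck k.+1 U f -> Ck k U Y -> Ck k U (fun x => 'D_(Y x) f x).
Proof.
move=> [I [b [be hb]]] fW oU [df dkf] HY; have [lb cb eb] := hb.
apply: (@Ck_eq _ _ _ k U (fun x => \sum_i be i (Y x) *: 'D_(b i) f x)) => //.
  by move=> x Ux; rewrite -derive_basis//; exact: df.
apply: Ck_sum => // i _; apply: Ck_mulv => //; last exact: dkf.
exact: Ck_linear_comp.
Qed.

Lemma Ck_entry V m n k (U : set V) (f : V -> 'M[R]_(m, n)) i j : open U ->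
  Ck k U f -> Ck k U (fun x => f x i j).
Proof.
move=> oU; apply: (@Ck_linear_comp _ V _ R (fun M : 'M[R]_(m, n) => M i j)) => //.
  exact: linear_entry.
exact: coord_continuous.
Qed.

Lemma Ck_mx V m n k (U : set V) (f : V -> 'M[R]_(m, n)) : open U ->
  (forall i j, Ck k U (fun x => f x i j)) -> Ck k U f.
Proof.
move=> oU Hf.
apply: (@Ck_eq _ _ _ k U (fun x => \sum_i \sum_j f x i j *: delta_mx i j)) => //.
  by move=> x _; rewrite -matrix_sum_delta.
by apply: Ck_sum => // i _; apply: Ck_sum => // j _; exact: Ck_scale.
Qed.

Lemma Ck_pair V W X k (U : set V) (f : V -> W) (g : V -> X) : open U ->
  Ck k U f -> Ck k U g -> Ck k U (fun x => (f x, g x)).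
Proof.
move=> oU Hf Hg.
have H1 : Ck k U (fun x => (f x, 0 : X)).
  apply: (@Ck_linear_comp _ V W _ (fun w => (w, 0 : X))) => //.
    by move=> a u v; congr pair; rewrite /= scaler0 addr0.
  by move=> w; apply: cvg_pair; [exact: cvg_id|exact: cvg_cst].
have H2 : Ck k U (fun x => (0 : W, g x)).
  apply: (@Ck_linear_comp _ V X _ (fun w => (0 : W, w))) => //.
    by move=> a u v; congr pair; rewrite /= scaler0 addr0.
  by move=> w; apply: cvg_pair; [exact: cvg_cst|exact: cvg_id].
apply: Ck_eq (Ck_add oU H1 H2) => // x _.
by congr pair; rewrite /= ?addr0 ?add0r.
Qed.

Lemma Ck_mulmx V m n p k (U : set V) (f : V -> 'M[R]_(m, n)) (g : V -> 'M[R]_(n, p)) :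
  open U -> Ck k U f -> Ck k U g -> Ck k U (fun x => f x *m g x).
Proof.
move=> oU Hf Hg; apply: Ck_mx => // i j.
apply: (@Ck_eq _ _ _ k U (fun x => \sum_l f x i l * g x l j)) => //.
  by move=> x _; rewrite mxE.
by apply: Ck_sum => // l _; apply: Ck_mul => //; exact: Ck_entry.
Qed.

Lemma Ck_det V n k (U : set V) (f : V -> 'M[R]_n) :
  open U -> Ck k U f -> Ck k U (fun x => \det (f x)).
Proof.
move=> oU Hf; rewrite /determinant.
apply: Ck_sum => // s _; apply: Ck_mul => //; first exact: Ck_cst.
by apply: Ck_prod => // i _; exact: Ck_entry.
Qed.

(** Cramer's rule: the inverse is the adjugate, polynomial in the entries, divided by a nonvanishing
    determinant. *)
Lemma Ck_invmx V n k (U : set V) (f : V -> 'M[R]_n) :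
  open U -> (forall x, U x -> f x \in unitmx) -> Ck k U f ->
  Ck k U (fun x => invmx (f x)).
Proof.
move=> oU uf Hf.
apply: (@Ck_eq _ _ _ k U (fun x => (\det (f x))^-1 *: \adj (f x))) => //.
  by move=> x Ux; rewrite /invmx uf.
apply: Ck_mulv => //; first exact: findim_mx.
  apply: Ck_inv => //; last exact: Ck_det.
  by move=> x Ux; rewrite -unitfE -unitmxE uf.
apply: Ck_mx => // i j.
apply: (@Ck_eq _ _ _ k U
  (fun x => (-1) ^+ (j + i) * \det (row' j (col' i (f x))))) => //.
  by move=> x _; rewrite mxE.
apply: Ck_mul => //; first exact: Ck_cst.
apply: Ck_det => //; apply: Ck_mx => // a b.
by apply: Ck_eq (Ck_entry _ _ oU Hf) => // x _; rewrite !mxE.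
Qed.

End FinDim.

(** * Symmetry of second derivatives *)

Section Schwarz.
Context {R : realType} {V : normedModType R}.

Lemma is_derive_line (f : V -> R) p u (s : R) :
  differentiable f (p + s *: u) ->
  is_derive s (1 : R) (fun s : R => f (p + s *: u)) ('D_u f (p + s *: u)).
Proof.
move=> df.
have lin : linear (fun s : R => s *: u).
  by move=> a b c; rewrite scalerDl scalerA.
have cont : continuous (fun s : R => s *: u) by exact: scalel_continuous.
have [dL eL] := linear_fun_diff s (1 : R) lin cont.
have dc : differentiable (fun s : R => p + s *: u) s.
  by apply: differentiableD => //; exact: differentiable_cst.
have ec : 'D_1 (fun s : R => p + s *: u) s = u.
  rewrite deriveD; [|exact: derivable_cst|exact: diff_derivable].
  by rewrite derive_cst add0r [LHS]eL scale1r.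
have := derive_chain (1 : R) dc df; rewrite ec => <-.
apply: derivableP; apply: diff_derivable.
exact: differentiable_comp dc df.
Qed.

Lemma MVT_ccw (phi dphi : R -> R) (h : R) : 0 < h ->
  (forall s, 0 <= s <= h -> is_derive s (1 : R) phi (dphi s)) ->
  exists2 s, 0 <= s <= h & phi h - phi 0 = dphi s * h.
Proof.
move=> h0 dph.
have [||s] := @MVT R phi dphi 0 h h0.
- by move=> s; rewrite in_itv/= => /andP[s0 sh]; apply: dph; rewrite !ltW.
- apply: derivable_within_continuous => s; rewrite in_itv/= => sh.
  by have /@ex_derive := dph s sh.
rewrite in_itv/= subr0 => /andP[s0 sh] e.
by exists s => //; rewrite !ltW.
Qed.

(** The mean value theorem is used twice: along [u] for the increment of [f] in the direction [v],
    and then along [v] for ['D_u f]. *)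
Lemma second_difference (f : V -> R) (U : set V) x u v (h : R) : Ck 2%N U f -> 0 < h ->
  (forall s t, 0 <= s <= h -> 0 <= t <= h -> U (x + s *: u + t *: v)) ->
  exists s t, [/\ 0 <= s <= h, 0 <= t <= h &
    f (x + h *: u + h *: v) - f (x + h *: u) - f (x + h *: v) + f x =
    h * h * 'D_v (fun y => 'D_u f y) (x + s *: u + t *: v)].
Proof.
move=> [df dkf] h0 HU.
have hh : 0 <= h <= h by apply/andP; split=> //; exact: ltW.
have h00 : (0 : R) <= 0 <= h by apply/andP; split=> //; exact: ltW.
pose phi (s : R) := f ((x + h *: v) + s *: u) - f (x + s *: u).
pose dphi (s : R) := 'D_u f ((x + h *: v) + s *: u) - 'D_u f (x + s *: u).
have [s hs e1] : exists2 s, 0 <= s <= h & phi h - phi 0 = dphi s * h.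
  apply: MVT_ccw => // s hs; apply: is_deriveB.
    apply: is_derive_line; apply: df; rewrite addrAC; exact: HU.
  apply: is_derive_line; apply: df; rewrite -[_ + _]addr0 -(scale0r v); exact: HU.
have [dg _] := dkf u.
pose psi (t : R) := 'D_u f ((x + s *: u) + t *: v).
have [t ht e2] : exists2 t, 0 <= t <= h & psi h - psi 0 =
    'D_v (fun y => 'D_u f y) ((x + s *: u) + t *: v) * h.
  apply: (MVT_ccw (phi := psi)
    (dphi := fun t : R => 'D_v (fun y => 'D_u f y) ((x + s *: u) + t *: v)) h0).
  move=> t ht; apply: (@is_derive_line (fun y => 'D_u f y)); apply: dg.
  exact: HU.
exists s, t; split=> //.
move: e1; rewrite /phi /dphi !scale0r !addr0 => e1.
move: e2; rewrite /psi scale0r addr0 => e2.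
rewrite -mulrA [h * 'D_v _ _]mulrC -e2 [h * _]mulrC.
have -> : 'D_u f (x + s *: u + h *: v) = 'D_u f (x + h *: v + s *: u).
  by rewrite addrAC.
rewrite -e1 [x + h *: v + h *: u]addrAC; ring.
Qed.

(** The second difference is symmetric in [u] and [v], so the two mixed derivatives take a common
    value at points arbitrarily close to [x]; continuity of both concludes. *)
Lemma derive_sym (f : V -> R) (U : set V) x u v : open U -> U x -> Ck 2%N U f ->
  'D_v (fun y => 'D_u f y) x = 'D_u (fun y => 'D_v f y) x.
Proof.
move=> oU Ux Hf; have [_ dkf] := Hf.
have cA : {for x, continuous (fun y => 'D_v (fun y => 'D_u f y) y)}.
  by have [_ ] := dkf u; apply.
have cB : {for x, continuous (fun y => 'D_u (fun y => 'D_v f y) y)}.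
  by have [_ ] := dkf v; apply.
apply/eqP; rewrite -subr_eq0 -normr_le0; apply/ler_addgt0Pl => e e0; rewrite addr0.
pose A y := 'D_v (fun y => 'D_u f y) y; pose B y := 'D_u (fun y => 'D_v f y) y.
have e20 : 0 < e / 2 by rewrite divr_gt0.
have /cvgrPdist_lt/(_ _ e20) nA : A y @[y --> x] --> A x by exact: cA.
have /cvgrPdist_lt/(_ _ e20) nB : B y @[y --> x] --> B x by exact: cB.
have : \forall y \near x, [/\ U y, `|A x - A y| < e / 2 & `|B x - B y| < e / 2].
  have nU : nbhs x U by exact: open_nbhs_nbhs.
  apply: (@filterS _ (nbhs x) _ _ _ _ (filterI nU (filterI nA nB))).
  move=> y [Uy [Ay By]]; split; [exact: Uy|exact: Ay|exact: By].
move=> /nbhs_ballP[r /= r0 Hr].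
(* With this bound the parallelogram of side parameter r / (2 N) stays within distance r / 2 of [x];
   the summand 1 keeps [N] positive when [u] and [v] vanish. *)
pose N := 1 + `|u| + `|v|.
have N0 : 0 < N by rewrite /N -addrA ltr_pwDl// addr_ge0.
pose h := r / (2 * N).
have h0 : 0 < h by rewrite divr_gt0// mulr_gt0.
have inb s t : 0 <= s <= h -> 0 <= t <= h -> ball x r (x + s *: u + t *: v).
  move=> /andP[s0 sh] /andP[t0 th]; rewrite -ball_normE/=.
  rewrite -addrA opprD addrA subrr add0r normrN.
  apply: (@le_lt_trans _ _ (h * N)).
    apply: le_trans (ler_normD _ _) _; rewrite !normrZ !ger0_norm//.
    apply: (@le_trans _ _ (h * `|u| + h * `|v|)).
      by apply: lerD; apply: ler_wpM2r.
    by rewrite /N -mulrDr ler_wpM2l ?(ltW h0)// -addrA lerDr.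
  rewrite /h; have -> : r / (2 * N) * N = r / 2.
    by field; rewrite gt_eqF.
  by rewrite ltr_pdivrMr// ltr_pMr// ltr1n.
have HU s t hs ht := Hr _ (inb s t hs ht).
have [s [t [hs ht e1]]] := second_difference Hf h0 (fun s t hs ht =>
   let: And3 a _ _ := HU s t hs ht in a).
have [s' [t' [hs' ht' e2]]] := @second_difference f U x v u h Hf h0 (fun s t hs ht => ltac:(
   by rewrite addrAC; have [] := HU t s ht hs)).
have e3 : f (x + h *: u + h *: v) - f (x + h *: u) - f (x + h *: v) + f x =
    f (x + h *: v + h *: u) - f (x + h *: v) - f (x + h *: u) + f x.
  by rewrite [x + h *: v + h *: u]addrAC; ring.
have eAB : A (x + s *: u + t *: v) = B (x + s' *: v + t' *: u).
  have hh : h * h != 0 by rewrite mulf_neq0// gt_eqF.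
  exact: (mulfI hh (etrans (esym e1) (etrans e3 e2))).
have [_ a1 _] := HU s t hs ht; have [_ _ b1] := HU t' s' ht' hs'.
rewrite addrAC in b1.
change (`|A x - B x| <= e).
move: (A x) (B x) (A _) (B _) eAB a1 b1 => ax bx ap bq eAB a1 b1.
have -> : ax - bx = (ax - ap) - (bx - bq) by rewrite eAB opprB addrA subrK.
by apply: le_trans (ler_normB _ _) _; rewrite (splitr e); apply: lerD; exact: ltW.
Qed.

End Schwarz.

(** * Tangent vectors and brackets *)

Section Tangent.
Context {R : realType}.
Implicit Types V W X : normedModType R.

Lemma open_preimage_in V W (U : set V) (U' : set W) (f : V -> W) : open U -> open U' ->
  (forall x, U x -> {for x, continuous f}) -> open (U `&` f @^-1` U').
Proof.
move=> oU oU' cf; rewrite openE => x [Ux Ufx]; apply: filterI.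
  exact: open_nbhs_nbhs.
by apply: (cf x Ux); exact: open_nbhs_nbhs.
Qed.

(** The derivative along a tangent vector is the derivative along a curve in [S], which never sees
    values off [S]. *)
Lemma tangent_derive_eq V W (S U : set V) x v (f g : V -> W) :
  tangent S x v -> open U -> U x -> differentiable f x -> differentiable g x ->
  (forall y, U y -> S y -> f y = g y) -> 'D_v f x = 'D_v g x.
Proof.
move=> [T [c [[oT T0] sc cS c0 <-]]] oU Ux df dg fg.
have dc : differentiable c 0 by exact: smooth_diff T0.
rewrite -c0 -!derive_chain ?c0//; apply: near_eq_derive.
have nT : nbhs (0 : R^o) T by exact: open_nbhs_nbhs.
have nU : nbhs (0 : R^o) (c @^-1` U).
  by apply: (differentiable_continuous dc); rewrite c0; exact: open_nbhs_nbhs.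
apply: filterS (filterI nT nU) => t [Tt Ut]; apply: fg => //; exact: cS.
Qed.

Lemma tangent_image V W (S U : set V) (S' : set W) x v (f : V -> W) :
  findim V -> findim W -> open U -> U x -> smooth U f ->
  (forall y, U y -> S y -> S' (f y)) ->
  tangent S x v -> tangent S' (f x) ('D_v f x).
Proof.
move=> fV fW oU Ux sf fS [T [c [[oT T0] sc cS c0 <-]]].
have ccont t : T t -> {for t, continuous c}.
  by move=> Tt; apply: differentiable_continuous; exact: smooth_diff Tt.
have oTU : open (T `&` c @^-1` U) by exact: open_preimage_in.
have T0' : (T `&` c @^-1` U) 0 by split=> //; rewrite /preimage/= c0.
exists (T `&` c @^-1` U), (fun t => f (c t)); split=> //.
- move=> k; apply: (@Ck_comp _ V _ W k U _ c f) => //; first by move=> t [].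
  by apply: Ck_sub (sc k) => t [].
- by move=> t [Tt Ut]; apply: fS => //; exact: cS.
- by rewrite c0.
- have dc : differentiable c 0 by exact: smooth_diff T0.
  have df : differentiable f (c 0) by rewrite c0; exact: smooth_diff Ux.
  by rewrite (derive_chain _ dc df) c0.
Qed.

(** The second component moves along a straight line. With [tangent_image] this pushes tangent
    vectors of R, with any fibre component, through the retraction onto Sigma(R). *)
Lemma tangent_cylinder V W (S : set V) (x : V * W) (v : V * W) :
  tangent S x.1 v.1 -> tangent [set y : V * W | S y.1] x v.
Proof.
move=> [T [c [oT0 sc cS c0 e]]].
have [oT T0] := oT0.
have dc : differentiable c 0 by exact: smooth_diff T0.
have lin : linear (fun s : R^o => s *: v.2).
  by move=> a b d; rewrite scalerDl scalerA.
have cont : continuous (fun s : R^o => s *: v.2) by exact: scalel_continuous.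
have [d1 e1] := linear_fun_diff (0 : R^o) (1 : R^o) lin cont.
have d2 : differentiable (fun t : R^o => x.2 + t *: v.2) 0.
  by apply: differentiableD => //; exact: differentiable_cst.
exists T, (fun t => (c t, x.2 + t *: v.2)); split=> //.
- move=> k; apply: Ck_pair => //; apply: Ck_add => //; first exact: Ck_cst.
  exact: Ck_linear.
- by rewrite c0 scale0r addr0; case: (x).
- have dp : differentiable (fun t => (c t, x.2 + t *: v.2)) 0.
    exact: differentiable_pair.
  have [_ f1] := @derive_linear_comp R R^o _ _ (@fst V W) _ (0 : R^o) (1 : R^o) (@linear_fst R V W) (@continuous_fst R V W) dp.
  have [_ f2] := @derive_linear_comp R R^o _ _ (@snd V W) _ (0 : R^o) (1 : R^o) (@linear_snd R V W) (@continuous_snd R V W) dp.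
  have f3 : 'D_1 (fun t : R^o => x.2 + t *: v.2) 0 = v.2.
    rewrite deriveD; [|exact: derivable_cst|exact: diff_derivable].
    by rewrite derive_cst add0r e1 scale1r.
  rewrite [LHS]surjective_pairing -f1 -f2 [RHS]surjective_pairing.
  by congr pair; [exact: e|exact: f3].
Qed.

Lemma derive_big V W (I : Type) (r : seq I) (f : I -> V -> W) x v :
  (forall i, differentiable (f i) x) ->
  differentiable (fun y => \sum_(i <- r) f i y) x /\
  'D_v (fun y => \sum_(i <- r) f i y) x = \sum_(i <- r) 'D_v (f i) x.
Proof.
move=> df; elim: r => [|i r [IH1 IH2]].
  rewrite (_ : (fun _ => _) = cst 0).
    by rewrite big_nil derive_cst; split=> //; exact: differentiable_cst.
  by apply/funext => y; rewrite big_nil.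
rewrite (_ : (fun _ => _) = (fun y => f i y + \sum_(i <- r) f i y)); last first.
  by apply/funext => y; rewrite big_cons.
split; first exact: differentiableD.
by rewrite big_cons -IH2 deriveD//; exact: diff_derivable.
Qed.

Lemma derive_form V W (I : Type) (r : seq I) (eta : I -> V -> R) (L : I -> W -> R)
    (X : V -> W) x v :
  (forall i, linear (L i)) -> (forall i, continuous (L i)) ->
  (forall i, differentiable (eta i) x) -> differentiable X x ->
  differentiable (fun y => \sum_(i <- r) eta i y * L i (X y)) x /\
  'D_v (fun y => \sum_(i <- r) eta i y * L i (X y)) x =
  \sum_(i <- r) ('D_v (eta i) x * L i (X x) + eta i x * L i ('D_v X x)).
Proof.
move=> lL cL de dX.
have dLX i := derive_linear_comp v (lL i) (cL i) dX.
have dM i : differentiable (fun y => eta i y * L i (X y)) x.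
  exact: differentiableM (de i) (dLX i).1.
have [d1 ->] := derive_big r v dM; split=> //.
apply: eq_bigr => i _.
have := deriveM (diff_derivable (de i)) (diff_derivable (v := v) (dLX i).1).
rewrite (dLX i).2 => e; rewrite [LHS]e.
by rewrite addrC /GRing.scale/= [L i _ * _]mulrC.
Qed.

(** Cartan's formula: eta(Y) = 0 is differentiated along X and eta(X) = 0 along Y, and the results
    are subtracted. Both identities hold along [S] only, which suffices because X and Y are tangent
    to [S] at [x]. *)
Lemma bracket_form V (S U : set V) (I : Type) (r : seq I) (eta : I -> V -> R)
    (L : I -> V -> R) (X Y : V -> V) x :
  (forall i, linear (L i)) -> (forall i, continuous (L i)) ->
  (forall i, differentiable (eta i) x) ->
  differentiable X x -> differentiable Y x ->
  open U -> U x ->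
  (forall y, U y -> S y -> \sum_(i <- r) eta i y * L i (X y) = 0) ->
  (forall y, U y -> S y -> \sum_(i <- r) eta i y * L i (Y y) = 0) ->
  tangent S x (X x) -> tangent S x (Y x) ->
  \sum_(i <- r) eta i x * L i (lie_bracket X Y x) =
  - \sum_(i <- r) ('D_(X x) (eta i) x * L i (Y x) - 'D_(Y x) (eta i) x * L i (X x)).
Proof.
move=> lL cL de dX dY oU Ux X0 Y0 tX tY.
have [d1 e1] := derive_form r (X x) lL cL de dY.
have [d2 e2] := derive_form r (Y x) lL cL de dX.
have := tangent_derive_eq tX oU Ux d1 (differentiable_cst 0 x) Y0.
rewrite e1 derive_cst big_split/= => z1.
have := tangent_derive_eq tY oU Ux d2 (differentiable_cst 0 x) X0.
rewrite e2 derive_cst big_split/= => z2.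
rewrite sumrB.
have -> : \sum_(i <- r) eta i x * L i (lie_bracket X Y x) =
    \sum_(i <- r) eta i x * L i ('D_(X x) Y x) -
    \sum_(i <- r) eta i x * L i ('D_(Y x) X x).
  rewrite -sumrB; apply: eq_bigr => i _.
  by rewrite /lie_bracket (linearB_fun _ _ (lL i)) mulrBr.
move/eqP: z1; rewrite addrC addr_eq0 => /eqP ->.
by move/eqP: z2; rewrite addrC addr_eq0 => /eqP ->; rewrite opprB opprK addrC.
Qed.

(** The form dH vanishes on fields tangent to [S], and its exterior derivative is zero by symmetry
    of second derivatives, so Cartan's formula gives dH([X, Y]) = 0. *)
Lemma bracket_tangent V (S U : set V) (H : V -> R) (X Y : V -> V) x :
  findim V -> open U -> U x -> Ck 2%N U H -> (forall y, U y -> S y -> H y = 0) ->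
  differentiable X x -> differentiable Y x -> S x ->
  (forall y, U y -> S y -> tangent S y (X y)) ->
  (forall y, U y -> S y -> tangent S y (Y y)) ->
  'D_(lie_bracket X Y x) H x = 0.
Proof.
move=> [I [b [be hb]]] oU Ux HH H0 dX dY Sx tX tY.
have [lb cb _] := hb; have [dH dkH] := HH.
have tan0 y v : U y -> S y -> tangent S y v -> \sum_i 'D_(b i) H y * be i v = 0.
  move=> Uy Sy tv.
  have := tangent_derive_eq tv oU Uy (dH y Uy) (differentiable_cst 0 y) H0.
  rewrite derive_cst (derive_basis _ hb (dH y Uy)) => e0; apply: etrans e0.
  by apply: eq_bigr => i _; rewrite mulrC.
have de i : differentiable (fun y => 'D_(b i) H y) x by have [+ _] := dkH (b i); apply.
rewrite (derive_basis _ hb (dH x Ux)).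
rewrite (eq_bigr (fun i => 'D_(b i) H x * be i (lie_bracket X Y x))); last first.
  by move=> i _; rewrite mulrC.
have -> := @bracket_form V S U I (index_enum I) (fun i y => 'D_(b i) H y) be X Y x
  lb cb de dX dY oU Ux _ _ (tX x Ux Sx) (tY x Ux Sx); last 2 first.
- by move=> y Uy Sy; apply: tan0 => //; exact: tX.
- by move=> y Uy Sy; apply: tan0 => //; exact: tY.
have key u v : \sum_i 'D_u (fun y => 'D_(b i) H y) x * be i v =
    'D_v (fun y => 'D_u H y) x.
  have du : differentiable (fun y => 'D_u H y) x by have [+ _] := dkH u; apply.
  rewrite (derive_basis v hb du); apply: eq_bigr => i _.
  by rewrite mulrC (derive_sym _ _ oU Ux HH).
by rewrite sumrB !key (derive_sym _ _ oU Ux HH) subrr oppr0.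
Qed.

End Tangent.

(** * Symbol algebras in coordinates *)

Section Symbol.
Context {R : realType}.
Implicit Types V W X : normedModType R.

(** A graded component is kept inside the full row space as the set of vectors fixed by a mask.
    Membership in a span becomes an equation, and no change of dimension occurs between degrees. *)
Definition row_mask {n : nat} (g : seq 'I_n) (u : 'rV[R]_n) : 'rV[R]_n :=
  \row_i (if i \in g then u 0 i else 0).

Lemma row_maskD n (g : seq 'I_n) a u v : row_mask g (a *: u + v) = a *: row_mask g u + row_mask g v.
Proof. by apply/rowP => i; rewrite !mxE; case: ifP => // _; rewrite mulr0 addr0. Qed.

Lemma row_mask_id n (g : seq 'I_n) u : row_mask g (row_mask g u) = row_mask g u.
Proof. by apply/rowP => i; rewrite !mxE; case: (i \in g). Qed.

Lemma graded_part_row_mask n (gr : nat -> seq 'I_n) k (u : 'rV[R]_n) :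
  graded_part gr k u <-> row_mask (gr k) u = u.
Proof.
rewrite /graded_part /=; split=> [|<-].
  set s := [seq _ | i <- gr k].
  have : all (fun w => row_mask (gr k) w == w) s.
    apply/allP => w /mapP[i ig ->]; apply/eqP/rowP => j; rewrite !mxE eqxx/=.
    by have [->|//] := eqVneq j i; rewrite ?ig// if_same.
  elim: s u => [|w s IH] u /=; first rewrite span_nil memv0 => _ /eqP ->.
    by apply/rowP => i; rewrite !mxE if_same.
  move=> /andP[/eqP ws /IH als]; rewrite span_cons => /memv_addP[u1 /vlineP[a ->]].
  by move=> [u2 /als e2 ->]; rewrite row_maskD ws e2.
rewrite [row_mask _ _]row_sum_delta; apply: rpred_sum => i _; rewrite mxE.
case: ifP => [ig|_]; last by rewrite scale0r mem0v.
by apply: rpredZ; apply: memv_span; apply/mapP; exists i.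
Qed.

(** A single linear map [lam] serves all degrees: in degree k a class is sent to the degree k part
    of [lam] at a representative. The kernel condition makes this well defined and injective. The
    bracket condition makes all values [X, Y]_x fall in one class, and the existence of sections
    makes that class nonempty. *)
Lemma symbol_isomorphic_coords V (S : set V) (F : nat -> V -> set V) (x : V)
    (n : nat) (gr : nat -> seq 'I_n) (tbl : seq ('I_n * 'I_n * 'I_n))
    (lam : V -> 'rV[R]_n) :
  linear lam ->
  (forall k, linear_subset (F k x)) ->
  (forall k v, F k x v <-> F k.+1 x v /\ row_mask (gr k.+1) (lam v) = 0) ->
  (forall k u, (0 < k)%N -> graded_part gr k u ->
     exists2 v, F k x v & row_mask (gr k) (lam v) = u) ->
  (forall k v, (0 < k)%N -> F k x v ->
     exists2 X : V -> V, local_section S (F k) x X & X x = v) ->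
  (forall k l (X Y : V -> V), (0 < k)%N -> (0 < l)%N ->
     local_section S (F k) x X -> local_section S (F l) x Y ->
     F k x (X x) -> F l x (Y x) ->
     F (k + l)%N x (lie_bracket X Y x) /\
     row_mask (gr (k + l)%N) (lam (lie_bracket X Y x)) =
     table_bracket tbl (row_mask (gr k) (lam (X x))) (row_mask (gr l) (lam (Y x)))) ->
  symbol_isomorphic S F x gr tbl.
Proof.
move=> llam linF kerF surjF secF brF; split=> //.
have F0 k : F k x 0 by case: (linF k).
have FP k a u v : F k x u -> F k x v -> F k x (a *: u + v).
  by case: (linF k) => _; apply.
have FB k u v : F k x u -> F k x v -> F k x (u - v).
  by move=> Fu Fv; rewrite addrC -scaleN1r; exact: FP.
have FD k u v : F k x u -> F k x v -> F k x (u + v).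
  by move=> Fu Fv; rewrite -[u]scale1r; exact: FP.
have mB g u v : row_mask g (lam (u - v)) = row_mask g (lam u) - row_mask g (lam v).
  by rewrite addrC -scaleN1r llam row_maskD scaleN1r addrC.
have clsxx k u : symbol_class F x k u u by rewrite /symbol_class/= subrr.
have cls_eq k u v : symbol_class F x k u v ->
    symbol_class F x k u = symbol_class F x k v.
  move=> uv; apply/seteqP; split=> z; rewrite /symbol_class/= in uv * => h.
    by rewrite -[z - v](subrKA u) -[u - v]opprB; exact: FB.
  by rewrite -[z - u](subrKA v); exact: FD.
(* A representative is picked by choice; the default 0 is never reached on a symbol space, because
   each class contains the vector that defines it. *)
pose phi k (A : set V) := row_mask (gr k) (lam (xget 0 A)).
have in_cls k u v : (0 < k)%N -> F k x u -> symbol_class F x k u v ->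
    F k x v /\ row_mask (gr k) (lam v) = row_mask (gr k) (lam u).
  case: k => // k _ Fu; rewrite /symbol_class/= => /kerF[Fuv /eqP].
  rewrite mB subr_eq0 => /eqP e; split=> //.
  by rewrite -[v](subrK u); exact: FD.
have phi_cls k u : (0 < k)%N -> F k x u ->
    phi k (symbol_class F x k u) = row_mask (gr k) (lam u).
  move=> k0 Fu; apply: (in_cls k u _ k0 Fu _).2.
  exact: xgetPex (ex_intro _ u (clsxx k u)).
exists phi; split.
- move=> k k0; split.
  + move=> _ [u Fu <-]; rewrite phi_cls//.
    by apply/graded_part_row_mask; rewrite row_mask_id.
  + move=> _ _ /set_mem[u Fu <-] /set_mem[v Fv <-]; rewrite !phi_cls// => e.
    apply: cls_eq; rewrite /symbol_class/=.
    case: k k0 Fu Fv e => // k k0 Fu Fv e; apply/kerF; split; first exact: FB.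
    by rewrite mB e subrr.
  + move=> u /(surjF _ _ k0)[v Fv <-]; exists (symbol_class F x k v).
      by exists v.
    exact: phi_cls.
- move=> k a u v k0 Fu Fv; rewrite !phi_cls//; last exact: FP.
  by rewrite llam row_maskD.
- move=> k l _ _ k0 l0 [u Fu <-] [v Fv <-].
  have [X sX Xx] := secF k u k0 Fu; have [Y sY Yx] := secF l v l0 Fv.
  have kl0 : (0 < k + l)%N by rewrite addn_gt0 k0.
  have br (X' Y' : V -> V) : local_section S (F k) x X' -> local_section S (F l) x Y' ->
      symbol_class F x k u (X' x) -> symbol_class F x l v (Y' x) ->
      F (k + l)%N x (lie_bracket X' Y' x) /\
      row_mask (gr (k + l)%N) (lam (lie_bracket X' Y' x)) =
      table_bracket tbl (row_mask (gr k) (lam u)) (row_mask (gr l) (lam v)).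
    move=> sX' sY' /(in_cls _ _ _ k0 Fu)[Fu' <-] /(in_cls _ _ _ l0 Fv)[Fv' <-].
    exact: brF.
  have [FXY eXY] := br X Y sX sY ltac:(by rewrite Xx) ltac:(by rewrite Yx).
  have -> : symbol_bracket S F x k l (symbol_class F x k u) (symbol_class F x l v) =
      symbol_class F x (k + l)%N (lie_bracket X Y x).
    apply/seteqP; split=> [z [X' [Y' [sX' sY' uX' vY' h]]]|z h]; last first.
      by exists X, Y; split=> //; rewrite ?Xx ?Yx.
    have [FXY' eXY'] := br X' Y' sX' sY' uX' vY'.
    rewrite (_ : symbol_class _ _ _ _ = symbol_class F x (k + l)%N (lie_bracket X' Y' x))//.
    apply: cls_eq; rewrite /symbol_class/=.
    move: kl0 FXY eXY FXY' eXY'; case: (k + l)%N => // m _ FXY eXY FXY' eXY'.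
    by apply/kerF; split; [exact: FB|rewrite mB eXY eXY' subrr].
  split; first by exists (lie_bracket X Y x).
  by rewrite !phi_cls.
Qed.

End Symbol.

(** * Orthogonal projections onto planes *)

Section Projection.
Context {R : realType} {n : nat}.
Implicit Types u h v : 'rV[R]_n.

Lemma pairingE u v : pairing u v = \sum_i u 0 i * v 0 i.
Proof. by rewrite /pairing mxE; apply: eq_bigr => i _; rewrite mxE. Qed.

Lemma pairingC u v : pairing u v = pairing v u.
Proof. by rewrite !pairingE; apply: eq_bigr => i _; rewrite mulrC. Qed.

Lemma pairing_linearr u a v w : pairing u (a *: v + w) = a * pairing u v + pairing u w.
Proof. by rewrite /pairing linearP/= mulmxDr -scalemxAr !mxE. Qed.

Lemma pairing_linearl u a v w : pairing (a *: v + w) u = a * pairing v u + pairing w u.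
Proof. by rewrite !(pairingC _ u) pairing_linearr. Qed.

Lemma pairing0r u : pairing u 0 = 0.
Proof. by rewrite /pairing trmx0 mulmx0 mxE. Qed.

Lemma pairingDr u v w : pairing u (v + w) = pairing u v + pairing u w.
Proof. by rewrite -[v]scale1r pairing_linearr mul1r scale1r. Qed.

Lemma pairingDl u v w : pairing (v + w) u = pairing v u + pairing w u.
Proof. by rewrite !(pairingC _ u) pairingDr. Qed.

Lemma pairingZr u a v : pairing u (a *: v) = a * pairing u v.
Proof. by rewrite -[a *: v]addr0 pairing_linearr pairing0r addr0. Qed.

Lemma pairingZl u a v : pairing (a *: v) u = a * pairing v u.
Proof. by rewrite !(pairingC _ u) pairingZr. Qed.

Lemma pairingBl u v w : pairing (v - w) u = pairing v u - pairing w u.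
Proof. by rewrite pairingDl -scaleN1r pairingZl mulN1r. Qed.

Lemma pairingBr u v w : pairing u (v - w) = pairing u v - pairing u w.
Proof. by rewrite !(pairingC u) pairingBl. Qed.

Lemma pairing_eq0 u : pairing u u = 0 -> u = 0.
Proof.
rewrite pairingE => e; apply/rowP => i; rewrite mxE.
have /psumr_eq0P /(_ e i isT)/eqP : forall i, true -> 0 <= u 0 i * u 0 i.
  by move=> j _; rewrite -expr2 sqr_ge0.
by rewrite mulf_eq0 orbb => /eqP.
Qed.

Definition gram u h := pairing u u * pairing h h - pairing u h * pairing u h.

Definition independent u h := forall a b, a *: u + b *: h = 0 -> a = 0 /\ b = 0.

(** Equality case of Cauchy-Schwarz: the square norm of [z] is a multiple of the Gram determinant,
    so its vanishing would produce a linear relation between [u] and [h]. *)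
Lemma gram_neq0 u h : independent u h -> gram u h != 0.
Proof.
move=> ind; apply/eqP => g0.
pose z := pairing h h *: u - pairing u h *: h.
have z0 : z = 0.
  apply: pairing_eq0; rewrite /z pairingBl !pairingBr !pairingZl !pairingZr.
  rewrite [pairing h u]pairingC.
  by transitivity (pairing h h * gram u h); [rewrite /gram; ring|rewrite g0 mulr0].
have /ind[hh0 _] : pairing h h *: u + (- pairing u h) *: h = 0.
  by rewrite scaleNr; exact: z0.
have h0 := pairing_eq0 hh0.
have /ind[_ /eqP] : 0 *: u + 1 *: h = 0 by rewrite scale0r add0r scale1r.
by rewrite oner_eq0.
Qed.

(* This is A^T (A A^T)^-1 A, where A is the matrix with rows u and h. *)
Definition plane_proj u h : 'M[R]_n :=
  (gram u h)^-1 *: (pairing h h *: (u^T *m u)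
    - pairing u h *: (u^T *m h + h^T *m u) + pairing u u *: (h^T *m h)).

Lemma mul_rank1 v u h : v *m (u^T *m h) = pairing v u *: h.
Proof.
rewrite mulmxA; apply/rowP => i; rewrite !mxE big_ord1; congr (_ * _).
Qed.

Lemma mul_plane_proj v u h : v *m plane_proj u h =
  ((gram u h)^-1 * (pairing h h * pairing v u - pairing u h * pairing v h)) *: u +
  ((gram u h)^-1 * (pairing u u * pairing v h - pairing u h * pairing v u)) *: h.
Proof.
rewrite /plane_proj -scalemxAr !mulmxDr mulmxN -!scalemxAr mulmxDr !mul_rank1.
by apply/rowP => i; rewrite !mxE; ring.
Qed.

Lemma plane_proj_fixl u h : gram u h != 0 -> u *m plane_proj u h = u.
Proof.
move=> g0; rewrite mul_plane_proj [pairing h h * _]mulrC -/(gram u h) mulVf//.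
by rewrite scale1r [pairing u u * _]mulrC subrr mulr0 scale0r addr0.
Qed.

Lemma plane_proj_fixr u h : gram u h != 0 -> h *m plane_proj u h = h.
Proof.
move=> g0; rewrite mul_plane_proj [pairing h u]pairingC.
rewrite [pairing h h * _]mulrC subrr mulr0 scale0r add0r.
by rewrite -/(gram u h) mulVf// scale1r.
Qed.

Lemma plane_proj_sym u h : (plane_proj u h)^T = plane_proj u h.
Proof.
by apply/matrixP => i j; rewrite !mxE !big_ord1 !mxE; ring.
Qed.

Lemma plane_proj_sub v u h :
  exists a b, v *m plane_proj u h = a *: u + b *: h.
Proof. by rewrite mul_plane_proj; do 2!eexists; reflexivity. Qed.

Lemma plane_proj_idem u h : gram u h != 0 ->
  plane_proj u h *m plane_proj u h = plane_proj u h.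
Proof.
move=> g0; apply/row_matrixP => i; rewrite row_mul.
have [a [b e]] := plane_proj_sub (delta_mx 0 i) u h.
rewrite rowE e mulmxDl -!scalemxAl plane_proj_fixl// plane_proj_fixr//.
Qed.

Lemma independent_rank u h : independent u h -> \rank (col_mx u h) = 2%N.
Proof.
move=> ind; apply/eqP; change (row_free (col_mx u h)).
rewrite -kermx_eq0; apply/eqP/row_matrixP => i; rewrite row0.
have : row i (kermx (col_mx u h)) *m col_mx u h = 0.
  by rewrite -row_mul mulmx_ker row0.
set w : 'rV_(1 + 1) := row i _; rewrite -[w]hsubmxK mul_row_col.
rewrite [lsubmx w]mx11_scalar [rsubmx w]mx11_scalar !mul_scalar_mx => /ind[-> ->].
by rewrite !raddf0 row_mx0.
Qed.

Lemma plane_proj_eqmx u h : gram u h != 0 -> (plane_proj u h :=: col_mx u h)%MS.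
Proof.
move=> g0; apply/eqmxP/andP; split.
  apply/row_subP => i; rewrite rowE.
  have [a [b ->]] := plane_proj_sub (delta_mx 0 i) u h.
  rewrite -addsmxE; apply: addmx_sub_adds; exact: scalemx_sub.
rewrite col_mx_sub; apply/andP; split; apply/submxP.
  by exists u; rewrite plane_proj_fixl.
by exists h; rewrite plane_proj_fixr.
Qed.

Lemma sub_plane_proj v u h : gram u h != 0 -> (v <= plane_proj u h)%MS ->
  exists a b, v = a *: u + b *: h.
Proof.
move=> g0 /submxP[w ->]; exact: plane_proj_sub.
Qed.

(** Two symmetric idempotents P and Q with the same row space satisfy P Q = P and Q P = Q;
    transposing the first equality gives Q P = P, hence P = Q. An integral element is thereby
    recovered from two spanning vectors. *)
Lemma plane_proj_unique u h (P : 'M[R]_n) : independent u h ->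
  P^T = P -> P *m P = P -> \rank P = 2%N -> (u <= P)%MS -> (h <= P)%MS ->
  P = plane_proj u h.
Proof.
move=> ind Ps Pi Pr uP hP; have g0 := gram_neq0 ind.
have fixP v : (v <= P)%MS -> v *m P = v.
  by move=> /submxP[w ->]; rewrite -mulmxA Pi.
have sub : (P <= col_mx u h)%MS.
  have s : (col_mx u h <= P)%MS by rewrite col_mx_sub uP.
  by have := (mxrank_leqif_eq s).2; rewrite independent_rank// Pr eqxx => /esym/andP[].
have e1 : P *m plane_proj u h = P.
  apply/row_matrixP => i; rewrite row_mul.
  have : (row i P <= plane_proj u h)%MS.
    by rewrite plane_proj_eqmx// (submx_trans (row_sub i P)).
  move=> /(sub_plane_proj g0)[a [b ->]].
  by rewrite mulmxDl -!scalemxAl plane_proj_fixl// plane_proj_fixr.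
have e2 : plane_proj u h *m P = plane_proj u h.
  apply/row_matrixP => i; rewrite row_mul rowE.
  have [a [b ->]] := plane_proj_sub (delta_mx 0 i) u h.
  by rewrite mulmxDl -!scalemxAl !fixP.
by rewrite -e1 -[in LHS]Ps -[in LHS](plane_proj_sym u h) -trmx_mul e2 plane_proj_sym.
Qed.

End Projection.

(** * Smooth dependence of the projection on the spanning vectors *)

Section PlaneProjSmooth.
Context {R : realType} {n : nat} {V : normedModType R}.

Lemma Ck_pairing k (U : set V) (f g : V -> 'rV[R]_n) : open U ->
  Ck k U f -> Ck k U g -> Ck k U (fun x => pairing (f x) (g x)).
Proof.
move=> oU Hf Hg.
apply: (@Ck_eq _ _ _ k U (fun x => \sum_i f x 0 i * g x 0 i)) => //.
  by move=> x _; rewrite pairingE.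
by apply: Ck_sum => // i _; apply: Ck_mul => //; exact: Ck_entry.
Qed.

Lemma Ck_plane_proj k (U : set V) (f g : V -> 'rV[R]_n) : open U ->
  (forall x, U x -> gram (f x) (g x) != 0) ->
  Ck k U f -> Ck k U g -> Ck k U (fun x => plane_proj (f x) (g x)).
Proof.
move=> oU g0 Hf Hg; apply: Ck_mx => // i j.
apply: (@Ck_eq _ _ _ k U (fun x => (gram (f x) (g x))^-1 *
   (pairing (g x) (g x) * (f x 0 i * f x 0 j) +
    - (pairing (f x) (g x) * (f x 0 i * g x 0 j + g x 0 i * f x 0 j)) +
    pairing (f x) (f x) * (g x 0 i * g x 0 j)))) => //.
  by move=> x _; rewrite !mxE !big_ord1 !mxE.
have Hfi l : Ck k U (fun x => f x 0 l) by exact: Ck_entry.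
have Hgi l : Ck k U (fun x => g x 0 l) by exact: Ck_entry.
have P1 := Ck_pairing oU Hf Hf; have P2 := Ck_pairing oU Hf Hg.
have P3 := Ck_pairing oU Hg Hg.
apply: Ck_mul => //.
  apply: Ck_inv => //; apply: Ck_add => //; first exact: Ck_mul.
  by apply: Ck_opp => //; exact: Ck_mul.
apply: Ck_add => //; last by apply: Ck_mul => //; exact: Ck_mul.
apply: Ck_add => //; first by apply: Ck_mul => //; exact: Ck_mul.
apply: Ck_opp => //; apply: Ck_mul => //; apply: Ck_add => //; exact: Ck_mul.
Qed.

End PlaneProjSmooth.

(** * Tangent spaces and dual frames *)

Section Gradient.
Context {R : realType}.

Definition grad (F : 'rV[R]_8 -> R) (y : 'rV[R]_8) : 'rV[R]_8 :=
  \row_i 'D_(unit_vec i) F y.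

Lemma derive_grad F y v : differentiable F y -> 'D_v F y = pairing (grad F y) v.
Proof.
move=> dF; rewrite deriveE// {1}(row_sum_delta v) linear_sum pairingE.
by apply: eq_bigr => i _; rewrite linearZ/= -deriveE// mxE mulrC.
Qed.

Lemma smooth_grad F U : open U -> smooth U F -> smooth U (grad F).
Proof.
move=> oU sF k; apply: Ck_mx => // i j.
apply: (@Ck_eq _ _ _ k U (fun x => 'D_(unit_vec j) F x)) => //.
  by move=> x _; rewrite mxE.
exact: smooth_derive sF k.
Qed.

Lemma tangent_zero_set_sub F G y v :
  smooth setT F -> smooth setT G -> tangent (zero_set F G) y v ->
  pairing (grad F y) v = 0 /\ pairing (grad G y) v = 0.
Proof.
move=> sF sG tv; rewrite -!derive_grad; [|exact: smooth_diff sG _|exact: smooth_diff sF _].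
have d0 : differentiable (cst (0 : R)) y by exact: differentiable_cst.
split.
- rewrite (tangent_derive_eq tv openT I (smooth_diff sF I) d0) ?derive_cst//.
  by move=> z _ [].
- rewrite (tangent_derive_eq tv openT I (smooth_diff sG I) d0) ?derive_cst//.
  by move=> z _ [].
Qed.

Lemma mul_trmx_eq0 m (A : 'M[R]_(m, 8)) (v : 'rV[R]_8) :
  v *m A^T = 0 <-> forall i, pairing (row i A) v = 0.
Proof.
split=> [e i|e].
  move/rowP : e => /(_ i); rewrite !mxE => e.
  by rewrite pairingE -[RHS]e; apply: eq_bigr => j _; rewrite !mxE mulrC.
apply/rowP => i; rewrite !mxE -[RHS](e i) pairingE.
by apply: eq_bigr => j _; rewrite !mxE mulrC.
Qed.

Lemma col_mx_pairing_eq0 (a b v : 'rV[R]_8) :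
  v *m (col_mx a b)^T = 0 <-> pairing a v = 0 /\ pairing b v = 0.
Proof.
rewrite mul_trmx_eq0; split=> [e|[e1 e2] i].
  split; first by have := e (lshift 1 0); rewrite rowKu row_id.
  by have := e (rshift 1 0); rewrite rowKd row_id.
by case: (split_ordP i) => j ->; rewrite ?rowKu ?rowKd ord1 row_id.
Qed.

Definition fibre_coord : 'M[R]_(8, 3) :=
  \matrix_(i, j) (i == tnth [tuple jr; js; jt] j)%:R.

Lemma grad_rstE F y : grad_rst F y = grad F y *m fibre_coord.
Proof.
apply/rowP => j; rewrite !mxE; under eq_bigr do rewrite !mxE.
move: (tnth _ j) => l; rewrite (bigD1 l)//= big1 ?eqxx ?mulr1 ?addr0// => i.
by move=> /negbTE ->; rewrite mulr0.
Qed.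

Lemma rank_grad F G y : row_free (col_mx (grad_rst F y) (grad_rst G y)) ->
  \rank (col_mx (grad F y) (grad G y)) = 2%N.
Proof.
move=> fr; apply/eqP; rewrite eqn_leq rank_leq_row/=.
move: fr; rewrite !grad_rstE -mul_col_mx /row_free => /eqP fr.
by rewrite -[X in (X <= _)%N]fr; exact: mxrankM_maxl.
Qed.

(* Surjectivity of six covectors on the tangent space forces it to fill the
   six-dimensional common kernel of dF and dG. *)
Lemma coframe_tangent F G y (ths : 6.-tuple 'rV[R]_8) :
  regular_system F G -> zero_set F G y ->
  is_coframe (tangent (zero_set F G) y) ths ->
  (forall v, tangent (zero_set F G) y v <->
     pairing (grad F y) v = 0 /\ pairing (grad G y) v = 0) /\
  (forall v, tangent (zero_set F G) y v ->
     (forall i, pairing (tnth ths i) v = 0) -> v = 0).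
Proof.
move=> [sF sG _ reg] My [_ _ surj].
pose B := (col_mx (grad F y) (grad G y))^T.
pose C := (\matrix_i tnth ths i)^T : 'M[R]_(8, 6).
have KB v : v *m B = 0 <-> pairing (grad F y) v = 0 /\ pairing (grad G y) v = 0.
  exact: col_mx_pairing_eq0.
have TK v : tangent (zero_set F G) y v -> v *m B = 0.
  by move=> /(tangent_zero_set_sub sF sG)/KB.
have vC v : \row_i pairing (tnth ths i) v = v *m C.
  apply/rowP => i; rewrite !mxE pairingE.
  by apply: eq_bigr => j _; rewrite !mxE mulrC.
have rB : \rank (kermx B) = 6%N.
  by rewrite mxrank_ker mxrank_tr rank_grad//; exact: reg.
(* Every unit row is the value of the six covectors on some tangent vector, so they have rank 6 on
   the kernel of [B], whose dimension is 8 - 2. *)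
have rBC : (6 <= \rank (kermx B *m C))%N.
  rewrite -[X in (X <= _)%N](mxrank1 R 6); apply: mxrankS.
  apply/row_subP => i; have [t Tt e] := surj (row i 1%:M) I.
  rewrite -e vC; apply: submxMr; apply/sub_kermxP; exact: TK.
have inj v : v *m B = 0 -> v *m C = 0 -> v = 0.
  move=> vB0 vC0.
  have : \rank (kermx B :&: kermx C)%MS == 0%N.
    have := mxrank_mul_ker (kermx B) C; rewrite rB => e.
    by rewrite -leqn0 -(leq_add2l (\rank (kermx B *m C))) e addn0.
  rewrite mxrank_eq0 => /eqP z; apply/eqP; rewrite -submx0 -z sub_capmx.
  by apply/andP; split; apply/sub_kermxP.
split=> v; last first.
  move=> Tv e; apply: inj; first exact: TK.
  by rewrite -vC; apply/rowP => i; rewrite !mxE.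
split=> [|Kv]; first by move/TK/KB.
have [t Tt e] := surj (v *m C) I.
suff -> : v = t by [].
apply/eqP; rewrite -subr_eq0; apply/eqP; apply: inj.
  by rewrite mulmxBl (TK t Tt) subr0; exact/KB.
by rewrite mulmxBl -(vC t) e subrr.
Qed.

(** The eight covectors form a matrix invertible at [c], hence near [c]; the rows of its inverse are
    the dual vectors. The frame is taken in the whole ambient space so that its members are smooth
    on an open set and not merely along R. *)
Lemma dual_frame (U : set 'rV[R]_8) (c : 'rV[R]_8) (th : 'I_8 -> 'rV[R]_8 -> 'rV[R]_8) :
  open U -> U c -> (forall j, smooth U (th j)) ->
  (forall v, (forall j, pairing (th j c) v = 0) -> v = 0) ->
  exists (U' : set 'rV[R]_8) (E : 'I_8 -> 'rV[R]_8 -> 'rV[R]_8),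
    [/\ open U', U' c, U' `<=` U, forall j, smooth U' (E j) &
      forall y, U' y ->
        (forall i j, pairing (th i y) (E j y) = (i == j)%:R) /\
        (forall v, v = \sum_j pairing (th j y) v *: E j y)].
Proof.
move=> oU Uc sth inj.
pose Th y := (\matrix_i th i y)^T.
have sTh : smooth U Th.
  move=> k; apply: Ck_mx => // i j.
  apply: (@Ck_eq _ _ _ k U (fun x => th j x 0 i)) => //.
    by move=> x _; rewrite !mxE.
  by apply: Ck_entry => //; exact: sth.
have sdet : smooth U (fun y => \det (Th y)) by move=> k; exact: Ck_det.
pose U' := U `&` (fun y => \det (Th y)) @^-1` [set a | a != 0].
have oU' : open U'.
  apply: (@open_preimage_in R _ R U [set a | a != 0] _ oU (@open_neq R 0)).
  by move=> x Ux; apply: differentiable_continuous; exact: smooth_diff Ux.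
have U'U : U' `<=` U by move=> y [].
have uTh y : U' y -> Th y \in unitmx by move=> [_]; rewrite unitmxE unitfE.
exists U', (fun j y => row j (invmx (Th y))); split=> //.
- split=> //; rewrite /preimage/=.
  have : row_free (Th c).
    rewrite -kermx_eq0; apply/eqP/row_matrixP => i; rewrite row0.
    apply: inj => j.
    have : row i (kermx (Th c)) *m Th c = 0 by rewrite -row_mul mulmx_ker row0.
    by move=> /mul_trmx_eq0/(_ j); rewrite rowK.
  by rewrite row_free_unit unitmxE unitfE.
- move=> j k; apply: Ck_mx => // a b.
  apply: (@Ck_eq _ _ _ k U' (fun x => invmx (Th x) j b)) => //.
    by move=> x _; rewrite !mxE.
  by apply: Ck_entry => //; apply: Ck_invmx => //; exact: smooth_sub sTh k.
- move=> y U'y; split=> [i j|v].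
    have /matrixP/(_ j i) := mulVmx (uTh y U'y); rewrite mxE [RHS]mxE eq_sym => <-.
    by rewrite pairingE; apply: eq_bigr => l _; rewrite !mxE mulrC.
  rewrite -[LHS](mulmxK (uTh y U'y)) mulmx_sum_row.
  apply: eq_bigr => j _; congr (_ *: _).
  by rewrite mxE pairingE; apply: eq_bigr => l _; rewrite !mxE mulrC.
Qed.

End Gradient.

(** * Adapted frames and integral elements *)

Section Cartan.
Context {R : realType}.

(** The map [L] is the identity for fields on the jet space and [fst] for fields on the
    prolongation; in the latter case [th] is a semibasic form whose coefficients may depend on the
    plane. *)
Lemma bracket_covector (V : normedModType R) n (S U : set V)
    (th : V -> 'rV[R]_n) (L : V -> 'rV[R]_n) (X Y : V -> V) x :
  linear L -> continuous L -> differentiable th x ->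
  differentiable X x -> differentiable Y x -> open U -> U x ->
  (forall y, U y -> S y -> pairing (th y) (L (X y)) = 0) ->
  (forall y, U y -> S y -> pairing (th y) (L (Y y)) = 0) ->
  tangent S x (X x) -> tangent S x (Y x) ->
  pairing (th x) (L (lie_bracket X Y x)) =
  - (pairing ('D_(X x) th x) (L (Y x)) - pairing ('D_(Y x) th x) (L (X x))).
Proof.
move=> lL cL dth dX dY oU Ux X0 Y0 tX tY.
have dthi i v := derive_linear_comp v (@linear_entry R 1 n 0 i)
  (@coord_continuous _ 1 n 0 i) dth.
have := @bracket_form R V S U 'I_n (index_enum 'I_n) (fun i y => th y 0 i)
  (fun i v => L v 0 i) X Y x _ _ (fun i => (dthi i 0).1) dX dY oU Ux _ _ tX tY.
rewrite pairingE => ->.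
- rewrite !pairingE -sumrB; congr (- _); apply: eq_bigr => i _.
  by rewrite !(dthi i _).2.
- by move=> i a u v; rewrite lL linear_entry.
- move=> i v; apply: (@continuous_comp _ _ _ L (fun w : 'rV[R]_n => w 0 i)); first exact: cL.
  exact: coord_continuous.
- by move=> y Uy Sy; rewrite -pairingE X0.
- by move=> y Uy Sy; rewrite -pairingE Y0.
Qed.

Lemma sum6 (V : nmodType) (f : 'I_6 -> V) :
  \sum_j f j = f (@Ordinal 6 0 isT) + f (@Ordinal 6 1 isT) + f (@Ordinal 6 2 isT) +
    f (@Ordinal 6 3 isT) + f (@Ordinal 6 4 isT) + f (@Ordinal 6 5 isT).
Proof.
do 6 rewrite big_ord_recr/=; rewrite big_ord0 add0r.
by do ![congr (_ + _)]; congr f; apply: val_inj.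
Qed.

End Cartan.

Definition k0 : 'I_6 := @Ordinal 6 0 isT.
Definition k1 : 'I_6 := @Ordinal 6 1 isT.
Definition k2 : 'I_6 := @Ordinal 6 2 isT.
Definition k3 : 'I_6 := @Ordinal 6 3 isT.
Definition k4 : 'I_6 := @Ordinal 6 4 isT.
Definition k5 : 'I_6 := @Ordinal 6 5 isT.

Section Adapted.
Context {R : realType}.
Implicit Types (F G : 'rV[R]_8 -> R) (U : set 'rV[R]_8)
  (th E : 'I_6 -> 'rV[R]_8 -> 'rV[R]_8).

(* [th] lists varpi_0, varpi_1, varpi_2, omega_1, sg, ta and [E] is its dual
   frame.  Here sg and ta replace omega_2 and pi in such a way that
   omega_2 = del sg + del' ta and omega_2 /\ pi = eps sg /\ ta. *)
Record adapted F G U th E (eps del del' : R) : Prop := Adapted {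
  ad_open : open U;
  ad_smooth_th : forall i, smooth U (th i);
  ad_smooth_E : forall i, smooth U (E i);
  ad_dual : forall y, U y -> forall i j, pairing (th i y) (E j y) = (i == j)%:R;
  ad_varpi0 : th k0 = varpi0;
  ad_tangent : forall y, U y -> zero_set F G y -> forall v,
    tangent (zero_set F G) y v <->
    pairing (grad F y) v = 0 /\ pairing (grad G y) v = 0;
  ad_tangent_E : forall y, U y -> zero_set F G y -> forall i,
    tangent (zero_set F G) y (E i y);
  ad_expand : forall y, U y -> zero_set F G y -> forall v,
    tangent (zero_set F G) y v -> v = \sum_i pairing (th i y) v *: E i y;
  ad_contact : forall y, U y -> zero_set F G y -> forall v,
    contact (zero_set F G) y v <->
    [/\ tangent (zero_set F G) y v, pairing (th k0 y) v = 0,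
        pairing (th k1 y) v = 0 & pairing (th k2 y) v = 0];
  ad_d0 : forall y, U y -> zero_set F G y -> forall u v,
    tangent (zero_set F G) y u -> tangent (zero_set F G) y v ->
    pairing (th k0 y) u = 0 -> pairing (th k0 y) v = 0 ->
    ext_d (th k0) y u v = wedge (th k3 y) (th k1 y) u v +
      wedge (del *: th k4 y + del' *: th k5 y) (th k2 y) u v;
  ad_d1 : forall y, U y -> zero_set F G y -> forall u v,
    contact (zero_set F G) y u -> contact (zero_set F G) y v ->
    ext_d (th k1) y u v = 0;
  ad_d2 : forall y, U y -> zero_set F G y -> forall u v,
    contact (zero_set F G) y u -> contact (zero_set F G) y v ->
    ext_d (th k2) y u v = eps * wedge (th k4 y) (th k5 y) u v }.

Context {F G U th E} {eps del del' : R}.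
Context (sF : smooth setT F) (sG : smooth setT G).
Context (ad : adapted F G U th E eps del del').
Let M := zero_set F G.

Lemma tangent_linear y : U y -> M y -> linear_subset (tangent M y).
Proof.
move=> Uy My; split; first by apply/(ad_tangent ad Uy My); rewrite !pairing0r.
move=> a u v /(ad_tangent ad Uy My)[u1 u2] /(ad_tangent ad Uy My)[v1 v2].
by apply/(ad_tangent ad Uy My); rewrite !pairing_linearr u1 u2 v1 v2 mulr0 addr0.
Qed.

Lemma contact_linear y : U y -> M y -> linear_subset (contact M y).
Proof.
move=> Uy My; have [T0 TD] := tangent_linear Uy My; split.
  by apply/(ad_contact ad Uy My); rewrite !pairing0r.
move=> a u v /(ad_contact ad Uy My)[tu u0 u1 u2] /(ad_contact ad Uy My)[tv v0 v1 v2].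
apply/(ad_contact ad Uy My); rewrite !pairing_linearr u0 u1 u2 v0 v1 v2 mulr0 addr0.
by split=> //; exact: TD.
Qed.

Lemma contact_expand y v : U y -> M y -> contact M y v ->
  v = pairing (th k3 y) v *: E k3 y + pairing (th k4 y) v *: E k4 y +
      pairing (th k5 y) v *: E k5 y.
Proof.
move=> Uy My /(ad_contact ad Uy My)[tv v0 v1 v2].
rewrite {1}(ad_expand ad Uy My tv) sum6 -/k0 -/k1 -/k2 -/k3 -/k4 -/k5.
by rewrite v0 v1 v2 !scale0r !add0r.
Qed.

Lemma contact_E y a b d : U y -> M y ->
  contact M y (a *: E k3 y + b *: E k4 y + d *: E k5 y).
Proof.
move=> Uy My; have cE (i : 'I_6) : (2 < i)%N -> contact M y (E i y).
  move=> i2; apply/(ad_contact ad Uy My); rewrite !(ad_dual ad Uy).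
  split; first exact: (ad_tangent_E ad Uy My).
  - by case: eqP i2 => // <-.
  - by case: eqP i2 => // <-.
  - by case: eqP i2 => // <-.
have [c0 cD] := contact_linear Uy My.
rewrite -addrA; apply: (cD); first exact: cE.
by apply: (cD); [exact: cE|rewrite -[_ *: _]addr0; apply: cD => //; exact: cE].
Qed.

Lemma tangent_bracket y (X Y : 'rV[R]_8 -> 'rV[R]_8) : U y -> M y ->
  differentiable X y -> differentiable Y y ->
  (forall z, U z -> M z -> tangent M z (X z)) ->
  (forall z, U z -> M z -> tangent M z (Y z)) ->
  tangent M y (lie_bracket X Y y).
Proof.
move=> Uy My dX dY tX tY; have oU := ad_open ad.
have fV := @findim_mx R 1 8.
apply/(ad_tangent ad Uy My); split.
- rewrite -derive_grad; last exact: smooth_diff sF I.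
  apply: (bracket_tangent fV oU Uy _ _ dX dY My tX tY).
    exact: smooth_sub sF 2%N.
  by move=> z _ [].
- rewrite -derive_grad; last exact: smooth_diff sG I.
  apply: (bracket_tangent fV oU Uy _ _ dX dY My tX tY).
    exact: smooth_sub sG 2%N.
  by move=> z _ [].
Qed.

(* d theta (u, v) = - theta ([X, Y]) for sections X, Y of the contact system
   through u, v: both families of 1-forms vanish on u, v at the same time,
   namely when [X, Y] belongs to the contact system. *)
Lemma ext_d_contact y u v : U y -> M y -> contact M y u -> contact M y v ->
  [/\ ext_d varpi0 y u v = 0, ext_d varpi1 y u v = 0 & ext_d varpi2 y u v = 0] <->
  [/\ ext_d (th k0) y u v = 0, ext_d (th k1) y u v = 0 & ext_d (th k2) y u v = 0].
Proof.
move=> Uy My cu cv.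
(* Keeping the frame coefficients constant extends a contact vector at [y] to a section of the
   contact system. *)
pose X w z := pairing (th k3 y) w *: E k3 z + pairing (th k4 y) w *: E k4 z +
      pairing (th k5 y) w *: E k5 z.
have cX w z : U z -> M z -> contact M z (X w z) by exact: contact_E.
have dX w : differentiable (X w) y.
  have dE i : differentiable (E i) y by exact: smooth_diff (ad_smooth_E ad i) Uy.
  by apply: differentiableD; [apply: differentiableD|]; exact: differentiableZ.
have Xu : X u y = u by rewrite [RHS](contact_expand Uy My cu).
have Xv : X v y = v by rewrite [RHS](contact_expand Uy My cv).
have tX w z : U z -> M z -> tangent M z (X w z).
  by move=> Uz Mz; have [] := cX w z Uz Mz.
pose Z := lie_bracket (X u) (X v) y.
have tZ : tangent M y Z by apply: tangent_bracket; [| |exact: dX|exact: dX|exact: tX|exact: tX].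
have key (al : 'rV[R]_8 -> 'rV[R]_8) : differentiable al y ->
    (forall z, U z -> M z -> forall w, contact M z w -> pairing (al z) w = 0) ->
    (pairing (al y) Z = 0 <-> ext_d al y u v = 0).
  move=> dal al0.
  have := @bracket_covector R _ 8 M U al id (X u) (X v) y _ _ dal (dX u) (dX v)
    (ad_open ad) Uy _ _ (tX u y Uy My) (tX v y Uy My).
  rewrite Xu Xv -/Z -/(ext_d al y u v) => ->.
  - by split => [/eqP|->]; rewrite ?oppr0 // oppr_eq0 => /eqP.
  - by [].
  - by move=> z; exact: cvg_id.
  - by move=> z Uz Mz; apply: al0 => //; exact: cX.
  - by move=> z Uz Mz; apply: al0 => //; exact: cX.
have dth i : differentiable (th i) y by exact: smooth_diff (ad_smooth_th ad i) Uy.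
have dlin (a b d : 'rV[R]_8) (i j : 'I_8) :
    differentiable (fun c : 'rV[R]_8 => a - c 0 i *: b - c 0 j *: d) y.
  have dc (l : 'I_8) : differentiable (fun c : 'rV[R]_8 => c 0 l) y.
    exact: (@differentiable_coord R 1 8).
  apply: differentiableB; first apply: differentiableB.
  - exact: differentiable_cst.
  - exact: differentiableZl.
  - exact: differentiableZl.
have v_0 : pairing (varpi0 y) Z = 0 <-> ext_d varpi0 y u v = 0.
  by apply: key; [exact: dlin|move=> z Uz Mz w [_ []]].
have v_1 : pairing (varpi1 y) Z = 0 <-> ext_d varpi1 y u v = 0.
  by apply: key; [exact: dlin|move=> z Uz Mz w [_ []]].
have v_2 : pairing (varpi2 y) Z = 0 <-> ext_d varpi2 y u v = 0.
  by apply: key; [exact: dlin|move=> z Uz Mz w [_ []]].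
have t_0 : pairing (th k0 y) Z = 0 <-> ext_d (th k0) y u v = 0.
  by apply: key; [exact: dth|move=> z Uz Mz w /(ad_contact ad Uz Mz)[]].
have t_1 : pairing (th k1 y) Z = 0 <-> ext_d (th k1) y u v = 0.
  by apply: key; [exact: dth|move=> z Uz Mz w /(ad_contact ad Uz Mz)[]].
have t_2 : pairing (th k2 y) Z = 0 <-> ext_d (th k2) y u v = 0.
  by apply: key; [exact: dth|move=> z Uz Mz w /(ad_contact ad Uz Mz)[]].
split=> [[/v_0 z0 /v_1 z1 /v_2 z2]|[/t_0 z0 /t_1 z1 /t_2 z2]].
  have /(ad_contact ad Uy My)[_ ? ? ?] : contact M y Z by split.
  by split; [exact/t_0|exact/t_1|exact/t_2].
have [_ [? ? ?]] : contact M y Z by apply/(ad_contact ad Uy My); split.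
by split; [exact/v_0|exact/v_1|exact/v_2].
Qed.

End Adapted.

(** * Integral elements in an adapted frame *)

Section Integral.
Context {R : realType}.
Context {F G : 'rV[R]_8 -> R} {U : set 'rV[R]_8}
  {th E : 'I_6 -> 'rV[R]_8 -> 'rV[R]_8} {eps del del' : R}.
Context (sF : smooth setT F) (sG : smooth setT G).
Context (ad : adapted F G U th E eps del del') (eps0 : eps != 0).
Let M := zero_set F G.

(** A vector of [P] killed by sg and ta is a multiple of [E k3]. If [E k3] is not in [P], then sg
    and ta are therefore coordinates on [P], and d varpi_2 = eps sg /\ ta takes the value eps on the
    dual basis, against integrality. *)
Lemma integral_first_vec y (P : 'M[R]_8) : U y -> M y -> integral_element M y P ->
  (E k3 y <= P)%MS.
Proof.
move=> Uy My [[_ _ rP] cP dP]; apply: contrapT => /negP nE.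
pose B := (col_mx (th k4 y) (th k5 y))^T.
have inj : \rank (P :&: kermx B)%MS = 0%N.
  apply/eqP; rewrite mxrank_eq0; apply/eqP/row_matrixP => i; rewrite row0.
  have := row_sub i (P :&: kermx B)%MS; rewrite sub_capmx => /andP[wP].
  move=> /sub_kermxP/col_mx_pairing_eq0[w4 w5].
  have := contact_expand ad Uy My (cP _ wP); rewrite w4 w5 !scale0r !addr0 => e.
  have [z|nz] := eqVneq (pairing (th k3 y) (row i (P :&: kermx B)%MS)) 0.
    by rewrite e z scale0r.
  case/negP: nE; rewrite -(eqmx_scale _ nz) -e.
  exact: wP.
have rPB : \rank (P *m B) = 2%N.
  by have := mxrank_mul_ker P B; rewrite inj addn0 => ->; exact: rP.
have full : row_full (P *m B) by rewrite /row_full rPB.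
have get (a : 'rV[R]_(1 + 1)) : exists2 u, (u <= P)%MS & u *m B = a.
  have /submxP[D ->] : (a <= P *m B)%MS by exact: submx_full.
  by exists (D *m P); [exact: submxMl|rewrite mulmxA].
have [u uP eu] := get (row_mx 1%:M 0); have [v vP ev] := get (row_mx 0 1%:M).
have pB w : w *m B = row_mx (pairing (th k4 y) w)%:M (pairing (th k5 y) w)%:M.
  rewrite /B tr_col_mx mul_mx_row; congr row_mx; apply/rowP => i;
  by rewrite ord1 pairingE !mxE eqxx mulr1n; apply: eq_bigr => j _; rewrite mxE mulrC.
have scal (a b : R) : (a%:M : 'M[R]_1) = b%:M -> a = b.
  by move/matrixP/(_ 0 0); rewrite !mxE eqxx !mulr1n.
have s0 : (0 : 'M[R]_1) = 0%:M by rewrite raddf0.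
move: eu ev; rewrite !pB s0 => /eq_row_mx[/scal u4 /scal u5] /eq_row_mx[/scal v4 /scal v5].
have cu := cP u uP; have cv := cP v vP.
have [_ _ z] := (ext_d_contact sF sG ad Uy My cu cv).1 (dP u v uP vP).
move: z; rewrite (ad_d2 ad Uy My cu cv) /wedge u4 u5 v4 v5 !mul1r mul0r subr0 mulr1.
by move/eqP; rewrite (negbTE eps0).
Qed.

Lemma frame_independent y a b : U y -> a != 0 \/ b != 0 ->
  independent (E k3 y) (a *: E k4 y + b *: E k5 y).
Proof.
move=> Uy ab p q e.
have pr i : p * (i == k3)%:R + q * (a * (i == k4)%:R + b * (i == k5)%:R) = 0 :> R.
  have := congr1 (pairing (th i y)) e.
  by rewrite pairing_linearr pairingZr pairing_linearr pairingZr !(ad_dual ad Uy) pairing0r.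
have := pr k3; have := pr k4; have := pr k5.
rewrite -!val_eqE /= !mulr0 !mulr1 !addr0 !add0r ?mulr0 ?addr0.
move=> /eqP qb /eqP qa p0; split=> //.
by move: qa qb; rewrite !mulf_eq0; case: ab => /negbTE ->; rewrite orbF; [move=> /eqP|move=> _ /eqP].
Qed.

(** On this plane sg and ta are proportional, in the ratio a : b, so sg /\ ta vanishes. The other
    two differentials already vanish on all pairs of contact vectors. *)
Lemma plane_integral y a b : U y -> M y -> a != 0 \/ b != 0 ->
  integral_element M y (plane_proj (E k3 y) (a *: E k4 y + b *: E k5 y)).
Proof.
move=> Uy My ab; have ind := frame_independent Uy ab; have g0 := gram_neq0 ind.
set h := _ + _ in ind g0 *.
have ctP v : (v <= plane_proj (E k3 y) h)%MS -> contact M y v /\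
    exists q, pairing (th k4 y) v = q * a /\ pairing (th k5 y) v = q * b.
  move=> /(sub_plane_proj g0)[p [q ->]]; split.
    by rewrite scalerDr !scalerA addrA; exact: (contact_E ad).
  exists q; rewrite !pairing_linearr !pairingZr !pairing_linearr !pairingZr.
  by rewrite !(ad_dual ad Uy) -!val_eqE /= !mulr0 !mulr1 !add0r ?addr0.
split; [split| |].
- exact: plane_proj_sym.
- exact: plane_proj_idem.
- by rewrite plane_proj_eqmx// independent_rank.
- by move=> v /ctP[].
- move=> u v /ctP[cu [qu [u4 u5]]] /ctP[cv [qv [v4 v5]]].
  apply/(ext_d_contact sF sG ad Uy My cu cv).
  have [tu u0 u1 u2] := (ad_contact ad Uy My u).1 cu.
  have [tv v0 v1 v2] := (ad_contact ad Uy My v).1 cv.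
  split.
  - by rewrite (ad_d0 ad)// /wedge u1 v1 u2 v2 !mulr0 subrr addr0.
  - exact: (ad_d1 ad).
  - by rewrite (ad_d2 ad)// /wedge u4 u5 v4 v5; ring.
Qed.

Lemma integral_proj y a b (P : 'M[R]_8) : U y -> M y -> a != 0 \/ b != 0 ->
  integral_element M y P -> ((a *: E k4 y + b *: E k5 y)%R <= P)%MS ->
  P = plane_proj (E k3 y) (a *: E k4 y + b *: E k5 y).
Proof.
move=> Uy My ab iP hP; have [[Ps Pi Pr] _ _] := iP.
have ind := frame_independent Uy ab; have f1P := integral_first_vec Uy My iP.
exact: (plane_proj_unique ind Ps Pi Pr f1P hP).
Qed.

End Integral.

(** * A chart of the prolongation *)

Section Chart.
Context {R : realType}.
Context {F G : 'rV[R]_8 -> R} {U : set 'rV[R]_8}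
  {th E : 'I_6 -> 'rV[R]_8 -> 'rV[R]_8} {eps del del' : R}.
Context (sF : smooth setT F) (sG : smooth setT G).
Context (ad : adapted F G U th E eps del del') (eps0 : eps != 0).
Local Notation V := ('rV[R]_8 * 'M[R]_8)%type.
Context (w0 : V) (Uw0 : U w0.1) (Sw0 : Sigma (zero_set F G) w0)
  (eP0 : (E k4 w0.1 <= w0.2)%MS).
Let M := zero_set F G.
Let e := E k4 w0.1.

(* On an integral element close to that of w0, the vector [e *m w.2] has a
   nonzero component on [E k4], so that the plane is spanned by [E k3] and
   [E k4 + slope *: E k5]. *)
Definition num_slope (w : V) : R := pairing (th k5 w.1) (e *m w.2).
Definition den_slope (w : V) : R := pairing (th k4 w.1) (e *m w.2).
Definition slope (w : V) : R := num_slope w / den_slope w.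
Definition second_vec (w : V) : 'rV[R]_8 := E k4 w.1 + slope w *: E k5 w.1.
(** The base point is kept, while the matrix component, which need not be a projection, is replaced
    by the projection onto the plane spanned by [E k3] and [second_vec w]. The formula thus makes
    sense on an ambient open set, including base points off R. *)
Definition retract (w : V) : V := (w.1, plane_proj (E k3 w.1) (second_vec w)).
Definition chart_dom : set V := [set w | U w.1 /\ den_slope w != 0].
Local Notation N := chart_dom.

Lemma findim_V : findim V.
Proof. by apply: findim_prod; exact: findim_mx. Qed.

Let UV : set V := @fst _ _ @^-1` U.

Let oUV : open UV.
Proof.
have -> : UV = setT `&` @fst _ _ @^-1` U by rewrite setTI.
apply: open_preimage_in; [exact: openT|exact: ad_open ad|].
by move=> x _; exact: continuous_fst.
Qed.

Lemma smooth_fst_comp (f : 'rV[R]_8 -> 'rV[R]_8) : smooth U f -> smooth UV (fun w => f w.1).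
Proof.
move=> sf k; apply: (Ck_comp (U := U)) => //.
- exact: findim_mx.
- exact: findim_mx.
- exact: ad_open ad.
- by apply: Ck_linear; [exact: linear_fst|exact: continuous_fst].
Qed.

Let smooth_eP : smooth UV (fun w : V => e *m w.2).
Proof.
move=> k; apply: Ck_mulmx => //; first exact: Ck_cst.
by apply: Ck_linear; [exact: linear_snd|exact: continuous_snd].
Qed.

Lemma smooth_den : smooth UV den_slope.
Proof.
move=> k; apply: Ck_pairing.
- exact: oUV.
- by apply: smooth_fst_comp; exact: (ad_smooth_th ad).
- exact: smooth_eP.
Qed.

Lemma open_chart_dom : open N.
Proof.
have -> : N = UV `&` den_slope @^-1` [set a | a != 0] by [].
apply: (@open_preimage_in R _ R UV [set a | a != 0] _ oUV (@open_neq R 0)).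
move=> x Ux; apply: differentiable_continuous.
exact: (smooth_diff smooth_den).
Qed.

Let NUV : N `<=` UV. Proof. by move=> w []. Qed.

Lemma smooth_slope : smooth N slope.
Proof.
move=> k; apply: Ck_mul; first exact: open_chart_dom.
  apply: Ck_pairing; first exact: open_chart_dom.
    apply: (smooth_sub NUV); apply: smooth_fst_comp; exact: (ad_smooth_th ad).
  exact: (smooth_sub NUV smooth_eP).
apply: Ck_inv; [exact: open_chart_dom|by move=> w []|].
exact: (smooth_sub NUV smooth_den).
Qed.

Lemma smooth_E_fst i : smooth N (fun w => E i w.1).
Proof.
by apply: (smooth_sub NUV); apply: smooth_fst_comp; exact: (ad_smooth_E ad).
Qed.

Lemma smooth_second_vec : smooth N second_vec.
Proof.
move=> k; apply: Ck_add; [exact: open_chart_dom|exact: smooth_E_fst|].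
apply: Ck_mulv; [exact: findim_mx|exact: open_chart_dom|exact: smooth_slope|exact: smooth_E_fst].
Qed.

Lemma second_vecE w : second_vec w = 1 *: E k4 w.1 + slope w *: E k5 w.1.
Proof. by rewrite scale1r. Qed.

Lemma one_or (a : R) : (1 : R) != 0 \/ a != 0.
Proof. by left; exact: oner_neq0. Qed.

Lemma chart_independent w : N w -> independent (E k3 w.1) (second_vec w).
Proof.
by move=> [Uw _]; rewrite second_vecE; exact: (frame_independent ad Uw (one_or _)).
Qed.

Lemma smooth_retract : smooth N retract.
Proof.
move=> k; apply: Ck_pair; first exact: open_chart_dom.
  by apply: Ck_linear; [exact: linear_fst|exact: continuous_fst].
apply: Ck_plane_proj; first exact: open_chart_dom.
- by move=> w Nw; apply: gram_neq0; exact: chart_independent.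
- exact: smooth_E_fst.
- exact: smooth_second_vec.
Qed.

Lemma retract_Sigma w : N w -> M w.1 -> Sigma M (retract w).
Proof.
move=> [Uw _] Mw; split=> //=; rewrite second_vecE.
exact: (plane_integral sF sG ad Uw Mw (one_or _)).
Qed.

(** The projection of [e] onto the plane lies in the plane, and so does [E k3]; removing the [E k3]
    component and dividing by the sg component leaves [second_vec w]. *)
Lemma second_vec_sub w : N w -> Sigma M w -> (second_vec w <= w.2)%MS.
Proof.
move=> [Uw dw] [Mw iw]; have f1w := integral_first_vec sF sG ad eps0 Uw Mw iw.
have [_ cw _] := iw.
have eq : (e *m w.2 <= w.2)%MS by exact: submxMl.
have := contact_expand ad Uw Mw (cw _ eq).
set p := pairing (th k3 _) _; rewrite -/(den_slope w) -/(num_slope w) => ee.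
have -> : second_vec w = (den_slope w)^-1 *: (e *m w.2 - p *: E k3 w.1).
  rewrite ee [_ - _]addrC -!addrA addKr scalerDr !scalerA mulVf// scale1r.
  by rewrite [_^-1 * _]mulrC.
apply: scalemx_sub; apply: addmx_sub => //.
by rewrite eqmx_opp; exact: scalemx_sub.
Qed.

Lemma retract_id w : N w -> Sigma M w -> retract w = w.
Proof.
move=> Nw Sw; have [Uw dw] := Nw; have [Mw iw] := Sw.
rewrite /retract [RHS]surjective_pairing; congr pair; rewrite second_vecE.
apply/esym/(integral_proj sF sG ad eps0 Uw Mw (one_or _) iw).
by rewrite -second_vecE; exact: second_vec_sub.
Qed.

Let eP : e *m w0.2 = e.
Proof.
have [_ [[_ PP _] _ _]] := Sw0; have /submxP[D eD] := eP0.
by rewrite /e eD -mulmxA PP.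
Qed.

Lemma den_slope0 : den_slope w0 = 1.
Proof. by rewrite /den_slope eP (ad_dual ad Uw0) eqxx. Qed.

Lemma slope0 : slope w0 = 0.
Proof. by rewrite /slope /num_slope eP (ad_dual ad Uw0) -val_eqE/= mul0r. Qed.

Lemma chart_dom0 : N w0.
Proof. by split=> //; rewrite den_slope0 oner_neq0. Qed.

Lemma second_vec0 : second_vec w0 = e.
Proof. by rewrite /second_vec slope0 scale0r addr0. Qed.

Lemma diff_fst w : differentiable (@fst 'rV[R]_8 'M[R]_8) w.
Proof. exact: (linear_fun_diff w 0 (@linear_fst R _ _) (@continuous_fst R _ _)).1. Qed.

Lemma derive_fst w (v : V) : 'D_v (@fst 'rV[R]_8 'M[R]_8) w = v.1.
Proof. exact: (linear_fun_diff w v (@linear_fst R _ _) (@continuous_fst R _ _)).2. Qed.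

Lemma diff_retract w : N w -> differentiable retract w.
Proof. exact: smooth_diff smooth_retract. Qed.

Lemma derive_retract1 w v : N w -> ('D_v retract w).1 = v.1.
Proof.
move=> Nw; have [_ <-] := derive_linear_comp v (@linear_fst R _ _)
  (@continuous_fst R _ _) (diff_retract Nw).
exact: derive_fst.
Qed.

Lemma tangent_fst w v : tangent (Sigma M) w v -> tangent M w.1 v.1.
Proof.
move=> tv; rewrite -(derive_fst w v).
apply: (@tangent_image R V _ (Sigma M) setT M w v fst) => //.
- exact: findim_V.
- exact: findim_mx.
- exact: openT.
- by move=> k; apply: Ck_linear; [exact: linear_fst|exact: continuous_fst].
- by move=> y _ [].
Qed.

Lemma tangent_retract w v : N w -> Sigma M w -> tangent M w.1 v.1 ->
  tangent (Sigma M) w ('D_v retract w).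
Proof.
move=> Nw Sw tv; rewrite -{1}(retract_id Nw Sw).
apply: (@tangent_image R V V [set y : V | M y.1] N (Sigma M) w v retract) => //.
- exact: findim_V.
- exact: findim_V.
- exact: open_chart_dom.
- exact: smooth_retract.
- by move=> y Ny My; exact: retract_Sigma.
- exact: tangent_cylinder.
Qed.

(** Over R, Sigma(R) is locally the fixed-point set of [retract]. On tangent vectors the derivatives
    of [retract] and of the identity agree, and conversely every lift of a tangent vector of R is
    pushed into Sigma(R). Linearity of the tangent space follows. *)
Lemma tangent_SigmaE w v : N w -> Sigma M w ->
  tangent (Sigma M) w v <-> tangent M w.1 v.1 /\ 'D_v retract w = v.
Proof.
move=> Nw Sw; split=> [tv|[tv <-]]; last exact: tangent_retract.
split; first exact: tangent_fst.
have did : differentiable (id : V -> V) w by exact: ex_diff.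
rewrite (tangent_derive_eq tv open_chart_dom Nw (diff_retract Nw) did).
  exact: derive_id.
exact: retract_id.
Qed.

Lemma tangent_Sigma_linear w : N w -> Sigma M w -> linear_subset (tangent (Sigma M) w).
Proof.
move=> Nw Sw; have [Uw _] := Nw; have [Mw _] := Sw.
have [T0 TD] := tangent_linear ad Uw Mw.
have lD := derive_linear (diff_retract Nw).
split.
  by apply/(tangent_SigmaE _ Nw Sw); split=> //; exact: (linear0_fun lD).
move=> a u v /(tangent_SigmaE _ Nw Sw)[tu eu] /(tangent_SigmaE _ Nw Sw)[tv ev].
apply/(tangent_SigmaE _ Nw Sw); split; first exact: TD.
by rewrite lD eu ev.
Qed.

(** The conditions that describe the tangent space are derivatives of functions vanishing along
    Sigma(R): F and G on the base point, and the matrix entries of [retract] minus the identity. The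
    bracket annihilates each of them. *)
Lemma tangent_Sigma_bracket (N' : set V) w (X Y : V -> V) : N w -> Sigma M w ->
  open N' -> N' w -> differentiable X w -> differentiable Y w ->
  (forall z, N' z -> Sigma M z -> tangent (Sigma M) z (X z)) ->
  (forall z, N' z -> Sigma M z -> tangent (Sigma M) z (Y z)) ->
  tangent (Sigma M) w (lie_bracket X Y w).
Proof.
move=> Nw Sw oN' N'w dX dY tX tY; have [Uw _] := Nw; have [Mw _] := Sw.
set Z := lie_bracket X Y w.
have oNN : open (N `&` N') by apply: openI => //; exact: open_chart_dom.
have NNw : (N `&` N') w by split.
have key (H : V -> R) : Ck 2%N N H -> (forall z, N z -> Sigma M z -> H z = 0) -> 'D_Z H w = 0.
  move=> cH H0; apply: (bracket_tangent findim_V oNN NNw _ _ dX dY Sw).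
  - by apply: Ck_sub cH => z [].
  - by move=> z [Nz _]; exact: H0.
  - by move=> z [_]; exact: tX.
  - by move=> z [_]; exact: tY.
have keyF (H : 'rV[R]_8 -> R) : smooth setT H -> (forall y, M y -> H y = 0) ->
    pairing (grad H w.1) Z.1 = 0.
  move=> sH H0; have dH := smooth_diff sH (I : setT w.1).
  rewrite -derive_grad// -{1}(derive_fst w Z) -(derive_chain _ (diff_fst w) dH).
  apply: key => [|z _ []]; last by move=> /H0.
  apply: (@Ck_comp R _ V R 2%N setT N fst H (@findim_mx R 1 8) (@findim_real R) openT open_chart_dom).
  - by [].
  - by apply: Ck_linear; [exact: linear_fst|exact: continuous_fst].
  - exact: sH.
apply/(tangent_SigmaE _ Nw Sw); split.
  apply/(ad_tangent ad Uw Mw); split; apply: keyF => //; by move=> y [].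
rewrite [LHS]surjective_pairing [RHS]surjective_pairing derive_retract1//.
congr pair; apply/matrixP => i j.
pose L (z : V) : R := z.2 i j.
have lL : linear L by move=> a u v; rewrite /L /= !mxE.
have cL : continuous L.
  move=> z; apply: (@continuous_comp _ _ _ snd (fun A : 'M[R]_8 => A i j)).
    exact: continuous_snd.
  exact: coord_continuous.
have [d1 e1] := derive_linear_comp Z lL cL (diff_retract Nw).
have [d2 e2] := linear_fun_diff w Z lL cL.
have : 'D_Z (fun z => L (retract z) - L z) w = 0.
  apply: key => [|z Nz Sz]; last by rewrite retract_id// subrr.
  apply: Ck_add; first exact: open_chart_dom.
    apply: Ck_linear_comp => //; [exact: open_chart_dom|exact: smooth_retract].
  apply: Ck_opp; first exact: open_chart_dom.
  exact: Ck_linear.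
rewrite deriveB; [|exact: diff_derivable|exact: diff_derivable].
by rewrite e1 e2 => /eqP; rewrite subr_eq0 => /eqP.
Qed.

End Chart.

(** * The filtration and its brackets at a point *)

Lemma derive_scalev (R : realType) (V : normedModType R) n (s : V -> R)
    (f : V -> 'rV[R]_n) x v :
  differentiable s x -> differentiable f x ->
  differentiable (fun y => s y *: f y) x ->
  'D_v (fun y => s y *: f y) x = 'D_v s x *: f x + s x *: 'D_v f x.
Proof.
move=> ds df dsf; apply/rowP => i.
have cE := @coord_continuous R 1 n 0 i; have lE := @linear_entry R 1 n 0 i.
have [_ e1] := derive_linear_comp v lE cE dsf.
have [dfi e2] := derive_linear_comp v lE cE df.
rewrite -e1 !mxE -e2.
rewrite (_ : (fun y => (s y *: f y) 0 i) = s * (fun y => f y 0 i)); last first.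
  by apply/funext => y; rewrite mxE.
rewrite deriveM; [|exact: diff_derivable|exact: diff_derivable].
by rewrite addrC /GRing.scale/= [f x 0 i * _]mulrC.
Qed.

(** Two functions that agree on a line through a point have the same derivative along it; this
    allows a derivative to be computed where the functions agree nowhere else. *)
Lemma derive_line0 (R : realType) (V W : normedModType R) (f : V -> W) p u :
  differentiable f p -> 'D_(1 : R) (fun s : R => f (p + s *: u)) 0 = 'D_u f p.
Proof.
move=> df.
have lin : linear (fun s : R => s *: u) by move=> a b c; rewrite scalerDl scalerA.
have cont : continuous (fun s : R => s *: u) by exact: scalel_continuous.
have [dL eL] := linear_fun_diff (0 : R) (1 : R) lin cont.
have dc : differentiable (fun s : R => p + s *: u) 0.
  by apply: differentiableD => //; exact: differentiable_cst.
have ec : 'D_(1 : R) (fun s : R => p + s *: u) 0 = u.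
  rewrite deriveD; [|exact: derivable_cst|exact: diff_derivable].
  by rewrite derive_cst add0r [LHS]eL scale1r.
have p0 : p + (0 : R) *: u = p by rewrite scale0r addr0.
have df' : differentiable f (p + (0 : R) *: u) by rewrite p0.
by rewrite (derive_chain (1 : R) dc df') ec p0.
Qed.

Lemma ext_dE (R : realType) n (th : 'rV[R]_n -> 'rV[R]_n) x (u v : 'rV[R]_n) a b c d :
  differentiable th x ->
  ext_d th x (a *: u + b *: v) (c *: u + d *: v) = (a * d - b * c) * ext_d th x u v.
Proof.
move=> dth; have lD := derive_linear dth.
have D2 p q : 'D_(p *: u + q *: v) th x = p *: 'D_u th x + q *: 'D_v th x.
  by rewrite lD (linearZ_fun _ _ lD).
rewrite /ext_d !D2; move: ('D_u th x) ('D_v th x) => p q.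
rewrite !pairing_linearl !pairingZl !pairing_linearr !pairingZr.
by move: (pairing p u) (pairing q u) (pairing p v) (pairing q v) => *; ring.
Qed.

(** * Coordinates and bracket tables of the model algebras *)

Section Rows.
Context {R : realType}.

Lemma row7P (u v : 'rV[R]_7) :
  u 0 X0 = v 0 X0 -> u 0 X1 = v 0 X1 -> u 0 X2 = v 0 X2 -> u 0 Xom1 = v 0 Xom1 ->
  u 0 Xom2 = v 0 Xom2 -> u 0 Xpi = v 0 Xpi -> u 0 Xa = v 0 Xa -> u = v.
Proof.
move=> e0 e1 e2 e3 e4 e5 e6; apply/rowP => -[[|[|[|[|[|[|[|//]]]]]]] lt];
by rewrite (bool_irrelevance lt isT).
Qed.

Lemma f0_tableE (u v : 'rV[R]_7) (w := table_bracket f0_table u v) :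
  [/\ w 0 X0 = (u 0 X1 * v 0 Xom1 - u 0 Xom1 * v 0 X1) +
               (u 0 X2 * v 0 Xom2 - u 0 Xom2 * v 0 X2),
      w 0 X1 = 0 /\ w 0 X2 = u 0 Xpi * v 0 Xom2 - u 0 Xom2 * v 0 Xpi,
      w 0 Xom1 = 0 /\ w 0 Xom2 = 0,
      w 0 Xpi = u 0 Xa * v 0 Xom2 - u 0 Xom2 * v 0 Xa & w 0 Xa = 0].
Proof.
by rewrite /w /table_bracket !big_cons big_nil !mxE -!val_eqE /=
   !mulr0 !mulr1 !add0r ?addr0.
Qed.

Lemma f1_tableE (u v : 'rV[R]_7) (w := table_bracket f1_table u v) :
  [/\ w 0 X0 = u 0 X1 * v 0 Xom1 - u 0 Xom1 * v 0 X1,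
      w 0 X1 = 0 /\ w 0 X2 = u 0 Xpi * v 0 Xom2 - u 0 Xom2 * v 0 Xpi,
      w 0 Xom1 = 0 /\ w 0 Xom2 = u 0 Xa * v 0 Xpi - u 0 Xpi * v 0 Xa,
      w 0 Xpi = 0 & w 0 Xa = 0].
Proof.
by rewrite /w /table_bracket !big_cons big_nil !mxE -!val_eqE /=
   !mulr0 !mulr1 !add0r ?addr0.
Qed.

End Rows.

Section SymbolCoordinates.
Context {R : realType}.
Context {F G : 'rV[R]_8 -> R} {U : set 'rV[R]_8}
  {th E : 'I_6 -> 'rV[R]_8 -> 'rV[R]_8} {eps del del' : R}.
Context (sF : smooth setT F) (sG : smooth setT G).
Context (ad : adapted F G U th E eps del del') (eps0 : eps != 0).
Local Notation V := ('rV[R]_8 * 'M[R]_8)%type.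
Context (w0 : V) (Uw0 : U w0.1) (Sw0 : Sigma (zero_set F G) w0)
  (eP0 : (E k4 w0.1 <= w0.2)%MS).
Let M := zero_set F G.
Local Notation slope := (@slope R th E w0).
Local Notation second_vec := (@second_vec R th E w0).
Local Notation retract := (@retract R th E w0).
Local Notation N := (@chart_dom R U th E w0).
Local Notation Fil := (filtration M).

Let Mw0 : M w0.1. Proof. by case: Sw0. Qed.
Let Nw0 : N w0. Proof. exact: (chart_dom0 ad Uw0 Sw0 eP0). Qed.
Let oN : open N. Proof. exact: (open_chart_dom ad). Qed.

Definition coframe_coord (i : 'I_6) (v : V) : R := pairing (th i w0.1) v.1.
(** This is the omega_1 /\ sg coefficient of d ta at [w0]. Absorbing it into [slope_coord] removes
    the ta component that the bracket of X_omega_1 and X_sg would otherwise have. *)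
Definition kappa : R := ext_d (th k5) w0.1 (E k3 w0.1) (E k4 w0.1).
(* At w0, where slope = 0, the restriction of -d(ta - slope sg) to the plane is
   the wedge of slope_coord and sg. *)
Definition slope_coord (v : V) : R := 'D_v slope w0 - kappa * coframe_coord k3 v.

Lemma coframe_coord_linear i : linear (coframe_coord i).
Proof. by move=> a u v; rewrite /coframe_coord pairing_linearr. Qed.

Lemma diff_slope : differentiable slope w0.
Proof.
exact: (smooth_diff (smooth_slope ad w0) Nw0).
Qed.

Lemma slope_coord_linear : linear slope_coord.
Proof.
move=> a u v; rewrite /slope_coord (derive_linear diff_slope) (coframe_coord_linear k3).
by move: ('D_u _ _) ('D_v _ _) (coframe_coord k3 u) (coframe_coord k3 v) => p q r s;
  rewrite /GRing.scale/=; ring.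
Qed.

Lemma tangent_expand v : tangent (Sigma M) w0 v ->
  v.1 = \sum_i coframe_coord i v *: E i w0.1.
Proof. by move=> /tangent_fst tv; exact: (ad_expand ad Uw0 Mw0 tv). Qed.

Lemma plane_span w v : N w -> Sigma M w -> (v <= w.2)%MS ->
  exists a b, v = a *: E k3 w.1 + b *: second_vec w.
Proof.
move=> Nw Sw; rewrite -{1}(retract_id sF sG ad eps0 Nw Sw).
by apply: sub_plane_proj; apply: gram_neq0; exact: (chart_independent ad Nw).
Qed.

Lemma pairing_plane w a b : N w ->
  [/\ pairing (th k0 w.1) (a *: E k3 w.1 + b *: second_vec w) = 0,
      pairing (th k1 w.1) (a *: E k3 w.1 + b *: second_vec w) = 0,
      pairing (th k2 w.1) (a *: E k3 w.1 + b *: second_vec w) = 0 &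
      pairing (th k5 w.1 - slope w *: th k4 w.1) (a *: E k3 w.1 + b *: second_vec w) = 0].
Proof.
move=> [Uw _]; rewrite /second_vec pairingBl pairingZl.
have pr i : pairing (th i w.1) (a *: E k3 w.1 + b *: (E k4 w.1 + slope w *: E k5 w.1)) =
   a * (i == k3)%:R + b * ((i == k4)%:R + slope w * (i == k5)%:R).
  by rewrite pairing_linearr pairingZr pairingDr pairingZr !(ad_dual ad Uw).
rewrite !pr -!val_eqE /=; move: (slope w) => s.
by split; ring.
Qed.

Lemma plane_contact w v : N w -> Sigma M w -> (v <= w.2)%MS -> contact M w.1 v.
Proof. by move=> Nw [_ [_ + _]]; apply. Qed.

(** Along all of Sigma(R) near [w0], the form ta - slope sg vanishes on F^-1. Its differential
    therefore governs the component of brackets in degree -2. *)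
Lemma Fil1_forms w v : N w -> Sigma M w -> Fil 1 w v ->
  pairing (th k5 w.1 - slope w *: th k4 w.1) v.1 = 0.
Proof.
move=> Nw Sw [_ /(plane_span Nw Sw)[a [b ->]]].
by have [] := pairing_plane a b Nw.
Qed.

Lemma Fil12 w v : N w -> Sigma M w -> Fil 1 w v -> Fil 2 w v.
Proof. by move=> Nw Sw [tv vP]; split=> //; exact: plane_contact vP. Qed.

Lemma Fil23 w v : N w -> Sigma M w -> Fil 2 w v -> Fil 3 w v.
Proof. by move=> Nw Sw [tv [_ []]]. Qed.

Lemma Fil2_forms w v : N w -> Sigma M w -> Fil 2 w v ->
  pairing (th k1 w.1) v.1 = 0 /\ pairing (th k2 w.1) v.1 = 0.
Proof.
move=> [Uw _] [Mw _] [_ cv].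
by have [] := (ad_contact ad Uw Mw _).1 cv.
Qed.

Lemma Fil3_form w v : Fil 3 w v -> pairing (th k0 w.1) v.1 = 0.
Proof. by move=> [_]; rewrite (ad_varpi0 ad). Qed.

Lemma Fil_tangent k w v : (0 < k)%N -> Fil k w v -> tangent (Sigma M) w v.
Proof. by case: k => [|[|[|[|k]]]] //= _; [case|case|case]. Qed.

Lemma Fil2E v : Fil 2 w0 v <-> Fil 3 w0 v /\ coframe_coord k1 v = 0 /\ coframe_coord k2 v = 0.
Proof.
split=> [h|[[tv v0] [v1 v2]]].
  by split; [exact: Fil23|exact: Fil2_forms].
split=> //; apply/(ad_contact ad Uw0 Mw0); split=> //; first exact: tangent_fst.
by rewrite (ad_varpi0 ad).
Qed.

Lemma Fil1E v : Fil 1 w0 v <-> Fil 2 w0 v /\ coframe_coord k5 v = 0.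
Proof.
have s0 := slope0 ad Uw0 Sw0 eP0.
split=> [h|[[tv cv] v5]].
  split; first exact: Fil12.
  by have := Fil1_forms Nw0 Sw0 h; rewrite s0 scale0r subr0.
split=> //; rewrite (contact_expand ad Uw0 Mw0 cv) -/(coframe_coord k5 v) v5 scale0r addr0.
apply: addmx_sub; apply: scalemx_sub => //.
by have [_ i0] := Sw0; exact: (integral_first_vec sF sG ad eps0 Uw0 Mw0 i0).
Qed.

(** The three coordinates together with those killed by F^-1 force v.1 = 0 and a zero derivative of
    the slope. Over a fixed base point [retract] depends on the slope alone, so its derivative along
    v, which is v itself, is zero. *)
Lemma Fil0E v : Fil 0 w0 v <->
  Fil 1 w0 v /\ [/\ coframe_coord k3 v = 0, coframe_coord k4 v = 0 & slope_coord v = 0].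
Proof.
have retr_lin := derive_linear (diff_retract ad Nw0).
have tS := tangent_SigmaE sF sG ad eps0 _ Nw0 Sw0.
have [T0 _] := tangent_Sigma_linear sF sG ad eps0 Nw0 Sw0.
split=> [->|[f1 [v3 v4 v6]]].
  split; first by split=> //; exact: sub0mx.
  by rewrite !(linear0_fun (coframe_coord_linear _)) (linear0_fun slope_coord_linear).
have [/Fil2E[f3 [v1 v2]] v5] := (Fil1E v).1 f1.
have v0 := Fil3_form f3.
have tv : tangent (Sigma M) w0 v by case: f1.
have v10 : v.1 = 0.
  rewrite (tangent_expand tv) sum6 -/k0 -/k1 -/k2 -/k3 -/k4 -/k5.
  by rewrite v1 v2 v3 v4 v5 -/(coframe_coord k0 v) [coframe_coord k0 v]v0 !scale0r !addr0.
have ds0 : 'D_v slope w0 = 0 by move: v6; rewrite /slope_coord v3 mulr0 subr0.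
have [_ rv] := (tS v).1 tv.
(* The plane of slope [a] over the fixed base point [w0.1]; along the line through [w0] in the
   direction v the matrix component of [retract] is [psi] of the slope. *)
pose psi (a : R) := plane_proj (E k3 w0.1) (E k4 w0.1 + a *: E k5 w0.1).
have spsi : smooth setT psi.
  move=> k; apply: Ck_plane_proj; first exact: openT.
  - move=> a _; apply: gram_neq0; rewrite -[E k4 _]scale1r.
    exact: (frame_independent ad Uw0 (one_or _)).
  - exact: Ck_cst.
  - apply: Ck_add; [exact: openT|exact: Ck_cst|].
    by apply: Ck_linear; [move=> a u w; rewrite scalerDl scalerA|exact: scalel_continuous].
have dpsi : differentiable psi (slope w0) by exact: (smooth_diff spsi I).
have lC : linear (fun A : 'M[R]_8 => (0 : 'rV[R]_8, A)).
  by move=> a A B; congr pair; rewrite /= scaler0 addr0.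
have e1 : 'D_v (fun w => (retract w).2) w0 = 'D_v (fun w => psi (slope w)) w0.
  have d1 : differentiable (fun w => (retract w).2) w0.
    have [h _] := derive_linear_comp v (@linear_snd R _ _) (@continuous_snd R _ _)
      (diff_retract ad Nw0).
    exact: h.
  have d2 : differentiable (fun w => psi (slope w)) w0.
    exact: differentiable_comp diff_slope dpsi.
  rewrite -(derive_line0 v d1) -(derive_line0 v d2).
  suff -> : (fun s : R => (retract (w0 + s *: v)).2) = (fun s : R => psi (slope (w0 + s *: v))).
    by [].
  apply/funext => t; rewrite /psi /retract /second_vec /=.
  by rewrite v10 scaler0 addr0.
have e2 : 'D_v (fun w => psi (slope w)) w0 = 0.
  rewrite (derive_chain v diff_slope dpsi) ds0.
  exact: (linear0_fun (derive_linear dpsi)).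
have [_ e3] := derive_linear_comp v (@linear_snd R _ _) (@continuous_snd R _ _)
   (diff_retract ad Nw0).
have v20 : v.2 = 0 by rewrite -rv -e3 e1 e2.
by rewrite /= [v]surjective_pairing v10 v20.
Qed.

Lemma Fil_linear k : linear_subset (Fil k w0).
Proof.
have [T0 TD] := tangent_Sigma_linear sF sG ad eps0 Nw0 Sw0.
have [c0 cD] := contact_linear ad Uw0 Mw0.
case: k => [|[|[|[|k]]]] /=.
- by split=> [//|a u v -> ->]; rewrite scaler0 addr0.
- split=> [|a u v [tu Pu] [tv Pv]]; split; [by []|exact: sub0mx|exact: TD|].
  by apply: addmx_sub => //; exact: scalemx_sub.
- by split=> [|a u v [tu Pu] [tv Pv]]; split; [by []|by []|exact: TD|exact: cD].
- split=> [|a u v [tu Pu] [tv Pv]]; split; [by []|exact: pairing0r|exact: TD|].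
  by rewrite pairing_linearr Pu Pv mulr0 addr0.
- by [].
Qed.


(** Frame coefficients are kept constant, but [E k4] is replaced by [second_vec w]: the plane over a
    nearby [w] is spanned by [E k3] and [second_vec w], so an extension of a vector of F^-1 stays in
    F^-1. *)
Definition lift_vec (v w : V) : 'rV[R]_8 :=
  coframe_coord k0 v *: E k0 w.1 + coframe_coord k1 v *: E k1 w.1 + coframe_coord k2 v *: E k2 w.1 +
  (coframe_coord k3 v *: E k3 w.1 + coframe_coord k4 v *: second_vec w) + coframe_coord k5 v *: E k5 w.1.

Lemma pairing_lift_vec (p : 'rV[R]_8) v w : pairing p (lift_vec v w) =
  coframe_coord k0 v * pairing p (E k0 w.1) + coframe_coord k1 v * pairing p (E k1 w.1) +
  coframe_coord k2 v * pairing p (E k2 w.1) + (coframe_coord k3 v * pairing p (E k3 w.1) +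
  coframe_coord k4 v * (pairing p (E k4 w.1) + slope w * pairing p (E k5 w.1))) +
  coframe_coord k5 v * pairing p (E k5 w.1).
Proof.
rewrite /lift_vec /second_vec; move: (slope w) (coframe_coord^~ v) => s c.
by rewrite !pairingDr !pairingZr pairingDr pairingZr.
Qed.

(** The derivative of [retract] makes the field tangent to Sigma(R) without altering its base
    component; the constant [v.2] supplies the fibre direction. *)
Definition extend (v w : V) : V := 'D_(lift_vec v w, v.2) retract w.

Lemma smooth_extend v : smooth N (extend v).
Proof.
move=> k; apply: (@Ck_dirder R V V k N retract (fun w => (lift_vec v w, v.2)) (@findim_V R) (@findim_V R) oN).
  exact: (smooth_retract ad w0 k.+1).
apply: Ck_pair; [exact: oN| |exact: Ck_cst].
have sE i : Ck k N (fun w => coframe_coord i v *: E i w.1).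
  apply: Ck_mulv; [exact: findim_mx|exact: oN|exact: Ck_cst|].
  exact: (smooth_E_fst ad w0 i k).
have sV : Ck k N (fun w => coframe_coord k4 v *: second_vec w).
  apply: Ck_mulv; [exact: findim_mx|exact: oN|exact: Ck_cst|].
  exact: (smooth_second_vec ad w0 k).
by do ![apply: Ck_add; first exact: oN].
Qed.

Lemma extend0 v : tangent (Sigma M) w0 v -> extend v w0 = v.
Proof.
move=> tv; have [_ rv] := (tangent_SigmaE sF sG ad eps0 v Nw0 Sw0).1 tv.
rewrite /extend (_ : (lift_vec v w0, v.2) = v)// [RHS]surjective_pairing.
congr pair; rewrite [RHS](tangent_expand tv) sum6 /lift_vec.
by rewrite (second_vec0 ad Uw0 Sw0 eP0) !addrA.
Qed.

Lemma extend_fst v w : N w -> (extend v w).1 = lift_vec v w.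
Proof. by move=> Nw; rewrite /extend (derive_retract1 ad _ Nw). Qed.

Lemma extend_tangent v w : N w -> Sigma M w -> tangent (Sigma M) w (extend v w).
Proof.
move=> Nw Sw; have [Uw _] := Nw; have [Mw _] := Sw.
apply: (tangent_retract sF sG ad eps0 Nw Sw); apply/(ad_tangent ad Uw Mw) => /=.
have tE i := (ad_tangent ad Uw Mw _).1 (ad_tangent_E ad Uw Mw i).
have tEF i : pairing (grad F w.1) (E i w.1) = 0 by case: (tE i).
have tEG i : pairing (grad G w.1) (E i w.1) = 0 by case: (tE i).
split.
  by rewrite pairing_lift_vec !tEF; move: (slope w) (coframe_coord^~ v) => s c; ring.
rewrite pairing_lift_vec !tEG; move: (slope w) (coframe_coord^~ v) => s c; ring.
Qed.

Lemma local_section_extend k v : (0 < k)%N -> Fil k w0 v ->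
  exists2 X : V -> V, local_section (Sigma M) (Fil k) w0 X & X w0 = v.
Proof.
move=> kpos fv; exists (extend v); last exact: extend0 (Fil_tangent kpos fv).
exists N; split; [exact: oN|exact: Nw0|exact: smooth_extend|].
move=> w Nw Sw; have [Uw _] := Nw; have [Mw iw] := Sw.
have tX := extend_tangent v Nw Sw.
case: k kpos fv => [|[|[|[|k]]]] //= _ fv.
- split=> //; rewrite extend_fst//.
  have [/Fil2E[/Fil3_form v0 [v1 v2]] v5] := (Fil1E v).1 fv.
  rewrite /lift_vec v1 v2 v5 [coframe_coord k0 v]v0 !scale0r !add0r addr0.
  apply: addmx_sub; apply: scalemx_sub.
    exact: (integral_first_vec sF sG ad eps0 Uw Mw iw).
  exact: (second_vec_sub sF sG ad eps0 Nw Sw).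
- split=> //; rewrite extend_fst//.
  have [/Fil3_form v0 [v1 v2]] := (Fil2E v).1 fv.
  rewrite /lift_vec v1 v2 [coframe_coord k0 v]v0 !scale0r !add0r /second_vec scalerDr scalerA.
  rewrite -!addrA -scalerDl addrA; exact: (contact_E ad).
- split=> //; rewrite extend_fst// -(ad_varpi0 ad).
  have v0 := @Fil3_form w0 v fv.
  rewrite pairing_lift_vec [coframe_coord k0 v]v0 !(ad_dual ad Uw) -!val_eqE /=.
  by move: (slope w) (coframe_coord^~ v) => s c; ring.
Qed.

(** A rank-one matrix carrying [E k4] to [E k5], hence a direction in which the slope grows at unit
    rate. It need not be tangent to the Grassmann bundle; the derivative of [retract] corrects this
    and preserves the rate. *)
Definition vertical : 'M[R]_8 :=
  (pairing (E k4 w0.1) (E k4 w0.1))^-1 *: ((E k4 w0.1)^T *m E k5 w0.1).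

Lemma mul_vertical : E k4 w0.1 *m vertical = E k5 w0.1.
Proof.
rewrite /vertical -scalemxAr mul_rank1 scalerA mulVf ?scale1r//.
apply/eqP => /pairing_eq0 e0; have := ad_dual ad Uw0 k4 k4.
by rewrite e0 pairing0r eqxx => /eqP; rewrite eq_sym oner_eq0.
Qed.

Lemma derive_slope_vertical : 'D_((0, vertical) : V) slope w0 = 1.
Proof.
rewrite -(derive_line0 ((0, vertical) : V) diff_slope).
suff -> : (fun s : R => slope (w0 + s *: ((0, vertical) : V))) = (id : R -> R).
  exact: derive_id.
have [_ [[_ PP _] _ _]] := Sw0; have /submxP[D eD] := eP0.
have eP : E k4 w0.1 *m w0.2 = E k4 w0.1 by rewrite eD -mulmxA PP.
apply/funext => s; rewrite /slope /num_slope /den_slope /=.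
rewrite scaler0 addr0 mulmxDr -scalemxAr mul_vertical eP.
rewrite !pairingDr !pairingZr !(ad_dual ad Uw0) -!val_eqE /=.
by rewrite mulr1 add0r mulr0 addr0 divr1.
Qed.

(** Projecting [E k4 w0.1] to the retracted plane gives a combination of [E k3] and [second_vec w],
    in which the ratio of the ta and sg components is the slope of [w]. *)
Lemma slope_retract w : N w -> N (retract w) -> slope (retract w) = slope w.
Proof.
move=> [Uw dw] [_]; rewrite /slope /num_slope /den_slope /=.
have [a [b ->]] := plane_proj_sub (E k4 w0.1) (E k3 w.1) (second_vec w).
rewrite /second_vec !pairing_linearr !pairingZr !pairingDr !pairingZr.
rewrite !(ad_dual ad Uw) -!val_eqE /= -/(slope w).
move: (slope w) => s; rewrite !mulr0 !mulr1 !add0r !addr0 mulr1 => b0.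
by rewrite mulrC mulKf.
Qed.

Lemma derive_slope_retract v : 'D_('D_v retract w0) slope w0 = 'D_v slope w0.
Proof.
have r0 := retract_id sF sG ad eps0 Nw0 Sw0.
have ds : differentiable slope (retract w0) by rewrite r0; exact: diff_slope.
have := derive_chain v (diff_retract ad Nw0) ds; rewrite r0 => <-.
have oNr : open (N `&` retract @^-1` N).
  apply: open_preimage_in; [exact: oN|exact: oN|].
  by move=> w Nw; apply: differentiable_continuous; exact: (diff_retract ad Nw).
apply: near_eq_derive.
have : nbhs w0 (N `&` retract @^-1` N).
  by apply: open_nbhs_nbhs; split=> //; split=> //; rewrite /preimage/= r0.
by apply: filterS => w [Nw Nrw]; exact: slope_retract.
Qed.

Lemma tangent_vector_exists (c : 'I_6 -> R) (t : R) :
  exists v, [/\ tangent (Sigma M) w0 v, v.1 = \sum_i c i *: E i w0.1,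
    forall i, coframe_coord i v = c i & slope_coord v = t].
Proof.
pose xi := \sum_i c i *: E i w0.1.
have co i (v : V) : v.1 = xi -> coframe_coord i v = c i.
  rewrite /coframe_coord => ->; rewrite /xi; move: (th i w0.1) (ad_dual ad Uw0 i) => p pE.
  rewrite (big_morph (pairing p) (pairingDr p) (pairing0r p)) (bigD1 i)//= big1.
    by rewrite pairingZr pE eqxx mulr1 addr0.
  by move=> j /negbTE ji; rewrite pairingZr pE eq_sym ji mulr0.
have lD := derive_linear diff_slope.
(* The slope must have derivative t + kappa c(k3) along the vector; the lift of [xi] contributes its
   own amount and the vertical direction supplies the difference. *)
pose s := t + kappa * c k3 - 'D_((xi, 0) : V) slope w0.
pose y : V := s *: ((0, vertical) : V) + ((xi, 0) : V).
have y1 : y.1 = xi by rewrite /= scaler0 add0r.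
have v1 : ('D_y retract w0).1 = xi by rewrite (derive_retract1 ad _ Nw0).
exists ('D_y retract w0); split=> //.
- apply: (tangent_retract sF sG ad eps0 Nw0 Sw0).
  apply/(ad_tangent ad Uw0 Mw0); rewrite y1.
  have tE i := (ad_tangent ad Uw0 Mw0 _).1 (ad_tangent_E ad Uw0 Mw0 i).
  split; rewrite /xi (big_morph _ (pairingDr _) (pairing0r _)) big1// => i _;
    by rewrite pairingZr ?(tE i).1 ?(tE i).2 mulr0.
- by move=> i; exact: co.
- rewrite /slope_coord derive_slope_retract (co k3 _ v1) /y lD derive_slope_vertical /s.
  move: ('D_ _ slope w0) => d; rewrite /GRing.scale/=; ring.
Qed.


Definition section_on k (N' : set V) (X : V -> V) : Prop :=
  [/\ open N', N' w0, N' `<=` N, smooth N' X &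
    forall w, N' w -> Sigma M w -> Fil k w (X w)].

Lemma local_sections_on k l X Y :
  local_section (Sigma M) (Fil k) w0 X -> local_section (Sigma M) (Fil l) w0 Y ->
  exists N', section_on k N' X /\ section_on l N' Y.
Proof.
move=> [A [oA A0 sX fX]] [B [oB B0 sY fY]].
exists (N `&` (A `&` B)).
have oNAB : open (N `&` (A `&` B)) by apply: openI; [exact: oN|exact: openI].
have h0 : (N `&` (A `&` B)) w0 by split.
split; split=> //.
- by apply: smooth_sub sX => w [_ []].
- by move=> w [_ [Aw _]]; exact: fX.
- by apply: smooth_sub sY => w [_ []].
- by move=> w [_ [_ Bw]]; exact: fY.
Qed.

Lemma section_on2 N' X : section_on 1 N' X -> section_on 2 N' X.
Proof.
move=> [oN' N'0 N'N sX fX]; split=> // w N'w Sw.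
by apply: (Fil12 (N'N _ N'w) Sw); exact: fX.
Qed.

Lemma section_on3 N' X : section_on 2 N' X -> section_on 3 N' X.
Proof.
move=> [oN' N'0 N'N sX fX]; split=> // w N'w Sw.
by apply: (Fil23 (N'N _ N'w) Sw); exact: fX.
Qed.

Lemma section_on_tangent k N' X w : (0 < k)%N -> section_on k N' X -> N' w -> Sigma M w ->
  tangent (Sigma M) w (X w).
Proof. by move=> kpos [_ _ _ _ fX] N'w Sw; apply: (Fil_tangent kpos); exact: fX. Qed.

Lemma diff_section k N' X : section_on k N' X -> differentiable X w0.
Proof. by move=> [_ N'0 _ sX _]; exact: (smooth_diff sX N'0). Qed.

Lemma bracket_section_tangent k l N' X Y : (0 < k)%N -> (0 < l)%N ->
  section_on k N' X -> section_on l N' Y ->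
  tangent (Sigma M) w0 (lie_bracket X Y w0).
Proof.
move=> kpos lpos sX sY; have [oN' N'0 _ _ _] := sX.
apply: (tangent_Sigma_bracket sF sG ad eps0 Nw0 Sw0 oN' N'0
  (diff_section sX) (diff_section sY)).
  by move=> z; exact: section_on_tangent sX.
by move=> z; exact: section_on_tangent sY.
Qed.

Lemma derive_th i : differentiable (fun w : V => th i w.1) w0 /\
  forall v, 'D_v (fun w : V => th i w.1) w0 = 'D_(v.1) (th i) w0.1.
Proof.
have dth : differentiable (th i) w0.1 by exact: (smooth_diff (ad_smooth_th ad i) Uw0).
split; first exact: differentiable_comp (diff_fst w0) dth.
by move=> v; rewrite (derive_chain v (diff_fst w0) dth) derive_fst.
Qed.

Lemma bracket_eta k l N' X Y (eta : V -> 'rV[R]_8) : (0 < k)%N -> (0 < l)%N ->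
  section_on k N' X -> section_on l N' Y -> differentiable eta w0 ->
  (forall w, N' w -> Sigma M w -> pairing (eta w) (X w).1 = 0) ->
  (forall w, N' w -> Sigma M w -> pairing (eta w) (Y w).1 = 0) ->
  pairing (eta w0) (lie_bracket X Y w0).1 =
  - (pairing ('D_(X w0) eta w0) (Y w0).1 - pairing ('D_(Y w0) eta w0) (X w0).1).
Proof.
move=> kpos lpos sX sY deta X0 Y0; have [oN' N'0 _ _ _] := sX.
exact: (bracket_covector (@linear_fst R _ _) (@continuous_fst R _ _) deta
  (diff_section sX) (diff_section sY) oN' N'0 X0 Y0
  (section_on_tangent kpos sX N'0 Sw0) (section_on_tangent lpos sY N'0 Sw0)).
Qed.

Lemma bracket_th i k l N' X Y : (0 < k)%N -> (0 < l)%N ->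
  section_on k N' X -> section_on l N' Y ->
  (forall w, N' w -> Sigma M w -> pairing (th i w.1) (X w).1 = 0) ->
  (forall w, N' w -> Sigma M w -> pairing (th i w.1) (Y w).1 = 0) ->
  coframe_coord i (lie_bracket X Y w0) = - ext_d (th i) w0.1 (X w0).1 (Y w0).1.
Proof.
move=> kpos lpos sX sY X0 Y0; have [dth eth] := derive_th i.
by rewrite /coframe_coord (bracket_eta kpos lpos sX sY dth X0 Y0) !eth.
Qed.

(** Every pair of degrees between -1 and -3 is covered at once, since varpi_0 vanishes on all of
    F^-3. *)
Lemma bracket_coord0 N' X Y : section_on 3 N' X -> section_on 3 N' Y ->
  coframe_coord k0 (lie_bracket X Y w0) =
  - (coframe_coord k3 (X w0) * coframe_coord k1 (Y w0) - coframe_coord k3 (Y w0) * coframe_coord k1 (X w0) +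
     ((del * coframe_coord k4 (X w0) + del' * coframe_coord k5 (X w0)) * coframe_coord k2 (Y w0) -
      (del * coframe_coord k4 (Y w0) + del' * coframe_coord k5 (Y w0)) * coframe_coord k2 (X w0))).
Proof.
move=> sX sY; have [_ N'0 N'N _ fX] := sX; have [_ _ _ _ fY] := sY.
have X0 w : N' w -> Sigma M w -> pairing (th k0 w.1) (X w).1 = 0.
  by move=> N'w Sw; exact: Fil3_form (fX w N'w Sw).
have Y0 w : N' w -> Sigma M w -> pairing (th k0 w.1) (Y w).1 = 0.
  by move=> N'w Sw; exact: Fil3_form (fY w N'w Sw).
rewrite (bracket_th (i := k0) (k := 3%N) (l := 3%N) isT isT sX sY X0 Y0); congr (- _).
have tX := tangent_fst (section_on_tangent (k := 3%N) isT sX N'0 Sw0).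
have tY := tangent_fst (section_on_tangent (k := 3%N) isT sY N'0 Sw0).
rewrite (ad_d0 ad Uw0 Mw0 tX tY (X0 _ N'0 Sw0) (Y0 _ N'0 Sw0)) /wedge.
by rewrite !pairing_linearl !pairingZl.
Qed.

Lemma bracket_coord12 N' X Y : section_on 2 N' X -> section_on 2 N' Y ->
  coframe_coord k1 (lie_bracket X Y w0) = 0 /\
  coframe_coord k2 (lie_bracket X Y w0) =
  - (eps * (coframe_coord k4 (X w0) * coframe_coord k5 (Y w0) - coframe_coord k4 (Y w0) * coframe_coord k5 (X w0))).
Proof.
move=> sX sY; have [_ N'0 N'N _ fX] := sX; have [_ _ _ _ fY] := sY.
have X12 w N'w Sw := Fil2_forms (N'N w N'w) Sw (fX w N'w Sw).
have Y12 w N'w Sw := Fil2_forms (N'N w N'w) Sw (fY w N'w Sw).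
have [_ cX] := fX _ N'0 Sw0; have [_ cY] := fY _ N'0 Sw0.
split.
  rewrite (bracket_th (i := k1) (k := 2%N) (l := 2%N) isT isT sX sY (fun w a b => (X12 w a b).1)
    (fun w a b => (Y12 w a b).1)).
  by rewrite (ad_d1 ad Uw0 Mw0 cX cY) oppr0.
rewrite (bracket_th (i := k2) (k := 2%N) (l := 2%N) isT isT sX sY (fun w a b => (X12 w a b).2)
  (fun w a b => (Y12 w a b).2)).
by rewrite (ad_d2 ad Uw0 Mw0 cX cY).
Qed.

Lemma Fil1_plane v : Fil 1 w0 v ->
  v.1 = coframe_coord k3 v *: E k3 w0.1 + coframe_coord k4 v *: E k4 w0.1.
Proof.
move=> f1; have [[_ cv] v5] := (Fil1E v).1 f1.
by rewrite {1}(contact_expand ad Uw0 Mw0 cv) -/(coframe_coord k5 v) v5 scale0r addr0.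
Qed.

(** Cartan's formula for ta - slope sg. The slope is zero at [w0], so the derivative of sg drops out
    and d ta - d slope /\ sg remains; on the plane d ta is kappa omega_1 /\ sg, which is the
    correction built into [slope_coord]. *)
Lemma bracket_coord5 N' X Y : section_on 1 N' X -> section_on 1 N' Y ->
  coframe_coord k5 (lie_bracket X Y w0) =
  slope_coord (X w0) * coframe_coord k4 (Y w0) - coframe_coord k4 (X w0) * slope_coord (Y w0).
Proof.
move=> sX sY; have [_ N'0 N'N _ fX] := sX; have [_ _ _ _ fY] := sY.
have s0 := slope0 ad Uw0 Sw0 eP0.
have [d4 e4] := derive_th k4; have [d5 e5] := derive_th k5.
pose eta (w : V) := th k5 w.1 - slope w *: th k4 w.1.
have dsc : differentiable (fun w : V => slope w *: th k4 w.1) w0.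
  have sN : smooth N (fun w : V => slope w *: th k4 w.1).
    move=> k; apply: Ck_mulv; [exact: findim_mx|exact: oN|exact: (smooth_slope ad w0 k)|].
    have := smooth_fst_comp ad (ad_smooth_th ad k4) k; apply: Ck_sub.
    by move=> w [].
  exact: (smooth_diff sN Nw0).
have deta : differentiable eta w0 by exact: differentiableB d5 dsc.
have eeta v : 'D_v eta w0 = 'D_(v.1) (th k5) w0.1 - 'D_v slope w0 *: th k4 w0.1.
  rewrite /eta deriveB; [|exact: diff_derivable|exact: diff_derivable].
  by rewrite (derive_scalev v diff_slope d4 dsc) s0 scale0r addr0 e5.
have X0 w N'w Sw := Fil1_forms (N'N w N'w) Sw (fX w N'w Sw).
have Y0 w N'w Sw := Fil1_forms (N'N w N'w) Sw (fY w N'w Sw).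
have := bracket_eta (k := 1%N) (l := 1%N) isT isT sX sY deta X0 Y0.
rewrite {1}/eta s0 scale0r subr0 !eeta -/(coframe_coord k5 _) => ->.
have dth5 : differentiable (th k5) w0.1.
  exact: (smooth_diff (ad_smooth_th ad k5) Uw0).
have := ext_dE (E k3 w0.1) (E k4 w0.1) (coframe_coord k3 (X w0)) (coframe_coord k4 (X w0))
  (coframe_coord k3 (Y w0)) (coframe_coord k4 (Y w0)) dth5.
rewrite -(Fil1_plane (fX _ N'0 Sw0)) -(Fil1_plane (fY _ N'0 Sw0)) -/kappa /ext_d.
rewrite /slope_coord.
move: ('D_(X w0) slope w0) ('D_(Y w0) slope w0) ('D_((X w0).1) (th k5) w0.1)
  ('D_((Y w0).1) (th k5) w0.1) => dx dy p q.
rewrite !pairingBl !pairingZl -/(coframe_coord k4 (X w0)) -/(coframe_coord k4 (Y w0)).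
move: (pairing p (Y w0).1) (pairing q (X w0).1) => p' q'.
move: (coframe_coord k3 (X w0)) (coframe_coord k4 (X w0)) (coframe_coord k3 (Y w0)) (coframe_coord k4 (Y w0)) kappa.
by move=> x3 x4 y3 y4 kap /eqP; rewrite subr_eq => /eqP ->; ring.
Qed.

End SymbolCoordinates.

(** * The model algebras *)

(* [b] is true on Sigma_1, where sg = pi and ta = omega_2. *)
Definition model_grading (b : bool) : nat -> seq 'I_7 := if b then f1_grading else f0_grading.
Definition model_table (b : bool) : seq ('I_7 * 'I_7 * 'I_7) := if b then f1_table else f0_table.

Section Model.
Context {R : realType}.

Lemma row_mask_eq0 n (g : seq 'I_n) (u : 'rV[R]_n) :
  row_mask g u = 0 <-> forall i, i \in g -> u 0 i = 0.
Proof.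
split=> [e i ig|e]; first by have /rowP/(_ i) := e; rewrite !mxE ig.
by apply/rowP => i; rewrite !mxE; case: ifP => // /e.
Qed.

Lemma model_maskE b k (u m : 'rV[R]_7) : m = row_mask (model_grading b k) u ->
  (m 0 X0 = (if k == 4 then u 0 X0 else 0)) *
  (m 0 X1 = (if k == 3 then u 0 X1 else 0)) *
  (m 0 X2 = (if k == 3 then u 0 X2 else 0)) *
  (m 0 Xom1 = (if k == 1 then u 0 Xom1 else 0)) *
  (m 0 Xom2 = (if k == (if b then 2 else 1) then u 0 Xom2 else 0)) *
  (m 0 Xpi = (if k == (if b then 1 else 2) then u 0 Xpi else 0)) *
  (m 0 Xa = (if k == 1 then u 0 Xa else 0)).
Proof.
by move=> ->; rewrite !mxE; case: b; case: k => [|[|[|[|[|k]]]]]; rewrite /= ?inE -?val_eqE.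
Qed.

Lemma model_mask_disjoint b j k (u : 'rV[R]_7) : j != k ->
  row_mask (model_grading b j) (row_mask (model_grading b k) u) = 0.
Proof.
move=> jk; have m1 := model_maskE (erefl (row_mask (model_grading b k) u)).
have m2 := model_maskE (erefl (row_mask (model_grading b j)
  (row_mask (model_grading b k) u))).
by apply: row7P; rewrite m2 m1 [RHS]mxE; case: eqVneq => // e; case: eqVneq => // e';
   rewrite e e' eqxx in jk.
Qed.

Lemma model_bracket_high b k l (u v : 'rV[R]_7) : (0 < k)%N -> (0 < l)%N -> (4 < k + l)%N ->
  table_bracket (model_table b) (row_mask (model_grading b k) u) (row_mask (model_grading b l) v) = 0.
Proof.
move=> kpos lpos kl; have := model_maskE (erefl (row_mask (model_grading b l) v)).
have := model_maskE (erefl (row_mask (model_grading b k) u)).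
move: (row_mask _ u) (row_mask _ v) => x y.
case: b => xE yE.
- have [e0 [e1 e2] [e3 e4] e5 e6] := f1_tableE x y.
  apply: row7P; rewrite ?e0 ?e1 ?e2 ?e3 ?e4 ?e5 ?e6 ?xE ?yE !mxE //=;
  case: k kpos kl {x xE e0 e1 e2 e3 e4 e5 e6} => [//|[|[|[|k]]]] _;
  case: l lpos {y yE} => [//|[|[|[|l]]]] _ //= _; rewrite ?mul0r ?mulr0 ?subrr //.
- have [e0 [e1 e2] [e3 e4] e5 e6] := f0_tableE x y.
  apply: row7P; rewrite ?e0 ?e1 ?e2 ?e3 ?e4 ?e5 ?e6 ?xE ?yE !mxE //=;
  case: k kpos kl {x xE e0 e1 e2 e3 e4 e5 e6} => [//|[|[|[|k]]]] _;
  case: l lpos {y yE} => [//|[|[|[|l]]]] _ //= _; rewrite ?mul0r ?mulr0 ?subrr ?addr0 //.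
Qed.


(** The minus signs are those of Cartan's formula, and on Sigma_1 eps = -1 compensates the exchange
    of sg and ta. By [low], ta vanishes in degree -1 and X_2 in degrees -1 and -2, so ta /\ varpi_2
    has no term in total degree -4; on Sigma_1, where omega_2 = ta, this removes the bracket of X_2
    and X_omega_2. *)
Lemma model_bracket b k l del' (x y z : 'rV[R]_7)
    (sg := if b then Xpi else Xom2) (ta := if b then Xom2 else Xpi)
    (eps : R := if b then -1 else 1) (del : R := if b then 0 else 1)
    (low := fun k (u : 'rV[R]_7) => [/\ (k <= 2)%N -> u 0 X1 = 0,
       (k <= 2)%N -> u 0 X2 = 0 & (k <= 1)%N -> u 0 ta = 0]) :
  (0 < k)%N -> (0 < l)%N -> (k + l <= 4)%N -> low k x -> low l y ->
  ((k + l)%N = 2%N -> z 0 ta = x 0 Xa * y 0 sg - x 0 sg * y 0 Xa) ->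
  ((k + l)%N = 3%N -> z 0 X1 = 0) ->
  ((k + l)%N = 3%N -> z 0 X2 = - (eps * (x 0 sg * y 0 ta - y 0 sg * x 0 ta))) ->
  ((k + l)%N = 4%N -> z 0 X0 = - (x 0 Xom1 * y 0 X1 - y 0 Xom1 * x 0 X1 +
     ((del * x 0 sg + del' * x 0 ta) * y 0 X2 -
      (del * y 0 sg + del' * y 0 ta) * x 0 X2))) ->
  row_mask (model_grading b (k + l)%N) z =
  table_bracket (model_table b) (row_mask (model_grading b k) x)
    (row_mask (model_grading b l) y).
Proof.
rewrite /low /sg /ta /eps /del {low sg ta eps del}.
move=> kpos lpos kl [x1 x2 x5] [y1 y2 y5] H2 H31 H32 H4.
have := model_maskE (erefl (row_mask (model_grading b l) y)).
have := model_maskE (erefl (row_mask (model_grading b k) x)).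
have := model_maskE (erefl (row_mask (model_grading b (k + l)%N) z)).
move: (row_mask _ x) (row_mask _ y) (row_mask _ z) => x' y' z' z'E x'E y'E.
(* The degrees are enumerated; in each case only the hypotheses whose degree condition holds are
   kept, and a polynomial identity remains. *)
case: b H2 H32 H4 x5 y5 z'E x'E y'E => H2 H32 H4 x5 y5 z'E x'E y'E;
  [have [e0 [e1 e2] [e3 e4] e5 e6] := f1_tableE x' y'
  |have [e0 [e1 e2] [e3 e4] e5 e6] := f0_tableE x' y'];
  (apply: row7P; rewrite ?e0 ?e1 ?e2 ?e3 ?e4 ?e5 ?e6 ?z'E ?x'E ?y'E;
   clear e0 e1 e2 e3 e4 e5 e6 z'E x'E y'E;
   case: k kpos kl x1 x2 x5 H2 H31 H32 H4 => [//|[|[|[|k]]]] _;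
   case: l lpos y1 y2 y5 => [//|[|[|[|l]]]] _ // y1 y2 y5 kl x1 x2 x5 H2 H31 H32 H4 //=;
   first [have {}x1 := x1 isT | clear x1]; first [have {}x2 := x2 isT | clear x2];
   first [have {}x5 := x5 isT | clear x5]; first [have {}y1 := y1 isT | clear y1];
   first [have {}y2 := y2 isT | clear y2]; first [have {}y5 := y5 isT | clear y5];
   first [have {}H2 := H2 erefl | clear H2]; first [have {}H31 := H31 erefl | clear H31];
   first [have {}H32 := H32 erefl | clear H32]; first [have {}H4 := H4 erefl | clear H4];
   rewrite ?H2 ?H31 ?H32 ?H4 ?x1 ?x2 ?x5 ?y1 ?y2 ?y5; first [ring | by move: kl; rewrite ?addSn ?addnS]).
Qed.

End Model.

(** * The symbol algebra over an adapted frame *)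

Section LocalSymbol.
Context {R : realType}.
Context {F G : 'rV[R]_8 -> R} {U : set 'rV[R]_8}
  {th E : 'I_6 -> 'rV[R]_8 -> 'rV[R]_8} {b : bool} {del' : R}.
Context (sF : smooth setT F) (sG : smooth setT G).
Local Notation eps := (if b then -1 else 1 : R).
Local Notation del := (if b then 0 else 1 : R).
Context (ad : adapted F G U th E eps del del').
Local Notation V := ('rV[R]_8 * 'M[R]_8)%type.
Context (w0 : V) (Uw0 : U w0.1) (Sw0 : Sigma (zero_set F G) w0)
  (eP0 : (E k4 w0.1 <= w0.2)%MS).
Let M := zero_set F G.
Local Notation Fil := (filtration M).
Local Notation coframe_coord := (@coframe_coord R th w0).
Local Notation slope_coord := (@slope_coord R th E w0).

Let eps0 : eps != 0.
Proof. by case: (b); rewrite ?oppr_eq0 oner_eq0. Qed.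

(** Positions follow the basis of the models: omega_2 has index 4 and pi index 5, whichever of the
    two is sg. *)
Definition symbol_coord (v : V) : 'rV[R]_7 :=
  \row_(i < 7) match nat_of_ord i with
    | 0 => coframe_coord k0 v | 1 => coframe_coord k1 v | 2 => coframe_coord k2 v | 3 => coframe_coord k3 v
    | 4 => coframe_coord (if b then k5 else k4) v | 5 => coframe_coord (if b then k4 else k5) v
    | _ => slope_coord v end.
Local Notation lam := symbol_coord.

Lemma symbol_coordE v :
  (lam v 0 X0 = coframe_coord k0 v) * (lam v 0 X1 = coframe_coord k1 v) * (lam v 0 X2 = coframe_coord k2 v) *
  (lam v 0 Xom1 = coframe_coord k3 v) * (lam v 0 Xom2 = coframe_coord (if b then k5 else k4) v) *
  (lam v 0 Xpi = coframe_coord (if b then k4 else k5) v) * (lam v 0 Xa = slope_coord v).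
Proof. by rewrite !mxE. Qed.

Lemma symbol_coord_linear : linear lam.
Proof.
move=> a u v; have l6 := slope_coord_linear ad Uw0 Sw0 eP0.
by apply: row7P; rewrite !mxE /=; exact: coframe_coord_linear || exact: l6.
Qed.

Lemma Fil_symbol k v : Fil k w0 v <->
  Fil k.+1 w0 v /\ row_mask (model_grading b k.+1) (lam v) = 0.
Proof.
have E0 := Fil0E sF sG ad eps0 Uw0 Sw0 eP0 v.
have E1 := Fil1E sF sG ad eps0 Uw0 Sw0 eP0 v.
have E2 := Fil2E ad Uw0 Sw0 eP0 v.
have E3 : Fil 3 w0 v <-> Fil 4 w0 v /\ coframe_coord k0 v = 0.
  by rewrite /coframe_coord (ad_varpi0 ad).
move: (lam v) (symbol_coordE v); case: (b) => u uE;
  [have mE := model_maskE (erefl (row_mask (model_grading true k.+1) u))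
  |have mE := model_maskE (erefl (row_mask (model_grading false k.+1) u))];
  move: (row_mask _ u) mE => m mE;
  (have -> : m = 0 <-> [/\ m 0 X0 = 0, m 0 X1 = 0 /\ m 0 X2 = 0, m 0 Xom1 = 0,
       m 0 Xom2 = 0 /\ m 0 Xpi = 0 & m 0 Xa = 0]
    by split=> [->|[? [? ?] ? [? ?] ?]]; [rewrite !mxE|apply: row7P; rewrite [RHS]mxE]);
  rewrite !mE !uE {mE uE m u};
  (case: k => [|[|[|[|k]]]]; [
    rewrite E0 /=; split=> [[f1 [c3 c4 c6]]|[f1 [_ _ c3 [c4 c5] c6]]]; split
  | rewrite E1 /=; split=> [[f1 c5]|[f1 [_ _ _ [c4 c5] _]]]; split
  | rewrite E2 /=; split=> [[f1 [c1 c2]]|[f1 [_ [c1 c2] _ _ _]]]; split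
  | rewrite E3 /=; split=> [[f1 c0]|[f1 [c0 _ _ _ _]]]; split
  | rewrite /=; split=> [f1|[f1 _]] ]) => //; split.
Qed.

Lemma symbol_coord_surj k (u : 'rV[R]_7) : (0 < k)%N ->
  graded_part (model_grading b) k u ->
  exists2 v, Fil k w0 v & row_mask (model_grading b k) (lam v) = u.
Proof.
move=> kpos /graded_part_row_mask um.
pose sg := if b then Xpi else Xom2; pose ta := if b then Xom2 else Xpi.
pose c (i : 'I_6) : R := match nat_of_ord i with
  | 0 => u 0 X0 | 1 => u 0 X1 | 2 => u 0 X2 | 3 => u 0 Xom1 | 4 => u 0 sg | _ => u 0 ta end.
have [v [tv v1 cv v6]] := tangent_vector_exists sF sG ad eps0 Uw0 Sw0 eP0 c (u 0 Xa).
have lamv : lam v = u.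
  by apply: row7P; rewrite !symbol_coordE ?cv ?v6 /c /sg /ta; case: (b).
exists v; last by rewrite lamv.
(* As [u] sits in degree k alone, the masks of [lam v] in higher degrees vanish, and [v] descends
   one step at a time from F^-(k+4), the whole tangent space, to F^-k. *)
have fil d : Fil (k + d)%N w0 v -> Fil k w0 v.
  elim: d => [|d IH]; rewrite ?addn0 ?addnS// => fd; apply: IH; apply/Fil_symbol.
  split=> //; rewrite lamv -um; apply: model_mask_disjoint.
  by rewrite gtn_eqF// ltnS leq_addr.
apply: (fil 4%N); rewrite addn4; exact: tv.
Qed.

Lemma symbol_bracket_coord k l (X Y : V -> V) : (0 < k)%N -> (0 < l)%N ->
  local_section (Sigma M) (Fil k) w0 X -> local_section (Sigma M) (Fil l) w0 Y ->
  Fil (k + l)%N w0 (lie_bracket X Y w0) /\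
  row_mask (model_grading b (k + l)%N) (lam (lie_bracket X Y w0)) =
  table_bracket (model_table b) (row_mask (model_grading b k) (lam (X w0)))
    (row_mask (model_grading b l) (lam (Y w0))).
Proof.
move=> kpos lpos lX lY.
have [N' [sX sY]] := local_sections_on ad Uw0 Sw0 eP0 lX lY.
have tZ := bracket_section_tangent sF sG ad eps0 Uw0 Sw0 eP0 kpos lpos sX sY.
(* Past degree 4 the filtration is the full tangent space and both brackets vanish. *)
have [h4|h4] := ltnP 4 (k + l).
  rewrite (model_bracket_high _ _ _ kpos lpos h4).
  by move: h4; case: (k + l)%N => [|[|[|[|[|m]]]]] // _; split=> //;
     rewrite /model_grading; case: (b); apply/row_mask_eq0.
pose Z := lie_bracket X Y w0.
have N'0 : N' w0 by case: sX.
have on3 j (W : V -> V) : (0 < j)%N -> (j <= 3)%N ->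
    @section_on R F G U th E w0 j N' W -> @section_on R F G U th E w0 3 N' W.
  move: j => [|[|[|[|j]]]] //= _ _; last exact: section_on3.
  by move=> sW; apply: section_on3; exact: section_on2.
have on2 j (W : V -> V) : (0 < j)%N -> (j <= 2)%N ->
    @section_on R F G U th E w0 j N' W -> @section_on R F G U th E w0 2 N' W.
  by move: j => [|[|[|j]]] //= _ _; exact: section_on2.
have low j (W : V -> V) : (0 < j)%N -> @section_on R F G U th E w0 j N' W ->
    [/\ (j <= 2)%N -> coframe_coord k1 (W w0) = 0,
        (j <= 2)%N -> coframe_coord k2 (W w0) = 0 &
        (j <= 1)%N -> coframe_coord k5 (W w0) = 0].
  move=> jpos sW.
  have low2 : (j <= 2)%N -> coframe_coord k1 (W w0) = 0 /\ coframe_coord k2 (W w0) = 0.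
    move=> j2; have [_ _ _ _ fW] := on2 j W jpos j2 sW.
    exact: ((Fil2E ad Uw0 Sw0 eP0 _).1 (fW _ N'0 Sw0)).2.
  split=> [/low2[]|/low2[]|j1] //.
  have ej : j = 1%N by case: j j1 jpos {sW low2} => [|[]].
  move: sW; rewrite ej => -[_ _ _ _ fW].
  exact: ((Fil1E sF sG ad eps0 Uw0 Sw0 eP0 _).1 (fW _ N'0 Sw0)).2.
have [x1 x2 x5] := low k X kpos sX; have [y1 y2 y5] := low l Y lpos sY.
have kl3 : (k <= 3)%N /\ (l <= 3)%N.
  by split; rewrite -ltnS; apply: leq_trans h4; rewrite -?[k.+1]addn1 -?[l.+1]add1n
    ?leq_add2l ?leq_add2r.
have kl2 : (k + l <= 3)%N -> (k <= 2)%N /\ (l <= 2)%N.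
  move=> h3; split; rewrite -ltnS; apply: leq_trans h3; 
  by rewrite -?[k.+1]addn1 -?[l.+1]add1n ?leq_add2l ?leq_add2r.
have kl1 : (k + l = 2)%N -> k = 1%N /\ l = 1%N.
  move: kpos lpos; case: (k) (l) => [//|[|k']] [//|[|l']] //=;
  by rewrite ?addSn ?addnS.
have c0 := bracket_coord0 ad Uw0 Sw0 (on3 k X kpos kl3.1 sX) (on3 l Y lpos kl3.2 sY).
have c12 (h3 : (k + l <= 3)%N) := bracket_coord12 ad Uw0 Sw0
  (on2 k X kpos (kl2 h3).1 sX) (on2 l Y lpos (kl2 h3).2 sY).
split.
  have F3 : (k + l <= 3)%N -> Fil 3 w0 Z.
    move=> h3; have [k_2 l_2] := kl2 h3.
    have c00 : coframe_coord k0 Z = 0.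
      by rewrite [LHS]c0 (x1 k_2) (x2 k_2) (y1 l_2) (y2 l_2) !mulr0 !subrr addr0 oppr0.
    by split=> //; rewrite -(ad_varpi0 ad).
  have F2 : (k + l)%N = 2%N -> Fil 2 w0 Z.
    move=> e2; have h3 : (k + l <= 3)%N by rewrite e2.
    have [ek el] := kl1 e2; have [c1 c2] := c12 h3.
    apply/(Fil2E ad Uw0 Sw0 eP0); split; [exact: F3|split; first exact: c1].
    by rewrite [LHS]c2 x5 ?ek// y5 ?el// !mulr0 subrr mulr0 oppr0.
  move: h4 F2 F3 kpos lpos; rewrite -/Z in tZ *; clear - tZ; case: k l => [//|k] [//|l].
  rewrite addSn addnS; move: (k + l)%N => [|[|[|m]]] h4 F2 F3 _ _.
  - exact: F2.
  - exact: F3.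
  - exact: tZ.
  - exact: tZ.
have lamE := symbol_coordE.
have lam_sg v : lam v 0 (if b then Xpi else Xom2) = coframe_coord k4 v.
  by move: (lamE v); case: (b) => ->.
have lam_ta v : lam v 0 (if b then Xom2 else Xpi) = coframe_coord k5 v.
  by move: (lamE v); case: (b) => ->.
apply: (@model_bracket R b k l del' _ _ _ kpos lpos h4); rewrite ?lam_sg ?lam_ta ?lamE //.
- move=> e2; have [ek el] := kl1 e2; move: sX sY; rewrite ek el => sX sY.
  exact: (bracket_coord5 sF sG ad eps0 Uw0 Sw0 eP0 sX sY).
- by move=> e3; have [] := c12 (eq_leq e3).
- by move=> e3; have [] := c12 (eq_leq e3).
Qed.

Theorem symbol_isomorphic_model :
  symbol_isomorphic (Sigma M) Fil w0 (model_grading b) (model_table b).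
Proof.
apply: (symbol_isomorphic_coords symbol_coord_linear).
- exact: (Fil_linear sF sG ad eps0 Uw0 Sw0 eP0).
- exact: Fil_symbol.
- exact: symbol_coord_surj.
- move=> k v kpos fv; exact: (local_section_extend sF sG ad eps0 Uw0 Sw0 eP0 kpos fv).
- by move=> k l X Y kpos lpos lX lY _ _; exact: symbol_bracket_coord.
Qed.

End LocalSymbol.

(** * Existence of adapted frames *)

Section AdaptedExistence.
Context {R : realType}.
Implicit Types (F G : 'rV[R]_8 -> R) (U : set 'rV[R]_8).

Definition six (a0 a1 a2 a3 a4 a5 : 'rV[R]_8 -> 'rV[R]_8) (i : 'I_6) :=
  match nat_of_ord i with
  | 0 => a0 | 1 => a1 | 2 => a2 | 3 => a3 | 4 => a4 | _ => a5 end.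

Lemma forall6 (P : 'I_6 -> Prop) :
  P k0 -> P k1 -> P k2 -> P k3 -> P k4 -> P k5 -> forall i, P i.
Proof.
move=> p0 p1 p2 p3 p4 p5 [[|[|[|[|[|[|//]]]]]] lt];
by rewrite (bool_irrelevance lt isT).
Qed.

Lemma congr_mod_apply m (T : set 'rV[R]_8) (ths : m.-tuple 'rV[R]_8) al be u v :
  congr_mod T ths al be -> T u -> T v ->
  (forall i, pairing (tnth ths i) u = 0) -> (forall i, pairing (tnth ths i) v = 0) ->
  al u v = be u v.
Proof.
move=> [eta e] Tu Tv u0 v0; apply/eqP; rewrite -subr_eq0 e// big1// => i _.
have im : (i < m)%N by rewrite -[X in (_ < X)%N](size_tuple ths).
have := tnth_nth 0 ths (Ordinal im); rewrite /= /wedge => <-.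
by rewrite u0 v0 !mulr0 subrr.
Qed.

(** The six forms of the coframe are completed by dF and dG, and the eight are independent because
    the tangent space is the common kernel of dF and dG. The first six dual vectors are killed by dF
    and dG, hence tangent to R. *)
Lemma adapted_exists F G (c : 'rV[R]_8) :
  regular_system F G -> involutive_system (zero_set F G) -> zero_set F G c ->
  exists U th E, adapted F G U th E 1 1 0 /\ U c.
Proof.
move=> HR HI Mc; have [sF sG _ _] := HR.
have [U [w1 [w2 [om1 [om2 [pi [oU Uc [sw1 sw2 som1 som2 spi] H]]]]]]] := HI c Mc.
pose th := six varpi0 w1 w2 om1 om2 pi.
have sv0 : smooth U varpi0.
  have sl (i : 'I_8) (w : 'rV[R]_8) k : Ck k U (fun c : 'rV[R]_8 => - (c 0 i *: w)).
    apply: (@Ck_eq _ _ _ k U (fun c : 'rV[R]_8 => c 0 i *: - w)) => //.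
      by move=> x _; rewrite scalerN.
    apply: Ck_scale => //; apply: Ck_linear; first exact: linear_entry.
    exact: coord_continuous.
  by move=> k; apply: Ck_add => //; apply: Ck_add => //; exact: Ck_cst.
have sth i : smooth U (th i) by move: i; apply: forall6.
pose th8 (j : 'I_8) y := if (j < 6)%N then th (inord j) y else
  if (j < 7)%N then grad F y else grad G y.
have th8w (i : 'I_6) (h : (6 <= 8)%N) : th8 (widen_ord h i) = th i.
  by apply/funext => y; rewrite /th8 /= ltn_ord inord_val.
have sth8 j : smooth U (th8 j).
  have [h|h] := boolP (j < 6)%N.
    rewrite (_ : th8 j = th (inord j)); first exact: sth.
    by apply/funext => y; rewrite /th8 h.
  have [h'|h'] := boolP (j < 7)%N.
    rewrite (_ : th8 j = grad F); first by apply: smooth_grad => //; exact: smooth_sub sF.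
    by apply/funext => y; rewrite /th8 (negbTE h) h'.
  rewrite (_ : th8 j = grad G); first by apply: smooth_grad => //; exact: smooth_sub sG.
  by apply/funext => y; rewrite /th8 (negbTE h) (negbTE h').
have H1 y : U y -> zero_set F G y ->
    (forall v, tangent (zero_set F G) y v <->
      pairing (grad F y) v = 0 /\ pairing (grad G y) v = 0) /\
    (forall v, tangent (zero_set F G) y v ->
      (forall i, pairing (th i y) v = 0) -> v = 0).
  move=> Uy My; have [cf _ _ _ _] := H y Uy My.
  have [T0 inj] := coframe_tangent HR My cf; split=> // v Tv v0; apply: inj => //.
  by apply: forall6; rewrite (tnth_nth 0); [exact: (v0 k0)|exact: (v0 k1)|exact: (v0 k2)
    |exact: (v0 k3)|exact: (v0 k4)|exact: (v0 k5)].
have th8F y : th8 (@Ordinal 8 6 isT) y = grad F y by [].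
have th8G y : th8 (@Ordinal 8 7 isT) y = grad G y by [].
have inj8 v : (forall j, pairing (th8 j c) v = 0) -> v = 0.
  move=> v0; have [T0 inj] := H1 c Uc Mc; apply: inj => [|i].
    by apply/T0; rewrite -th8F -th8G.
  by rewrite -(th8w i isT).
have [U' [E8 [oU' U'c U'U sE8 dE8]]] := dual_frame oU Uc sth8 inj8.
pose E (i : 'I_6) := E8 (widen_ord (isT : (6 <= 8)%N) i).
exists U', th, E; split=> //; split=> //.
- by move=> i; exact: smooth_sub (sth i).
- by move=> i; exact: sE8.
- move=> y U'y i j; have [d _] := dE8 y U'y.
  by rewrite -(th8w i isT) d.
- by move=> y /U'U Uy My; have [] := H1 y Uy My.
- move=> y U'y My i; have [d _] := dE8 y U'y; have [T0 _] := H1 y (U'U y U'y) My.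
  have lt := ltn_ord i.
  by apply/T0; rewrite -th8F -th8G !d -!val_eqE /= !gtn_eqF// (ltn_trans lt).
- move=> y U'y My v Tv; have [_ e] := dE8 y U'y; have [T0 _] := H1 y (U'U y U'y) My.
  have [vF vG] := (T0 v).1 Tv.
  rewrite {1}(e v) big_ord_recr big_ord_recr /=.
  have -> : ord_max = @Ordinal 8 7 isT by exact: val_inj.
  have -> : widen_ord (leqnSn 7) ord_max = @Ordinal 8 6 isT by exact: val_inj.
  rewrite th8F th8G vF vG !scale0r !addr0; apply: eq_bigr => i _.
  have -> : widen_ord (leqnSn 7) (widen_ord (leqnSn 6) i) =
     widen_ord (isT : (6 <= 8)%N) i by exact: val_inj.
  by rewrite (th8w i isT).
- move=> y U'y My v; have [_ eC _ _ _] := H y (U'U y U'y) My.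
  rewrite eC; split=> [[Tv [v0 v1 v2]]|[Tv v0 v1 v2]]; by split.
- move=> y U'y My u v Tu Tv u0 v0; have [_ _ e _ _] := H y (U'U y U'y) My.
  have := @congr_mod_apply 1 _ [tuple varpi0 y] _ _ u v e Tu Tv.
  rewrite scale1r scale0r addr0; apply; move=> i; by rewrite (ord1 i).
- move=> y U'y My u v cu cv; have [_ eC _ e _] := H y (U'U y U'y) My.
  move: cu cv; rewrite eC => -[Tu [u0 u1 u2]] [Tv [v0 v1 v2]].
  apply: (@congr_mod_apply 3 _ [tuple varpi0 y; w1 y; w2 y] _ _ u v e Tu Tv);
   by move=> [[|[|[|//]]] lt]; rewrite (tnth_nth 0).
- move=> y U'y My u v cu cv; have [_ eC _ _ e] := H y (U'U y U'y) My.
  move: cu cv; rewrite eC mul1r => -[Tu [u0 u1 u2]] [Tv [v0 v1 v2]].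
  apply: (@congr_mod_apply 3 _ [tuple varpi0 y; w1 y; w2 y] _ _ u v e Tu Tv);
   by move=> [[|[|[|//]]] lt]; rewrite (tnth_nth 0).
Qed.

(** Frame for Sigma_1, with sg = pi and ta = omega_2: the sign is that of omega_2 /\ pi = - pi /\
    omega_2, and omega_2 = 0 sg + 1 ta. *)
Lemma adapted_swap F G U th E : adapted F G U th E 1 1 0 ->
  let sw := tperm k4 k5 in
  adapted F G U (fun i => th (sw i)) (fun i => E (sw i)) (-1) 0 1.
Proof.
move=> ad sw.
have sw0 : sw k0 = k0 by rewrite /sw tpermD.
have sw1 : sw k1 = k1 by rewrite /sw tpermD.
have sw2 : sw k2 = k2 by rewrite /sw tpermD.
have sw3 : sw k3 = k3 by rewrite /sw tpermD.
have sw4 : sw k4 = k5 by rewrite /sw tpermL.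
have sw5 : sw k5 = k4 by rewrite /sw tpermR.
split; rewrite ?sw0 ?sw1 ?sw2 ?sw3 ?sw4 ?sw5.
- exact: ad_open ad.
- by move=> i; exact: (ad_smooth_th ad).
- by move=> i; exact: (ad_smooth_E ad).
- by move=> y Uy i j; rewrite (ad_dual ad Uy) (inj_eq perm_inj).
- exact: ad_varpi0 ad.
- by move=> y Uy My; exact: (ad_tangent ad Uy My).
- by move=> y Uy My i; exact: (ad_tangent_E ad Uy My).
- move=> y Uy My v Tv; rewrite {1}(ad_expand ad Uy My Tv).
  by rewrite (reindex_inj (@perm_inj _ sw)).
- by move=> y Uy My; exact: (ad_contact ad Uy My).
- move=> y Uy My u v Tu Tv u0 v0; rewrite (ad_d0 ad)//.
  by rewrite !scale1r !scale0r addr0 add0r.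
- by move=> y Uy My; exact: (ad_d1 ad Uy My).
- move=> y Uy My u v cu cv; rewrite (ad_d2 ad)// /wedge.
  by move: (pairing _ u) (pairing _ v) (pairing _ u) (pairing _ v) => p q r s; ring.
Qed.

(** Frame for Sigma_0: subtracting a omega_2 from pi leaves omega_2 /\ pi unchanged, and dually the
    vector of omega_2 becomes the one spanning the plane of slope [a]. *)
Lemma adapted_shear F G U th E a : adapted F G U th E 1 1 0 ->
  adapted F G U (fun i => if i == k5 then fun y => th k5 y - a *: th k4 y else th i)
    (fun i => if i == k4 then fun y => E k4 y + a *: E k5 y else E i) 1 1 0.
Proof.
move=> ad; have oU := ad_open ad.
split=> /=.
- exact: ad_open ad.
- move=> i; case: eqP => _; last exact: (ad_smooth_th ad).
  move=> k; apply: (@Ck_eq _ _ _ k U (fun y => th k5 y + (- a) *: th k4 y)) => //.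
    by move=> x _; rewrite scaleNr.
  apply: Ck_add => //; first exact: (ad_smooth_th ad).
  by apply: Ck_mulv; [exact: findim_mx| exact: oU|exact: Ck_cst|exact: (ad_smooth_th ad)].
- move=> i; case: eqP => _; last exact: (ad_smooth_E ad).
  move=> k; apply: Ck_add => //; first exact: (ad_smooth_E ad).
  by apply: Ck_mulv; [exact: findim_mx| exact: oU|exact: Ck_cst|exact: (ad_smooth_E ad)].
- move=> y Uy i j; have d := ad_dual ad Uy.
  have [->|i5] := eqVneq i k5; have [->|j4] := eqVneq j k4.
  + rewrite pairingBl pairingZl !pairingDr !pairingZr !d -!val_eqE /=; ring.
  + by rewrite pairingBl pairingZl !d [k4 == j]eq_sym (negbTE j4) mulr0 subr0.
  + by rewrite pairingDr pairingZr !d (negbTE i5) mulr0 addr0.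
  + exact: d.
- exact: ad_varpi0 ad.
- by move=> y Uy My; exact: (ad_tangent ad Uy My).
- move=> y Uy My i; case: eqP => _; last exact: (ad_tangent_E ad Uy My).
  have [_ TD] := tangent_linear ad Uy My; rewrite addrC.
  by apply: TD; exact: (ad_tangent_E ad Uy My).
- move=> y Uy My v Tv; rewrite {1}(ad_expand ad Uy My Tv) !sum6 /= -/k0 -/k1 -/k2 -/k3 -/k4 -/k5.
  rewrite -!addrA; do 4 congr (_ + _).
  rewrite scalerDr -addrA; congr (_ + _).
  by rewrite pairingBl pairingZl scalerA -scalerDl; congr (_ *: _); ring.
- by move=> y Uy My; exact: (ad_contact ad Uy My).
- move=> y Uy My u v Tu Tv u0 v0; rewrite (ad_d0 ad)//.
  by rewrite !scale0r.
- by move=> y Uy My; exact: (ad_d1 ad Uy My).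
- move=> y Uy My u v cu cv; rewrite (ad_d2 ad)// /wedge !pairingBl !pairingZl.
  by move: (pairing (th k4 y) u) (pairing (th k4 y) v) (pairing _ u) (pairing _ v) => p q r s; ring.
Qed.

End AdaptedExistence.

(** * The fibres of the projection to J^1 and the planes of the two strata *)

Section Kernel.
Context {R : realType}.

Lemma ker_pi21 (v : 'rV[R]_8) :
  v *m pi21 R = 0 -> forall i : 'I_8, (i < 5)%N -> v 0 i = 0.
Proof.
move=> e i i5; have /rowP/(_ (Ordinal i5)) := e; rewrite !mxE (bigD1 i)//= big1.
  by rewrite !mxE /= eqxx i5 mulr1 addr0.
by move=> j ji; rewrite !mxE /= val_eqE (negbTE ji) mulr0.
Qed.

Lemma fibre_coord_ker : (@fibre_coord R)^T *m pi21 R = 0.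
Proof.
apply/matrixP => i j; rewrite !mxE big1// => l _; rewrite !mxE.
have [->|] := eqVneq l (tnth [tuple jr; js; jt] i); last by rewrite mul0r.
rewrite mul1r; suff -> : (tnth [tuple jr; js; jt] i < 5)%N = false by rewrite andbF.
by case: i => [[|[|[|//]]] lt]; rewrite (tnth_nth jr).
Qed.

Lemma fibre_coord_left_inv : (@fibre_coord R)^T *m @fibre_coord R = 1%:M.
Proof.
apply/matrixP => i j; rewrite !mxE; under eq_bigr do rewrite !mxE.
have -> : (i == j) = (tnth [tuple jr; js; jt] i == tnth [tuple jr; js; jt] j).
  by move: i j => [[|[|[|//]]] li] [[|[|[|//]]] lj]; rewrite !(tnth_nth jr).
move: (tnth _ i) (tnth _ j) => a b; rewrite (bigD1 a)//= big1 ?addr0.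
  by rewrite eqxx mul1r.
by move=> l /negbTE ->; rewrite mul0r.
Qed.

Lemma unit_vec_pairing i (w : 'rV[R]_8) : pairing (unit_vec i) w = w 0 i.
Proof.
rewrite pairingE (bigD1 i)//= big1 ?addr0; first by rewrite !mxE !eqxx mul1r.
by move=> j ji; rewrite !mxE (negbTE ji) andbF mul0r.
Qed.

Lemma ext_d_varpi0 (c u v : 'rV[R]_8) : ext_d varpi0 c u v =
  (v 0 jp * u 0 jx + v 0 jq * u 0 jy) - (u 0 jp * v 0 jx + u 0 jq * v 0 jy).
Proof.
have D w : 'D_w varpi0 c = - (w 0 jp *: unit_vec jx) - w 0 jq *: unit_vec jy.
  have dl (i : 'I_8) (a : 'rV[R]_8) :
      differentiable (fun c : 'rV[R]_8 => c 0 i *: a) c /\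
      'D_w (fun c : 'rV[R]_8 => c 0 i *: a) c = w 0 i *: a.
    apply: linear_fun_diff; first by move=> b p q; rewrite !mxE scalerDl scalerA.
    move=> x; apply: (@continuous_comp _ _ _ (fun c : 'rV[R]_8 => c 0 i) (fun t => t *: a)).
      exact: coord_continuous.
    exact: scalel_continuous.
  rewrite /varpi0 deriveB; last first.
  - by apply: diff_derivable; exact: (dl jq _).1.
  - by apply: derivableB; apply: diff_derivable; [exact: differentiable_cst|exact: (dl jp _).1].
  rewrite deriveB; last first.
  - by apply: diff_derivable; exact: (dl jp _).1.
  - by apply: diff_derivable; exact: differentiable_cst.
  by rewrite (dl jp _).2 (dl jq _).2 derive_cst sub0r.
have Q (w z : 'rV[R]_8) :
    pairing (- (w 0 jp *: unit_vec jx) - w 0 jq *: unit_vec jy) z =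
    - (w 0 jp * z 0 jx) - w 0 jq * z 0 jy.
  by rewrite pairingBl -scaleNr !pairingZl !unit_vec_pairing mulNr.
rewrite /ext_d !D !Q; ring.
Qed.


Context {F G : 'rV[R]_8 -> R} {U : set 'rV[R]_8}
  {th E : 'I_6 -> 'rV[R]_8 -> 'rV[R]_8}.
Context (HR : regular_system F G) (ad : adapted F G U th E 1 1 0).
Context (c : 'rV[R]_8) (Uc : U c) (Mc : zero_set F G c).
Let M := zero_set F G.

(* The kernel of the projection to J^1 lies in the Cauchy characteristics of
   varpi_0, hence is spanned by the vector dual to pi. *)
Lemma kernel_vec (n : 'rV[R]_8) : tangent M c n -> n *m pi21 R = 0 ->
  contact M c n /\ n = pairing (th k5 c) n *: E k5 c.
Proof.
move=> Tn /ker_pi21 n0.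
have nx := n0 jx isT; have ny := n0 jy isT; have nz := n0 jz isT.
have np := n0 jp isT; have nq := n0 jq isT.
have cn : contact M c n.
  split=> //; rewrite /varpi0 /varpi1 /varpi2 /C2/=.
  rewrite !pairingBl !pairingZl !unit_vec_pairing nx ny nz np nq.
  by rewrite !mulr0 !subr0.
have d0 v : ext_d (th k0) c n v = 0.
  by rewrite (ad_varpi0 ad) ext_d_varpi0 nx ny np nq !mulr0 !mul0r addr0 subrr.
have [_ n_0 n_1 n_2] := (ad_contact ad Uc Mc n).1 cn.
(* Evaluating d varpi_0 (n, .) = 0 on [E k1] and [E k2] isolates omega_1(n) and omega_2(n). *)
have key i : (i == k1) || (i == k2) ->
    (i == k1)%:R * pairing (th k3 c) n + (i == k2)%:R * pairing (th k4 c) n = 0.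
  move=> i12; have dE := ad_dual ad Uc.
  have z0 : pairing (th k0 c) (E i c) = 0.
    by rewrite dE; case/orP: i12 => /eqP ->.
  have := ad_d0 ad Uc Mc Tn (ad_tangent_E ad Uc Mc i) n_0 z0.
  rewrite d0 /wedge scale1r scale0r addr0 !dE n_1 n_2 !mulr0 !subr0 => /esym.
  by rewrite [k1 == i]eq_sym [k2 == i]eq_sym mulrC [_ * (i == k2)%:R]mulrC.
split=> //.
rewrite {1}(contact_expand ad Uc Mc cn).
have -> : pairing (th k3 c) n = 0 by have := key k1 isT; rewrite mul1r mul0r addr0.
have -> : pairing (th k4 c) n = 0 by have := key k2 isT; rewrite mul1r mul0r add0r.
by rewrite !scale0r !add0r.
Qed.

(** Tangency imposes two linear equations on the three fibre coordinates r, s, t. *)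
Lemma kernel_exists : exists n, [/\ n != 0, tangent M c n & n *m pi21 R = 0].
Proof.
have [sF sG _ _] := HR.
pose A := col_mx (grad_rst F c) (grad_rst G c).
have : kermx A^T != 0.
  rewrite kermx_eq0 /row_free; apply/eqP => e.
  by have := rank_leq_col A^T; rewrite e.
move=> /rowV0Pn[x /sub_kermxP xA x0].
exists (x *m (@fibre_coord R)^T); split.
- apply: contra_neq x0 => e.
  by rewrite -[x]mulmx1 -fibre_coord_left_inv mulmxA e mul0mx.
- apply/(ad_tangent ad Uc Mc); apply/col_mx_pairing_eq0.
  by rewrite -mulmxA -trmx_mul mul_col_mx -!grad_rstE.
- by rewrite -mulmxA fibre_coord_ker mulmx0.
Qed.

(** A nonzero kernel vector exists and is a multiple of [E k5], so [E k5] is itself in the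
    kernel. *)
Lemma kernel_E : E k5 c *m pi21 R = 0.
Proof.
have [n [n0 Tn nk]] := kernel_exists; have [_ e] := kernel_vec Tn nk.
have p0 : pairing (th k5 c) n != 0 by apply: contra_neq n0 => p0; rewrite e p0 scale0r.
have -> : E k5 c = (pairing (th k5 c) n)^-1 *: n by rewrite {2}e scalerA mulVf// scale1r.
by rewrite -scalemxAl nk scaler0.
Qed.

Lemma Sigma1_plane (P : 'M[R]_8) : integral_element M c P ->
  \rank (P :&: kermx (pi21 R))%MS = 1%N -> (E k5 c <= P)%MS.
Proof.
move=> [_ cP _] r1.
have : (P :&: kermx (pi21 R))%MS != 0 by rewrite -mxrank_eq0 r1.
move=> /rowV0Pn[v]; rewrite sub_capmx => /andP[vP /sub_kermxP vk] v0.
have [Tv _] := cP v vP; have [_ e] := kernel_vec Tv vk.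
have p0 : pairing (th k5 c) v != 0 by apply: contra_neq v0 => p0; rewrite e p0 scale0r.
by rewrite -(eqmx_scale _ p0) -e.
Qed.

(** Transversality to the fibre excludes [E k5] from [P], which forces omega_2 to be nonzero
    somewhere on [P]. Removing the [E k3] component from such a vector and normalising gives the
    slope [a]. *)
Lemma Sigma0_plane (P : 'M[R]_8) : integral_element M c P ->
  \rank (P :&: kermx (pi21 R))%MS = 0%N ->
  exists a, ((E k4 c + a *: E k5 c)%R <= P)%MS.
Proof.
have [sF sG _ _] := HR.
move=> iP r0; have [[_ _ rP] cP _] := iP.
have f1P := integral_first_vec sF sG ad (oner_neq0 R) Uc Mc iP.
have nE5 : ~~ (E k5 c <= P)%MS.
  apply/negP => e5.
  have : (E k5 c <= P :&: kermx (pi21 R))%MS.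
    by rewrite sub_capmx e5; apply/sub_kermxP; exact: kernel_E.
  move/eqP: r0; rewrite mxrank_eq0 => /eqP ->; rewrite submx0 => /eqP z.
  by have := ad_dual ad Uc k5 k5; rewrite z pairing0r eqxx => /eqP; rewrite eq_sym oner_eq0.
have [[u [uP u4]]|no] := pselect (exists u : 'rV[R]_8, (u <= P)%MS /\ pairing (th k4 c) u != 0).
  exists (pairing (th k5 c) u / pairing (th k4 c) u).
  have e := contact_expand ad Uc Mc (cP u uP).
  have -> : E k4 c + (pairing (th k5 c) u / pairing (th k4 c) u) *: E k5 c =
      (pairing (th k4 c) u)^-1 *: (u - pairing (th k3 c) u *: E k3 c).
    rewrite {4}e [_ - _]addrC -!addrA addKr scalerDr !scalerA mulVf// scale1r.
    by rewrite [_^-1 * _]mulrC.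
  apply: scalemx_sub; apply: addmx_sub => //.
  by rewrite eqmx_opp; exact: scalemx_sub.
(* Without an [E k4] component, a vector of [P] has no [E k5] component either, since [P] contains
   [E k3] but not [E k5]; then [P] would be at most a line. *)
exfalso; have : (P <= E k3 c)%MS.
  apply/row_subP => i; have vP := row_sub i P; set v := row i P in vP *.
  have e := contact_expand ad Uc Mc (cP v vP).
  have v4 : pairing (th k4 c) v = 0.
    by apply/eqP; apply: contrapT => /negP h; apply: no; exists v.
  have v5 : pairing (th k5 c) v = 0.
    apply/eqP; apply: contrapT => /negP h; case/negP: nE5.
    rewrite -(eqmx_scale _ h).
    have -> : pairing (th k5 c) v *: E k5 c = v - pairing (th k3 c) v *: E k3 c.
      by rewrite {2}e v4 scale0r addr0 [_ - _]addrC addKr.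
    apply: addmx_sub => //.
    by rewrite eqmx_opp; exact: scalemx_sub.
  by rewrite e v4 v5 !scale0r !addr0; exact: scalemx_sub.
by move=> /mxrankS; rewrite rP leqNgt => /negP; apply; exact: (leq_ltn_trans (rank_leq_row _)).
Qed.

End Kernel.

Theorem proposition4p1 (R : realType) (F G : 'rV[R]_8 -> R)
  (HR : regular_system F G) (HI : involutive_system (zero_set F G)) :
  (forall w : ('rV[R]_8 * 'M[R]_8)%type, Sigma_ (zero_set F G) 0 w ->
     symbol_isomorphic (Sigma (zero_set F G)) (filtration (zero_set F G)) w
       f0_grading f0_table) /\
  (forall w : ('rV[R]_8 * 'M[R]_8)%type, Sigma_ (zero_set F G) 1 w ->
     symbol_isomorphic (Sigma (zero_set F G)) (filtration (zero_set F G)) w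
       f1_grading f1_table).
Proof.
have [sF sG _ _] := HR.
split=> w [Sw rk]; have [Mw iw] := Sw; have [U [th [E [ad Uw]]]] := adapted_exists HR HI Mw.
(* The shear by the slope of the plane over [w] turns that plane into ta = 0. *)
- have [a aP] := Sigma0_plane HR ad Uw Mw iw rk.
  exact: (symbol_isomorphic_model (b := false) sF sG (adapted_shear a ad) Uw Sw aP).
(* Here the plane contains the fibre direction, which the swap makes the vector dual to sg. *)
- have e5 := Sigma1_plane ad Uw Mw iw rk.
  apply: (symbol_isomorphic_model (b := true) sF sG (adapted_swap ad) Uw Sw).
  by rewrite tpermL.
Qed.
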